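(* Let $k$ be a nonnegative integer and $d$ an integer. If the set $\{1,3,d_k,d\}$ is a Diophantine quadruple in $\mathbb{Z}[\sqrt{-2}]$, then $d=d_{k-1}$ or $d=d_{k+1}$.
   Context: Let $R$ be a commutative ring with unity $1$. A set $\{a_1,\ldots,a_m\}\subset R$ is a Diophantine $m$-tuple in $R$ if $a_i\neq 0$ for all $i$, $a_i\neq a_j$ for all $i\ne j$, and $a_ia_j+1$ is a square in $R$ for all $1\le i<j\le m$. A Diophantine quadruple is a Diophantine $4$-tuple (so its four elements are nonzero and pairwise distinct). The sequence $(d_l)$ is given by $$d_l=-\frac{1}{6}\left((7+4\sqrt{3})^l+(7-4\sqrt{3})^l+4\right),$$ equivalently $d_0=-1$, $d_1=-3$, $d_{l+2}=14d_{l+1}-d_l+8$ for $l\ge 0$. For $k=0$ the symbol $d_{k-1}=d_{-1}$ is understood through the same formula, which gives $d_{-1}=-3=d_1$. *)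

(* Defs.v *)
From HB Require Import structures.
From mathcomp Require Import all_boot all_order all_algebra all_field.
From mathcomp Require Import ring lra.

Set Implicit Arguments.
Unset Strict Implicit.
Unset Printing Implicit Defensive.

Import Order.TTheory GRing.Theory Num.Theory.

Local Open Scope ring_scope.

(* The tuple lists the elements of the set {a_1, ..., a_m}. *)
Definition diophantine_tuple (R : comPzRingType) (m : nat) (a : m.-tuple R) :
    Prop :=
  [/\ forall i, tnth a i != 0,
      forall i j, i != j -> tnth a i != tnth a j
    & forall i j : 'I_m, (i < j)%N ->
        exists x : R, tnth a i * tnth a j + 1 = x ^+ 2].

Definition diophantine_quadruple (R : comPzRingType) (a : 4.-tuple R) : Prop :=
  diophantine_tuple a.

(* Zsqrt D a b stands for a + b * sqrt D. When D is a perfect square this is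
   Z[X] / (X^2 - D) rather than a subring of the complex numbers; for D < 0 the
   two agree, see zsqrt_algC and zsqrt_algC_inj. *)
Record zsqrt (D : int) := Zsqrt { zre : int; zim : int }.

Section ZsqrtRing.
Variable D : int.
Implicit Types x y : zsqrt D.

Definition zsqrt_pair x : int * int := (zre x, zim x).
Definition pair_zsqrt (p : int * int) : zsqrt D := Zsqrt D p.1 p.2.

Lemma zsqrt_pairK : cancel zsqrt_pair pair_zsqrt.
Proof. by case. Qed.

HB.instance Definition _ := Choice.copy (zsqrt D) (can_type zsqrt_pairK).

Definition zsqrt_zero : zsqrt D := Zsqrt D 0 0.
Definition zsqrt_one : zsqrt D := Zsqrt D 1 0.
Definition zsqrt_opp x : zsqrt D := Zsqrt D (- zre x) (- zim x).
Definition zsqrt_add x y : zsqrt D := Zsqrt D (zre x + zre y) (zim x + zim y).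
Definition zsqrt_mul x y : zsqrt D :=
  Zsqrt D (zre x * zre y + D * (zim x * zim y)) (zre x * zim y + zim x * zre y).

Lemma zsqrt_addA : associative zsqrt_add.
Proof. by move=> x y z; congr Zsqrt; rewrite /= addrA. Qed.

Lemma zsqrt_addC : commutative zsqrt_add.
Proof. by move=> x y; congr Zsqrt; rewrite /= addrC. Qed.

Lemma zsqrt_add0 : left_id zsqrt_zero zsqrt_add.
Proof. by case=> a b; congr Zsqrt; rewrite /= add0r. Qed.

Lemma zsqrt_addN : left_inverse zsqrt_zero zsqrt_opp zsqrt_add.
Proof. by move=> x; congr Zsqrt; rewrite /= addNr. Qed.

HB.instance Definition _ := GRing.isZmodule.Build (zsqrt D)
  zsqrt_addA zsqrt_addC zsqrt_add0 zsqrt_addN.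

Lemma zsqrt_mulA : associative zsqrt_mul.
Proof. by move=> x y z; congr Zsqrt; rewrite /=; ring. Qed.

Lemma zsqrt_mulC : commutative zsqrt_mul.
Proof. by move=> x y; congr Zsqrt; rewrite /=; ring. Qed.

Lemma zsqrt_mul1 : left_id zsqrt_one zsqrt_mul.
Proof. by case=> a b; congr Zsqrt; rewrite /=; ring. Qed.

Lemma zsqrt_mulD : left_distributive zsqrt_mul zsqrt_add.
Proof. by move=> x y z; congr Zsqrt; rewrite /=; ring. Qed.

Lemma zsqrt_one_neq0 : zsqrt_one != 0.
Proof. by []. Qed.

HB.instance Definition _ := GRing.Zmodule_isComNzRing.Build (zsqrt D)
  zsqrt_mulA zsqrt_mulC zsqrt_mul1 zsqrt_mulD zsqrt_one_neq0.

Definition zsqrt_algC x : algC :=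
  (zre x)%:~R + (zim x)%:~R * sqrtC D%:~R.

Lemma zsqrt_algC_is_zmod_morphism : zmod_morphism zsqrt_algC.
Proof. by move=> x y; rewrite /zsqrt_algC /= !intrD !intrN; ring. Qed.

HB.instance Definition _ := GRing.isZmodMorphism.Build (zsqrt D) algC
  zsqrt_algC zsqrt_algC_is_zmod_morphism.

Lemma zsqrt_algC_is_monoid_morphism : monoid_morphism zsqrt_algC.
Proof.
split=> [|x y]; first by rewrite /zsqrt_algC /= mul0r addr0.
rewrite /zsqrt_algC /= !intrD !intrM; have := sqrtCK (D%:~R : algC).
by move: (sqrtC _) => s <-; ring.
Qed.

HB.instance Definition _ := GRing.isMonoidMorphism.Build (zsqrt D) algC
  zsqrt_algC zsqrt_algC_is_monoid_morphism.

Lemma zsqrt_algC_inj : D < 0 -> injective zsqrt_algC.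
Proof.
move=> D_lt0; apply: raddf_inj => -[a b] /eqP; rewrite /zsqrt_algC /=.
rewrite addr_eq0 => /eqP ab.
have : a ^+ 2 = D * b ^+ 2.
  apply/eqP; rewrite -(eqr_int algC) intrM !rmorphXn /= ab sqrrN exprMn sqrtCK.
  by rewrite mulrC.
have [-> | b_neq0] := eqVneq b 0.
  by move/eqP; rewrite expr0n mulr0 sqrf_eq0 => /eqP->.
by move=> abE; have := sqr_ge0 a; rewrite abE pmulr_lge0 ?exprn_even_gt0 //
  leNgt D_lt0.
Qed.

End ZsqrtRing.

Fixpoint dseq_nat (n : nat) : int :=
  match n with
  | 0 => - 1
  | 1 => - 3
  | (m.+1 as p).+1 => 14 * dseq_nat p - dseq_nat m + 8
  end.

(* (d_l) for every integer l; the closed formula is even in l because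
   (7 + 4 sqrt 3) (7 - 4 sqrt 3) = 1. *)
Definition dseq (l : int) : int := dseq_nat `|l|%N.

Lemma dseqE (R : rcfType) (l : int) :
  (dseq l)%:~R =
    - (1 / 6) * ((7 + 4 * Num.sqrt 3) ^ l + (7 - 4 * Num.sqrt 3) ^ l + 4) :> R.
Proof.
set u := 7 + _; set v := 7 - _.
have s3 : Num.sqrt 3 ^+ 2 = 3 :> R by rewrite sqr_sqrtr // ler0n.
have uv : u * v = 1.
  have -> : u * v = 49 - 16 * Num.sqrt 3 ^+ 2 by rewrite /u /v; ring.
  by rewrite s3; ring.
have uD : u + v = 14 by rewrite /u /v; ring.
have natE n : (dseq_nat n)%:~R = - (1 / 6) * (u ^+ n + v ^+ n + 4) :> R.
  suff : (dseq_nat n)%:~R = - (1 / 6) * (u ^+ n + v ^+ n + 4) :> R /\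
         (dseq_nat n.+1)%:~R = - (1 / 6) * (u ^+ n.+1 + v ^+ n.+1 + 4) :> R.
    by case.
  elim: n => [|n [IH0 IH1]]; first by split; rewrite ?expr0 ?expr1 ?uD /=; field.
  split=> //.
  have -> : dseq_nat n.+2 = 14 * dseq_nat n.+1 - dseq_nat n + 8 by [].
  rewrite !intrD intrM intrN IH0 IH1.
  have xE (x y : R) : x * y = 1 -> x + y = 14 ->
      x ^+ n.+2 = 14 * x ^+ n.+1 - x ^+ n.
    move=> xy1 xy14; rewrite -xy14 !exprS.
    by rewrite -[X in _ - X]mul1r -xy1; ring.
  by rewrite (xE u v) // (xE v u) 1?mulrC 1?addrC //; field.
have uV : u^-1 = v by apply: mulr1_eq.
have vV : v^-1 = u by rewrite -uV invrK.
case: l => n; first exact: natE.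
have -> : dseq (Negz n) = dseq_nat n.+1 by [].
by rewrite /exprz natE -!exprVn uV vV [v ^+ _ + _]addrC.
Qed.

(* Main.v *)
Require Import Defs.
From Stdlib Require Import ZArith.
From mathcomp Require Import all_boot all_order all_algebra.
From mathcomp Require Import all_fingroup all_solvable all_field.
From mathcomp Require Import boolp classical_sets functions reals topology.
From mathcomp Require Import normedtype derive realfun trigo Rstruct.
From mathcomp Require Import ring lra zify.

Set Implicit Arguments.
Unset Strict Implicit.
Unset Printing Implicit Defensive.

(** Write [e_l = - d_l].  With [y_l + x_l sqrt 3 = (2 + sqrt 3)^l] one has
[e_l = 2 x_l^2 + 1].  An integer that is a square in [Z[sqrt -2]] is [a^2] or
[- 2 a^2] for an integer [a] ([zsqrt_square]).  A positive [d] is excluded by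
parity.  For a negative [d], the conditions on [d + 1] and [3 d + 1] read
[d = - 1 - 2 x^2] and [y^2 = 3 x^2 + 1]; so [d = d_l] for some [l]
([pell3_complete]), and the condition on [d_k d + 1] becomes
[z^2 = e_k e_l + 1].  As [k] and [l] differ and play symmetric roles, all that
has to be shown is [regular]: if [k < l] and [e_k e_l + 1] is a square, then
[l = k + 1].  The method depends on [k].

Large [k].  The three numbers [3 e_k], [3 e_k - 1 = 2 y_k^2] and
[3 e_k - 3 = 6 x_k^2] are close to each other, and [3 z], [2 y_l y_k],
[6 x_k x_l] are very close to [sqrt 6 x_l] times their square roots.  Small
linear forms with integer coefficients in these square roots come from
hypergeometric (Pade) approximation: expand [(X / prod_j (X + t_j))^(n+1)] in
partial fractions, put [X = s^2] and integrate over the half-line.  Every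
[(s^2 + t)^-(h+1)] contributes a rational multiple of [t^-h / sqrt t], while
the integrand lies between [0] and a constant to the power [n] times the one for
[n = 0] ([stieltjes_ge0], [partial_fractions], [pade_form_le]).  Substituting
the solution into the [n]-th form gives the integer [int_form], small by
[int_form_le] and, for [n > 0], not zero by a 2-adic argument ([int_form_neq0]).
This is absurd for [x_l] in a window which depends on [n]
([window_free]).  Successive windows overlap, so [x_l] is bounded; for [k >= 6]
the forms with [n = 0] and [n = 1] take care of what is left
([large_regular]).

[k = 3, 4, 5].  The windows overlap only from some [n] on, which leaves
[l <= 90] ([far_no_solution]); these [l] are excluded by a small prime modulo
which [e_k e_l + 1] is not a square ([middle_range]).

[k = 0] and [k = 2].  The solutions of one of the equations are given by Pell
sequences.  For [k = 2] a sieve by small primes first restricts the index.  A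
solution other than the expected one would then make [- 5], or [- 33 * 61], or
[- 33 * 29 * 257], a square modulo a suitable Pell number, against the value of
the Jacobi symbol given by quadratic reciprocity ([jacobi_eq1],
[pell3_x_plus_one], [pell3_norm22]).

[k = 1].  Factorizations into coprime squares lead to [b^4 + 1 = 2 c^2], which
is settled by Fermat's descent ([no_congruent_square], [pell3_y_plus_one]). *)

Import Order.TTheory GRing.Theory Num.Theory.
Import numFieldNormedType.Exports.

Delimit Scope Z_scope with ZZ.

(** * Pell sequences and their residues *)

Section Pell.
Variables (D a b : nat).

(** The coefficients of [(a + b sqrt D)^n]. *)
Fixpoint pell_pair (n : nat) : nat * nat :=
  if n is m.+1 then
    let: (t, u) := pell_pair m in (a * t + D * b * u, b * t + a * u)
  else (1, 0).

Definition pell_t n := (pell_pair n).1.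
Definition pell_u n := (pell_pair n).2.

Lemma pell_tS n : pell_t n.+1 = a * pell_t n + D * b * pell_u n.
Proof. by rewrite /pell_t /pell_u /=; case: (pell_pair n). Qed.

Lemma pell_uS n : pell_u n.+1 = b * pell_t n + a * pell_u n.
Proof. by rewrite /pell_t /pell_u /=; case: (pell_pair n). Qed.

Lemma pell_add m n :
  pell_t (m + n) = pell_t m * pell_t n + D * (pell_u m * pell_u n) /\
  pell_u (m + n) = pell_t m * pell_u n + pell_u m * pell_t n.
Proof.
elim: m => [|m [IHt IHu]].
  by rewrite /pell_t /pell_u /= add0n; case: (pell_pair n) => t u /=; split; ring.
by rewrite addSn !pell_tS !pell_uS IHt IHu; split; ring.
Qed.

Hypothesis norm1 : a * a = D * (b * b) + 1.

Lemma pell_norm n : pell_t n * pell_t n = D * (pell_u n * pell_u n) + 1.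
Proof.
elim: n => [|n IH]; first by rewrite /pell_t /pell_u /= mul0n muln0.
rewrite pell_tS pell_uS; move: (pell_t n) (pell_u n) IH => t u IH.
have -> : (a * t + D * b * u) * (a * t + D * b * u) =
   a * a * (t * t) + (2 * a * D * b * t * u + D * D * (b * b) * (u * u)) by ring.
rewrite norm1 IH; have -> : D * ((b * t + a * u) * (b * t + a * u)) =
  D * (b * b) * (t * t) + (2 * a * D * b * t * u + D * (a * a) * (u * u)) by ring.
by rewrite norm1 IH; ring.
Qed.

Lemma pell_double n : pell_t (2 * n) + 1 = 2 * (pell_t n * pell_t n) /\
  pell_u (2 * n) = 2 * (pell_t n * pell_u n).
Proof.
have [e1 e2] := pell_add n n; have := pell_norm n.
by rewrite mul2n -addnn e1 e2 => e3; split; [rewrite e3; lia | ring].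
Qed.

(** [T_((2k+1)n)] is [T_n] times a polynomial in [T_n], [U_n]: add [2 n] to the
    index and use that [T_n] divides [U_(2n)]. *)
Lemma pell_dvd_odd n g : odd g -> pell_t n %| pell_t (n * g).
Proof.
move=> og; have -> : g = 2 * g./2 + 1 by lia.
elim: g./2 => [|k IH]; first by rewrite muln1.
have -> : n * (2 * k.+1 + 1) = n * (2 * k + 1) + 2 * n by ring.
have [-> _] := pell_add (n * (2 * k + 1)) (2 * n); have [_ ->] := pell_double n.
apply: dvdn_add; first exact: dvdn_mulr.
by do 3 apply: dvdn_mull; exact: dvdn_mulr.
Qed.

End Pell.

(** Residues are computed with binary integers, so that the finite checks below
    evaluate quickly; [db] stands for [D * b]. *)
Fixpoint zpell_rec (a db b Q : Z) (n : nat) : Z * Z :=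
  if n is m.+1 then
    let: (t, u) := zpell_rec a db b Q m in
    ((a * t + db * u) mod Q, (b * t + a * u) mod Q)%ZZ
  else (1 mod Q, 0)%ZZ.

Section Modular.
Variables (D a b : nat) (q : nat).

Definition zpell (n : nat) : Z * Z :=
  zpell_rec (Z.of_nat a) (Z.of_nat (D * b)) (Z.of_nat b) (Z.of_nat q) n.

Hypothesis q_gt0 : 0 < q.

Lemma zpellE n : zpell n =
  (Z.of_nat (pell_t D a b n) mod Z.of_nat q, Z.of_nat (pell_u D a b n) mod Z.of_nat q)%ZZ.
Proof.
have q0 : (Z.of_nat q <> 0)%ZZ by lia.
rewrite /zpell; elim: n => [|n IH] /=; first by rewrite Z.mod_0_l.
have lin (c d u v : Z) : ((c * (u mod Z.of_nat q) + d * (v mod Z.of_nat q)) mod Z.of_nat q =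
   (c * u + d * v) mod Z.of_nat q)%ZZ.
  rewrite Z.add_mod // Z.mul_mod // Z.mod_mod // -Z.mul_mod //.
  by rewrite (Z.mul_mod d) // Z.mod_mod // -Z.mul_mod // -Z.add_mod.
rewrite IH pell_tS pell_uS !lin; congr pair; congr (_ mod _)%ZZ; lia.
Qed.

Lemma zpell_period m n k : zpell m = zpell 0 -> zpell (n + k * m) = zpell n.
Proof.
move=> per; elim: k => [|k IH]; first by rewrite addn0.
rewrite mulSn addnCA -IH; move: (n + k * m) => l {IH n}.
by move: per; rewrite /zpell; elim: l => [|l IH] per; rewrite ?addn0 // addnS /= IH.
Qed.

End Modular.

Fixpoint square_scan (n : nat) (Q v r : Z) : bool :=
  if n is m.+1 then
    if Z.eqb (r * r mod Q)%ZZ v then true else square_scan m Q v (r + 1)%ZZ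
  else false.

Definition is_square_mod (q : nat) (v : Z) : bool :=
  square_scan q (Z.of_nat q) (v mod Z.of_nat q)%ZZ 0%ZZ.

Lemma square_scanP n Q v r (k : nat) : k < n ->
  ((r + Z.of_nat k) * (r + Z.of_nat k) mod Q = v)%ZZ -> square_scan n Q v r.
Proof.
elim: n r k => // n IH r [|k] kn e /=.
  by rewrite Z.add_0_r in e; rewrite e Z.eqb_refl.
case: Z.eqb => //; apply: (IH _ k) => //; rewrite -e.
by congr (_ mod _)%ZZ; lia.
Qed.

Lemma is_square_modP q (w : Z) : 0 < q -> is_square_mod q (w * w).
Proof.
move=> q0; have q1 : (0 < Z.of_nat q)%ZZ by lia.
have b := Z.mod_pos_bound w _ q1.
apply: (@square_scanP _ _ _ _ (Z.to_nat (w mod Z.of_nat q))); first by lia.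
by rewrite Z2Nat.id ?Z.add_0_l -?Z.mul_mod //; lia.
Qed.

(** * Indices 3, 4 and 5: the second index up to 90 *)

Definition pell_x n := pell_u 3 2 1 n.
Definition pell_y n := pell_t 3 2 1 n.

(** A witness [q] against [e_k e_l + 1] being a square. *)
Definition not_square_mod k l q : bool :=
  let xk := (zpell 3 2 1 q k).2 in let xl := (zpell 3 2 1 q l).2 in
  ~~ is_square_mod q ((2 * (xk * xk) + 1) * (2 * (xl * xl) + 1) + 1)%ZZ.

Lemma not_square_modP k l q z : 0 < q -> not_square_mod k l q ->
  z * z = (2 * (pell_x k * pell_x k) + 1) * (2 * (pell_x l * pell_x l) + 1) + 1 -> False.
Proof.
move=> q0 + e; rewrite /not_square_mod !zpellE //= -/(pell_x k) -/(pell_x l) => /negP; apply.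
have q1 : (Z.of_nat q <> 0)%ZZ by lia.
have := is_square_modP (Z.of_nat z) q0.
have -> : (Z.of_nat z * Z.of_nat z = (2 * (Z.of_nat (pell_x k) * Z.of_nat (pell_x k)) + 1) *
   (2 * (Z.of_nat (pell_x l) * Z.of_nat (pell_x l)) + 1) + 1)%ZZ by lia.
rewrite /is_square_mod; move: (Z.of_nat (pell_x k)) (Z.of_nat (pell_x l)) => u v.
have m c : ((2 * ((c mod Z.of_nat q) * (c mod Z.of_nat q)) + 1) mod Z.of_nat q =
   (2 * (c * c) + 1) mod Z.of_nat q)%ZZ.
  rewrite Z.add_mod // Z.mul_mod // -(Z.mul_mod c c) // -Z.mul_mod //.
  by rewrite -Z.add_mod.
have -> // : (((2 * ((u mod Z.of_nat q) * (u mod Z.of_nat q)) + 1) *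
   (2 * ((v mod Z.of_nat q) * (v mod Z.of_nat q)) + 1) + 1) mod Z.of_nat q =
   ((2 * (u * u) + 1) * (2 * (v * v) + 1) + 1) mod Z.of_nat q)%ZZ.
rewrite Z.add_mod // Z.mul_mod // !m -Z.mul_mod //.
by rewrite -Z.add_mod.
Qed.

Definition small_primes := [seq p <- iota 5 100 | prime p].

Lemma middle_check : all (fun k => all (fun l => (l < k + 2) ||
  has (not_square_mod k l) small_primes) (iota 0 91)) (iota 3 3).
Proof. by vm_compute. Qed.

(** For each pair of indices in the range one of [small_primes] excludes a
    square. *)
Lemma middle_range k l z : 3 <= k <= 5 -> k + 2 <= l <= 90 ->
  z * z = (2 * (pell_x k * pell_x k) + 1) * (2 * (pell_x l * pell_x l) + 1) + 1 -> False.
Proof.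
move=> hk hl e; have := middle_check.
have : all (fun q => 0 < q) small_primes.
  by apply/allP => q; rewrite mem_filter => /andP[/prime_gt0].
move: small_primes => ps /allP ps0 /allP chk.
have kin : k \in iota 3 3 by rewrite mem_iota.
have lin : l \in iota 0 91 by rewrite mem_iota; lia.
have /orP[|/hasP[q qin hq]] := allP (chk k kin) l lin; first by lia.
exact: not_square_modP (ps0 q qin) hq e.
Qed.

(** * Integrating rational functions over a half-line *)

Local Open Scope ring_scope.

Section Stieltjes.
Variable R : realType.
Implicit Types t s : R.

(** [pi / 2 * wallis h] is the integral of [(s^2 + 1)^-(h+1)] over [s >= 0]. *)
Definition wallis (h : nat) : R := 'C(h.*2, h)%:R / 4 ^+ h.

Lemma bin_double_succ h : (h.+1 * 'C(h.+1.*2, h.+1) = 2 * h.*2.+1 * 'C(h.*2, h))%N.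
Proof.
have e1 : (h.+1 * 'C(h.*2.+2, h.+1) = h.*2.+2 * 'C(h.*2.+1, h))%N.
  by rewrite -mul_bin_diag.
have e2 : (h.+1 * 'C(h.*2.+1, h) = h.*2.+1 * 'C(h.*2, h))%N.
  have := mul_bin_down h.*2.+1 h; rewrite /= => ->.
  by congr (_ * _)%N; lia.
rewrite doubleS e1.
have -> : (h.*2.+2 = 2 * h.+1)%N by lia.
by rewrite -mulnA e2 mulnA.
Qed.

Lemma wallisS h : wallis h.+1 = h.*2.+1%:R / (2 * h.+1%:R) * wallis h.
Proof.
have := congr1 (fun n : nat => n%:R : R) (bin_double_succ h).
rewrite /= !natrM /wallis exprS => e.
have h0 : h.+1%:R != 0 :> R by rewrite pnatr_eq0.
have -> : 'C(h.+1.*2, h.+1)%:R = 2 * h.*2.+1%:R * 'C(h.*2, h)%:R / h.+1%:R :> R.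
  by rewrite -e mulrC mulKf.
by field; rewrite nat1r h0 expf_neq0 ?pnatr_eq0.
Qed.

(** The primitive of [(s^2 + t)^-(h+1)] that vanishes at 0, given by the usual
    reduction formula.  With it, integration over the half-line amounts to a
    derivative and a limit at infinity. *)
Fixpoint antider t (h : nat) s : R :=
  if h is p.+1 then
    (p.*2.+1%:R * antider t p s + s * ((s ^+ 2 + t) ^+ p.+1)^-1) / (2 * p.+1%:R * t)
  else atan (s / Num.sqrt t) / Num.sqrt t.

Lemma antider0 t h : antider t h 0 = 0.
Proof. by elim: h => [|h IH] /=; rewrite ?IH !mul0r ?atan0 ?mul0r // mulr0 add0r mul0r. Qed.

Lemma is_derive_antider t h s : 0 < t ->
  is_derive s (1 : R) (antider t h) ((s ^+ 2 + t) ^+ h.+1)^-1.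
Proof.
move=> t0; have q0 : s ^+ 2 + t != 0 by rewrite gt_eqF // ltr_wpDl ?sqr_ge0.
elim: h => [|h IH] /=.
  have st : Num.sqrt t != 0 by rewrite gt_eqF // sqrtr_gt0.
  rewrite expr1.
  have -> : (s ^+ 2 + t)^-1 =
      (1 + (s * (Num.sqrt t)^-1) ^+ 2)^-1 * (Num.sqrt t)^-1 * (Num.sqrt t)^-1.
    rewrite -[in LHS](sqr_sqrtr (ltW t0)).
    by field; rewrite st /= sqr_sqrtr ?ltW // addrC q0.
  have d1 : is_derive s (1 : R) ( *%R^~ (Num.sqrt t)^-1) (Num.sqrt t)^-1.
    have := is_deriveM (is_derive_id s (1:R)) (is_derive_cst (Num.sqrt t)^-1 s (1:R)).
    by move=> D; apply: (is_derive_eq D); rewrite scaler0 add0r /GRing.scale /= mulr1.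
  have d2 := @is_derive1_comp R (@atan R) ( *%R^~ (Num.sqrt t)^-1) s _ _ (is_derive1_atan _) d1.
  have := is_deriveM d2 (is_derive_cst (Num.sqrt t)^-1 s (1:R)).
  by move=> D; apply: (is_derive_eq D); rewrite scaler0 add0r /GRing.scale /= mulrC.
have d1 : is_derive s (1 : R) (fun s => (s ^+ 2 + t) ^+ h.+1)
    (h.+1%:R * (s ^+ 2 + t) ^+ h * (2 * s)).
  have d0 : is_derive s (1 : R) (fun s => s ^+ 2 + t) (2 * s).
    have -> : (fun s => s ^+ 2 + t) = (@id R) ^+ 2 + cst t by apply/funext => u.
    have := is_deriveD (is_deriveX 2 (is_derive_id s (1:R))) (is_derive_cst t s (1:R)).
    by move=> D; apply: (is_derive_eq D); rewrite addr0 /GRing.scale /= mulr1 expr1.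
  have -> : (fun s => (s ^+ 2 + t) ^+ h.+1) = (fun s => s ^+ 2 + t) ^+ h.+1.
    by apply/funext => u; rewrite fctE.
  have := is_deriveX h.+1 d0.
  by move=> D; apply: (is_derive_eq D); rewrite /GRing.scale.
have d2 := @is_deriveV R (fun s => (s ^+ 2 + t) ^+ h.+1) s _ 1 (expf_neq0 h.+1 q0) d1.
have d3 := is_deriveM (is_derive_id s (1:R)) d2.
have d4 := is_deriveM (is_derive_cst (h.*2.+1%:R : R) s (1:R)) IH.
have d5 := is_deriveM (is_deriveD d4 d3) (is_derive_cst ((2 * h.+1%:R * t)^-1 : R) s (1:R)).
have h0 : h.+1%:R != 0 :> R by rewrite pnatr_eq0.
apply: (is_derive_eq d5).
rewrite !scaler0 !addr0 !add0r /GRing.scale /= /cst.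
have -> : h.*2.+1%:R = 2 * h.+1%:R - 1 :> R.
  by rewrite -muln2 -addn1 natrD natrM -(addn1 h) natrD; ring.
rewrite !exprS; move: (h.+1%:R : R) h0 => H h0; field.
have t1 : t != 0 by rewrite gt_eqF.
apply/and4P; split; rewrite ?expr0 ?mulr1 -?expr2 ?expf_neq0 //.
Qed.

Lemma cvg_rational0 t h : 0 < t ->
  (s * ((s ^+ 2 + t) ^+ h.+1)^-1 @[s --> +oo] --> (0 : R))%classic.
Proof.
move=> t0; apply: (@squeeze_cvgr _ _ _ _ (cst 0) (fun s => s^-1 * (t ^+ h)^-1)).
- near=> s; have s0 : 0 < s by near: s; exact: nbhs_pinfty_gt.
  have q0 : 0 < s ^+ 2 + t by rewrite ltr_wpDl ?sqr_ge0.
  apply/andP; split; first by rewrite /= divr_ge0 ?exprn_ge0 // ltW.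
  rewrite exprS invfM mulrA ler_pM ?invr_ge0 ?exprn_ge0 ?divr_ge0 ?(ltW s0) ?(ltW t0) ?(ltW q0) //.
    by rewrite ler_pdivrMr // mulrC ler_pdivlMr // -expr2 lerDl ltW.
  by rewrite lef_pV2 ?posrE ?exprn_gt0 // lerXn2r ?nnegrE ?(ltW t0) ?(ltW q0) // lerDr sqr_ge0.
- exact: cvg_cst.
- suff : (s^-1 * (t ^+ h)^-1 @[s --> +oo] --> 0 * (t ^+ h)^-1)%classic by rewrite mul0r.
  apply: cvgMl.
  by apply/gtr0_cvgV0; [exact: nbhs_pinfty_gt | exact: cvg_id].
Unshelve. all: by end_near. Qed.

Lemma cvg_antider t h : 0 < t ->
  (antider t h s @[s --> +oo] --> pi / 2 * (wallis h / t ^+ h / Num.sqrt t))%classic.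
Proof.
move=> t0; elim: h => [|h IH] /=.
  rewrite /wallis bin0 !expr0 !divr1 mul1r; apply: cvgMl.
  have st : 0 < (Num.sqrt t)^-1 by rewrite invr_gt0 sqrtr_gt0.
  by apply: cvg_comp (@cvgy_atan R); apply: gt0_cvgMly => //; exact: cvg_id.
have -> : pi / 2 * (wallis h.+1 / t ^+ h.+1 / Num.sqrt t) =
   (h.*2.+1%:R * (pi / 2 * (wallis h / t ^+ h / Num.sqrt t)) + 0) / (2 * h.+1%:R * t).
  rewrite wallisS exprS addr0 -mulrA; move: (h.+1%:R : R) (pnatr_eq0 R h.+1) => H /negbT H0.
  by field; rewrite H0 /= ?gt_eqF ?sqrtr_gt0 ?exprn_gt0.
by apply: cvgMl; apply: cvgD; [apply: cvgMr | exact: cvg_rational0].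
Qed.

Lemma is_derive_bigsum (J : Type) (r : seq J) (f : J -> R -> R) (df : J -> R) s :
  (forall j, is_derive s (1 : R) (f j) (df j)) ->
  is_derive s (1 : R) (fun s => \sum_(j <- r) f j s) (\sum_(j <- r) df j).
Proof.
move=> d; elim: r => [|j r IH].
  rewrite big_nil (_ : (fun s => _) = cst 0); first exact: is_derive_cst.
  by apply/funext => u; rewrite big_nil.
rewrite big_cons (_ : (fun s => _) = f j + (fun s => \sum_(j <- r) f j s)).
  exact: is_deriveD.
by apply/funext => u; rewrite big_cons.
Qed.

Lemma cvg_bigsum (J : Type) (r : seq J) (f : J -> R -> R) (l : J -> R) :
  (forall j, (f j s @[s --> +oo] --> l j)%classic) ->
  (\sum_(j <- r) f j s @[s --> +oo] --> \sum_(j <- r) l j)%classic.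
Proof.
move=> c; elim: r => [|j r IH].
  rewrite big_nil (_ : (fun s => _) = cst 0); first exact: cvg_cst.
  by apply/funext => u; rewrite big_nil.
rewrite big_cons (_ : (fun s => _) = f j \+ (fun s => \sum_(j <- r) f j s)).
  exact: cvgD.
by apply/funext => u; rewrite big_cons.
Qed.

(** Up to the factor [pi / 2] the conclusion is the integral over [s >= 0] of
    the nonnegative function in the hypothesis: the primitive [F] increases from
    [F 0 = 0] and tends to that value. *)
Lemma stieltjes_ge0 (I : finType) (m : nat) (t : I -> R) (c : I -> nat -> R) :
  (forall i, 0 < t i) ->
  (forall s, 0 <= \sum_i \sum_(h < m) c i h / (s ^+ 2 + t i) ^+ h.+1) ->
  0 <= \sum_i \sum_(h < m) c i h * (wallis h / t i ^+ h / Num.sqrt (t i)).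
Proof.
move=> t0 f0.
pose F s := \sum_i \sum_(h < m) c i h * antider (t i) h s.
have dF s : is_derive s (1 : R) F (\sum_i \sum_(h < m) c i h / (s ^+ 2 + t i) ^+ h.+1).
  apply: is_derive_bigsum => i; apply: is_derive_bigsum => h.
  have D := is_deriveM (is_derive_cst (c i h) s (1:R)) (is_derive_antider h s (t0 i)).
  by apply: (is_derive_eq D); rewrite scaler0 addr0.
have F0 s : 0 <= s -> 0 <= F s.
  move=> s0; have <- : F 0 = 0.
    by rewrite /F big1 // => i _; rewrite big1 // => h _; rewrite antider0 mulr0.
  apply: (@ger0_derive1_ndecry R F 0) => //.
  - by move=> x _; rewrite derive1E (@derive_val _ _ _ _ _ _ _ (dF x)).
  - by apply: derivable_within_continuous => x _; exact: (@ex_derive _ _ _ _ _ _ _ (dF x)).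
have cF : (F s @[s --> +oo] -->
   pi / 2 * \sum_i \sum_(h < m) c i h * (wallis h / t i ^+ h / Num.sqrt (t i)))%classic.
  rewrite mulr_sumr; apply: cvg_bigsum => i; rewrite mulr_sumr.
  by apply: cvg_bigsum => h; rewrite mulrCA; apply: cvgMr; exact: cvg_antider.
rewrite -(pmulr_rge0 _ (_ : 0 < pi / 2)) ?divr_gt0 ?pi_gt0 //.
apply: cvgr_to_ge cF _; near=> s; apply: F0; near: s; exact: nbhs_pinfty_ge.
Unshelve. all: by end_near. Qed.
End Stieltjes.

(** * Partial fractions with integer numerators *)

(** The truncated expansion of [1 / (1 + r X)]. *)
Definition geometric_poly (m : nat) (r : int) : {poly int} := \poly_(i < m) (- r) ^+ i.

(** Let [Y = (X + t_j) / t_j] and [r_l = t_j / (t_l - t_j)].  Then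
    [X = t_j (Y - 1)] and [X + t_l = (t_l - t_j) (1 + r_l Y)]; so, up to a
    constant, this polynomial in [Y] is [X / prod_(l != j) (X + t_l)] modulo
    [Y^m], with integer coefficients once the [r_l] are integers. *)
Definition pade_poly (m : nat) (rs : seq int) : {poly int} :=
  ('X - 1) * \prod_(r <- rs) geometric_poly m r.

(** The numerators that multiply [sqrt t_j] after integration: [wallis (n - i)]
    is [4^i 'C(2 (n - i), n - i)] up to the common denominator [4^n]. *)
Definition pade_num (n : nat) (rs : seq int) : int :=
  \sum_(i < n.+1) 4 ^+ i * 'C((n - i).*2, n - i)%:Z * (pade_poly n.+1 rs ^+ n.+1)`_i.

Section Congruence.
Variable F : fieldType.
Implicit Types d p q : {poly F}.

Lemma dvdp_subM d p p' q q' :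
  d %| p - p' -> d %| q - q' -> d %| p * q - p' * q'.
Proof.
move=> dp dq; have -> : p * q - p' * q' = (p - p') * q + p' * (q - q') by ring.
by apply: dvdp_add; [exact: dvdp_mulr | exact: dvdp_mull].
Qed.

Lemma dvdp_subX d p q k : d %| p - q -> d %| p ^+ k - q ^+ k.
Proof.
by move=> h; elim: k => [|k IH]; rewrite ?expr0 ?subrr ?dvdp0 // !exprS dvdp_subM.
Qed.

Lemma dvdp_sub_prod d (J : finType) (P : pred J) (f g : J -> {poly F}) :
  (forall j, P j -> d %| f j - g j) ->
  d %| \prod_(j | P j) f j - \prod_(j | P j) g j.
Proof.
move=> h; elim/big_ind2: _ => [|????|j Pj].
- by rewrite subrr dvdp0.
- exact: dvdp_subM.
- exact: h.
Qed.

Lemma dvdp_bigsum d (J : finType) (P : pred J) (f : J -> {poly F}) :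
  (forall j, P j -> d %| f j) -> d %| \sum_(j | P j) f j.
Proof.
move=> h; elim/big_ind: _ => [|p q|j Pj]; [exact: dvdp0 | exact: dvdp_add | exact: h].
Qed.

(** Only the first [m] coefficients of [p] matter in [p(q)] modulo [q^m]. *)
Lemma dvdp_comp_trunc m p q :
  q ^+ m %| p \Po q - \sum_(i < m) p`_i *: q ^+ i.
Proof.
have -> : \sum_(i < m) p`_i *: q ^+ i = take_poly m p \Po q.
  rewrite /take_poly poly_def rmorph_sum /=; apply: eq_bigr => i _.
  by rewrite comp_polyZ comp_Xn_poly.
rewrite -{1}(poly_take_drop m p) comp_polyD comp_polyM comp_Xn_poly.
by rewrite addrAC subrr add0r dvdp_mulIr.
Qed.

Lemma dvdp_prod_coprime (J : finType) (f : J -> {poly F}) p :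
  (forall i j, i != j -> coprimep (f i) (f j)) -> (forall j, f j %| p) ->
  \prod_j f j %| p.
Proof.
move=> cop dv; suff : forall s : seq J, uniq s -> \prod_(j <- s) f j %| p.
  by apply; exact: index_enum_uniq.
elim=> [|j s IH] /=; first by rewrite big_nil dvd1p.
case/andP=> js us; rewrite big_cons Gauss_dvdp ?dv ?IH //.
rewrite coprimep_sym; elim: s js {us IH} => [|i s IH]; first by rewrite big_nil coprime1p.
rewrite inE negb_or => /andP[ji js]; rewrite big_cons coprimepMl IH // andbT.
by rewrite cop // eq_sym.
Qed.

End Congruence.

Section PartialFractions.
Variables (R : numFieldType) (I : finType) (t : I -> R) (r : I -> I -> int).
Hypothesis t_neq0 : forall j, t j != 0.
Hypothesis rE : forall j l, l != j -> (r j l)%:~R * (t l - t j) = t j.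

Definition ratios (j : I) : seq int := [seq r j l | l in predC1 j].
Definition node_diff (j : I) : R := \prod_(l | l != j) (t l - t j).

Lemma map_pade_poly m j :
  map_poly intr (pade_poly m (ratios j)) =
  ('X - 1) * \prod_(l | l != j) \poly_(i < m) (- (r j l)%:~R) ^+ i :> {poly R}.
Proof.
rewrite /pade_poly rmorphM rmorphB /= map_polyX rmorph1; congr (_ * _).
rewrite rmorph_prod big_image /=; apply: eq_bigr => l _.
apply/polyP => i; rewrite coef_map !coef_poly.
by case: ifP => _ /=; rewrite ?mulr0z // rmorphXn /= rmorphN.
Qed.

Lemma geometric_comp m (x : R) (q : {poly R}) :
  (\poly_(i < m) (- x) ^+ i \Po q) * (1 + x *: q) = 1 - (- x *: q) ^+ m.
Proof.
rewrite poly_def rmorph_sum /=.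
have -> : \sum_(i < m) ((- x) ^+ i *: 'X^i \Po q) = \sum_(i < m) (- x *: q) ^+ i.
  by apply: eq_bigr => i _; rewrite comp_polyZ comp_Xn_poly exprZn.
rewrite -(opprK (x *: q)) -scaleNr mulrC.
rewrite -[X in _ = X - _](expr1n _ m) subrXX; congr (_ * _).
by apply: eq_bigr => i _; rewrite expr1n mul1r.
Qed.

(** Both sides have degree less than [m * #|I|], so it suffices to compare them
    modulo the pairwise coprime [(X + t_j)^m].  There only the [j]-th term of
    the sum survives, and it is the truncated expansion described at
    [pade_poly], raised to the power [m]. *)
Lemma partial_fractions m : (0 < m)%N -> (1 < #|I|)%N ->
  'X^m = \sum_j \sum_(i < m) ((pade_poly m (ratios j) ^+ m)`_i)%:~R *
            (t j ^+ (m - i) / node_diff j ^+ m) *: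
          (('X + (t j)%:P) ^+ i * \prod_(l | l != j) ('X + (t l)%:P) ^+ m).
Proof.
move=> m0 I1.
have tneq j l : l != j -> t l - t j != 0.
  by move=> lj; apply: contraNneq (t_neq0 j) => e; rewrite -(rE lj) e mulr0.
have Vneq j : node_diff j != 0 by apply/prodf_neq0 => l; exact: tneq.
have szX j k : size (('X + (t j)%:P) ^+ k) = k.+1.
  by rewrite -(opprK (t j)) polyCN size_exp_XsubC.
set S := \sum_j _.
apply/eqP; rewrite -subr_eq0; apply: contraT => D0.
have szP (A : pred I) : size (\prod_(l | A l) ('X + (t l)%:P) ^+ m) = (#|A| * m).+1.
  rewrite size_prod => [|l _]; last by rewrite -size_poly_gt0 szX.
  rewrite (eq_bigr (fun _ => m.+1)) => [|l _]; last by rewrite szX.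
  by rewrite sum_nat_const; lia.
have sz : (size ('X^m - S)%R <= #|I| * m)%N.
  rewrite (leq_trans (size_polyD _ _)) // geq_max size_polyXn size_polyN.
  apply/andP; split; first by nia.
  apply: (leq_trans (size_sum _ _ _)); apply/bigmax_leqP => j _.
  apply: (leq_trans (size_sum _ _ _)); apply/bigmax_leqP => i _.
  apply: (leq_trans (size_scale_leq _ _)); apply: (leq_trans (size_polyMleq _ _)).
  rewrite szP szX.
  have -> : #|[pred l | l != j]| = #|I|.-1 by rewrite -(cardC1 j); apply: eq_card.
  by have := ltn_ord i; nia.
suff dv : \prod_l ('X + (t l)%:P) ^+ m %| 'X^m - S.
  have := dvdp_leq D0 dv; rewrite szP.
  by move=> h; have := leq_trans h sz; rewrite ltnn.
apply: dvdp_prod_coprime => [i j ij|j].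
  apply: coprimep_expl; apply: coprimep_expr.
  rewrite -(opprK (t i)) -(opprK (t j)) (polyCN (- t i)) (polyCN (- t j)) coprimep_XsubC root_XsubC.
  rewrite eqr_opp -subr_eq0. by rewrite tneq // eq_sym.
pose Y := (t j)^-1 *: ('X + (t j)%:P).
have XY : 'X + (t j)%:P = t j *: Y by rewrite scalerA divff // scale1r.
have YE k : Y ^+ k %= ('X + (t j)%:P) ^+ k.
  by rewrite exprZn eqp_scale // expf_neq0 ?invr_eq0.
rewrite -(eqp_dvdl _ (YE m)) /S (bigD1 j) //= opprD addrA dvdp_sub //; last first.
  apply: dvdp_bigsum => i ij; apply: dvdp_bigsum => k _.
  rewrite (eqp_dvdl _ (YE m)) (bigD1 j) 1?eq_sym //=.
  by rewrite -mul_polyC; do 2 apply: dvdp_mull; exact: dvdp_mulIl.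
pose g := map_poly intr (pade_poly m (ratios j)) : {poly R}.
pose Q := \prod_(l | l != j) ('X + (t l)%:P).
have -> : \sum_(i < m) ((pade_poly m (ratios j) ^+ m)`_i)%:~R *
     (t j ^+ (m - i) / node_diff j ^+ m) *:
     (('X + (t j)%:P) ^+ i * \prod_(l | l != j) ('X + (t l)%:P) ^+ m) =
   ((\sum_(i < m) (g ^+ m)`_i *: Y ^+ i) * ((t j / node_diff j)%:P * Q) ^+ m).
  rewrite mulr_suml; apply: eq_bigr => i _.
  rewrite -rmorphXn coef_map /= XY exprZn prodrXl.
  rewrite [((_ / _)%:P * Q) ^+ m]exprMn -polyC_exp.
  rewrite -!mul_polyC expr_div_n -[in t j ^+ m](subnK (ltnW (ltn_ord i))) exprD.
  by rewrite !polyCM; ring.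
have gY : (g \Po Y) * ((t j / node_diff j)%:P * Q) =
    'X * \prod_(l | l != j) (1 - (- (r j l)%:~R *: Y) ^+ m).
  rewrite /g map_pade_poly comp_polyM comp_polyB comp_polyX (comp_polyC 1 Y) rmorph_prod /=.
  have -> : \prod_(l | l != j) (1 - (- (r j l)%:~R *: Y) ^+ m) =
     (\prod_(l | l != j) (\poly_(i < m) (- (r j l)%:~R) ^+ i \Po Y)) *
     (((node_diff j)^-1)%:P * Q).
    rewrite /node_diff -prodfV rmorph_prod /= -!big_split /=.
    apply: eq_bigr => l lj; rewrite -geometric_comp; congr (_ * _).
    rewrite /Y scalerA -mul_polyC; have tl := tneq _ _ lj.
    have -> : (r j l)%:~R / t j = (t l - t j)^-1.
      by apply: (mulIf tl); rewrite mulVf // mulrAC rE // divff.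
    have -> : 'X + (t l)%:P = (t l - t j)%:P + ('X + (t j)%:P) :> {poly R}.
      by rewrite polyCB; ring.
    by rewrite [RHS]mulrDr -[in RHS]polyCM mulVf // mulrDr polyCM.
  have -> : 'X = (t j)%:P * (Y - 1) :> {poly R}.
    by rewrite mulrBr mulr1 mul_polyC -XY addrK.
  by rewrite polyCM; ring.
have cong1 : Y ^+ m %| 'X ^+ m - (g ^+ m \Po Y) * ((t j / node_diff j)%:P * Q) ^+ m.
  rewrite rmorphXn /= -exprMn gY; apply: dvdp_subX.
  rewrite -{1}['X]mulr1; apply: dvdp_subM; rewrite ?subrr ?dvdp0 //.
  suff : Y ^+ m %| \prod_(l | l != j) 1 - \prod_(l | l != j) (1 - (- (r j l)%:~R *: Y) ^+ m).
    by rewrite big1_eq.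
  apply: dvdp_sub_prod => l _.
  by rewrite opprB addrC subrK [(- _ *: Y) ^+ m]exprZn -mul_polyC dvdp_mull.
have cong2 := dvdp_comp_trunc m (g ^+ m) Y.
set u := (_ * Q) ^+ m in cong1 *.
have -> : 'X^m - (\sum_(i < m) (g ^+ m)`_i *: Y ^+ i) * u =
  'X^m - (g ^+ m \Po Y) * u + (g ^+ m \Po Y - \sum_(i < m) (g ^+ m)`_i *: Y ^+ i) * u.
  by ring.
by rewrite dvdp_add // dvdp_mulr.
Qed.

End PartialFractions.

(** * Small linear forms in square roots *)

Section PadeForm.
Variables (R : realType) (I : finType) (t : I -> R) (r : I -> I -> int).
Hypothesis t_gt0 : forall j, 0 < t j.
Hypothesis rE : forall j l, l != j -> (r j l)%:~R * (t l - t j) = t j.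
Hypothesis I_gt1 : (1 < #|I|)%N.

(** [2 / pi] times the integral over [s >= 0] of
    [(s^2 / prod_j (s^2 + t_j))^(n+1)]; see [pade_form_ge0]. *)
Definition pade_form (n : nat) : R :=
  \sum_j Num.sqrt (t j) * (pade_num n (ratios r j))%:~R /
           (4 ^+ n * node_diff t j ^+ n.+1).

Let c n j h : R :=
  ((pade_poly n.+1 (ratios r j) ^+ n.+1)`_(n - h))%:~R * t j ^+ h.+1 / node_diff t j ^+ n.+1.

Let c_value n :
  \sum_j \sum_(h < n.+1) c n j h * (wallis R h / t j ^+ h / Num.sqrt (t j)) =
  pade_form n.
Proof.
apply: eq_bigr => j _; rewrite /pade_num rmorph_sum /= mulr_sumr mulr_suml.
rewrite (reindex_inj rev_ord_inj) /=; apply: eq_bigr => i _.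
have lin : (i <= n)%N by rewrite -ltnS.
rewrite subSS /c subKn // /wallis [t j ^+ _.+1]exprS.
have st : Num.sqrt (t j) != 0 by rewrite gt_eqF // sqrtr_gt0.
have tE : t j = Num.sqrt (t j) ^+ 2 by rewrite sqr_sqrtr // ltW.
have t0 : t j ^+ (n - i) != 0 by rewrite expf_neq0 // gt_eqF.
rewrite -[in (4 : R) ^+ n](subnK lin) exprD !rmorphM rmorphXn /=.
have p0 k : (4 : R) ^+ k != 0 by rewrite expf_neq0 // pnatr_eq0.
have [->|V0] := eqVneq (node_diff t j ^+ n.+1) 0.
  by rewrite !(mulr0, invr0, mul0r).
move: (t j ^+ (n - i)) t0 => T T0.
have -> : t j * T = Num.sqrt (t j) ^+ 2 * T by rewrite -tE.
move: (p0 i) (p0 (n - i)%N); move: ((4 : R) ^+ i) ((4 : R) ^+ (n - i)) => a b a0 b0.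
rewrite -!pmulrn.
field.
by rewrite a0 b0 T0 V0 st.
Qed.

(** The numbers [c n j h] are the coefficients of the partial fraction
    expansion of that integrand. *)
Let c_rat n w : 0 <= w ->
  \sum_j \sum_(h < n.+1) c n j h / (w + t j) ^+ h.+1 =
  (w / \prod_j (w + t j)) ^+ n.+1.
Proof.
move=> w0.
have wt j : w + t j != 0 by rewrite gt_eqF // ltr_wpDl.
have Pn0 : \prod_j (w + t j) != 0 by apply/prodf_neq0.
have := congr1 (fun p => p.[w]) (partial_fractions (fun j => lt0r_neq0 (t_gt0 j)) rE (ltn0Sn n) I_gt1).
rewrite /= hornerXn expr_div_n => ->.
rewrite horner_sum mulr_suml; apply: eq_bigr => j _.
rewrite horner_sum mulr_suml (reindex_inj rev_ord_inj) /=; apply: eq_bigr => i _.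
have lin : (i <= n)%N by rewrite -ltnS.
rewrite subSS /c subKn // subSn // hornerZ hornerM horner_exp hornerD hornerX hornerC.
rewrite horner_prod (eq_bigr (fun l => (w + t l) ^+ n.+1)); last first.
  by move=> l _; rewrite horner_exp hornerD hornerX hornerC.
rewrite prodrXl [\prod_l (w + t l)](bigD1 j) //=.
have Q0 : \prod_(l | l != j) (w + t l) != 0 by apply/prodf_neq0 => l _.
set Q := \prod_(l | l != j) (w + t l) in Q0 *.
rewrite [((w + t j) * Q) ^+ n.+1]exprMn.
move: (Q ^+ n.+1) (expf_neq0 n.+1 Q0) => {Q Q0} Q Q0.
have -> : (w + t j) ^+ n.+1 = (w + t j) ^+ (n - i).+1 * (w + t j) ^+ i.
  by rewrite -exprD addSn subnK.
move: (expf_neq0 (n - i).+1 (wt j)) (expf_neq0 i (wt j)).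
move: ((w + t j) ^+ (n - i).+1) ((w + t j) ^+ i) => b a b0 a0.
move: (node_diff t j ^- n.+1) (t j ^+ _) (_%:~R) => v B A.
by field; rewrite a0 b0 Q0.
Qed.

Theorem pade_form_ge0 n : 0 <= pade_form n.
Proof.
rewrite -c_value; apply: stieltjes_ge0 => // s.
rewrite c_rat ?sqr_ge0 // exprn_ge0 // divr_ge0 ?sqr_ge0 // prodr_ge0 // => j _.
by rewrite addr_ge0 ?sqr_ge0 // ltW.
Qed.

(** The integrand for [n] is at most [rho^n] times the one for 0, because
    [w / prod_j (w + t_j) <= rho]. *)
Theorem pade_form_le n (rho : R) :
  (forall w, 0 <= w -> w <= rho * \prod_j (w + t j)) ->
  pade_form n <= rho ^+ n * pade_form 0.
Proof.
move=> hrho; rewrite -subr_ge0.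
pose d j h := rho ^+ n * (if h == 0%N then c 0 j 0 else 0) - c n j h.
have split0 (f : I -> nat -> R) :
  \sum_j \sum_(h < n.+1) d j h * f j h =
  rho ^+ n * (\sum_j \sum_(h < 1) c 0 j h * f j h) -
  \sum_j \sum_(h < n.+1) c n j h * f j h.
  rewrite mulr_sumr -sumrB; apply: eq_bigr => j _.
  under eq_bigr do rewrite mulrBl; rewrite sumrB; congr (_ - _).
  rewrite big_ord1 big_ord_recl /= big1 ?addr0 ?mulrA // => h _.
  by rewrite mulr0 mul0r.
have := stieltjes_ge0 (m := n.+1) (c := d) t_gt0.
rewrite (split0 (fun j h => wallis R h / t j ^+ h / Num.sqrt (t j))) !c_value; apply=> s.
rewrite (split0 (fun j h => ((s ^+ 2 + t j) ^+ h.+1)^-1)) !c_rat ?sqr_ge0 //.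
set w := s ^+ 2; have w0 : 0 <= w by rewrite sqr_ge0.
set Q := \prod_j _; have Q0 : 0 < Q by apply: prodr_gt0 => j _; rewrite ltr_wpDl.
rewrite subr_ge0 expr1 exprSr ler_wpM2r ?divr_ge0 ?(ltW Q0) //.
have wQ : w / Q <= rho by rewrite ler_pdivrMr ?hrho.
have wQ0 : 0 <= w / Q by rewrite divr_ge0 // ltW.
by rewrite lerXn2r // nnegrE (le_trans wQ0).
Qed.
End PadeForm.

(** * Size and 2-adic valuation of the numerators *)

Section Majorant.
Variable R : realFieldType.
Implicit Types (p : {poly int}) (q : {poly R}).

Definition majorant p q := forall i, `|p`_i|%:~R <= q`_i.

Lemma majorant_coef_ge0 p q i : majorant p q -> 0 <= q`_i.
Proof. by move=> h; apply: le_trans (h i); rewrite ler0z. Qed.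

Lemma majorantM p1 p2 q1 q2 :
  majorant p1 q1 -> majorant p2 q2 -> majorant (p1 * p2) (q1 * q2).
Proof.
move=> h1 h2 i; rewrite !coefM.
apply: (@le_trans _ _ (\sum_(j < i.+1) `|p1`_j * p2`_(i - j)|)%:~R).
  by rewrite ler_int ler_norm_sum.
rewrite rmorph_sum /=; apply: ler_sum => j _.
by rewrite normrM intrM ler_pM ?ler0z.
Qed.

Lemma majorant1 : majorant 1 1.
Proof. by move=> i; rewrite !coef1; case: eqP. Qed.

Lemma majorantX p q k : majorant p q -> majorant (p ^+ k) (q ^+ k).
Proof.
by move=> h; elim: k => [|k IH]; rewrite ?expr0 ?exprS; [exact: majorant1 | exact: majorantM].
Qed.

Lemma majorant_prod (s : seq int) (f : int -> {poly int}) (g : int -> {poly R}) :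
  (forall r, majorant (f r) (g r)) -> majorant (\prod_(r <- s) f r) (\prod_(r <- s) g r).
Proof.
move=> h; elim/big_ind2: _ => [|????|r _]; [exact: majorant1 | exact: majorantM | exact: h].
Qed.

(** A Cauchy estimate: a majorant evaluated at [x] bounds the coefficients up to
    degree [n] of the majorized polynomial, at the cost of [x^-n]. *)
Lemma majorant_sum_coef p q (x : R) n : 0 < x -> x <= 1 -> majorant p q ->
  (\sum_(i < n.+1) `|p`_i|)%:~R <= x ^- n * q.[x].
Proof.
move=> x0 x1 h; rewrite (@horner_coef_wide _ (n.+1 + size q)) ?leq_addl //.
rewrite big_split_ord /= mulrDr -[X in X <= _]addr0 lerD //; last first.
  rewrite mulr_ge0 ?invr_ge0 ?exprn_ge0 ?(ltW x0) // sumr_ge0 // => i _.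
  by rewrite mulr_ge0 ?exprn_ge0 ?(ltW x0) // (majorant_coef_ge0 _ h).
rewrite rmorph_sum /= mulr_sumr; apply: ler_sum => i _.
rewrite mulrC ler_pdivlMr ?exprn_gt0 //; apply: ler_pM => //.
- by rewrite exprn_ge0 // ltW.
- by rewrite ler_wiXn2l ?(ltW x0) // -ltnS.
Qed.

End Majorant.

Lemma bin_double_le k : ('C(k.*2, k) <= 4 ^ k)%N.
Proof.
elim: k => // k IH; rewrite -(leq_pmul2l (ltn0Sn k)) bin_double_succ expnS.
by move: IH; move: 'C(_, _) (4 ^ k)%N => a b; nia.
Qed.

Section Bound.
Variable R : realFieldType.

Lemma geometric_sum_le (a x : R) m : 0 <= a -> 0 <= x -> a * x < 1 ->
  (\poly_(i < m) a ^+ i).[x] <= (1 - a * x)^-1.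
Proof.
move=> a0 x0 ax; rewrite horner_poly.
have d0 : 0 < 1 - a * x by lra.
rewrite -[X in _ <= X]mul1r ler_pdivlMr // mulrC.
have := subrXX 1 (a * x) m; rewrite expr1n.
rewrite (eq_bigr (fun i : 'I_m => a ^+ i * x ^+ i)) => [<-|i _].
  by rewrite gerBl exprn_ge0 // mulr_ge0.
by rewrite expr1n mul1r exprMn.
Qed.

(** [pade_poly] is majorized by the expansion of
    [(1 + X) prod_r 1 / (1 - |r| X)].  The number [x] is free, to be chosen
    later so as to make the bound small. *)
Theorem pade_num_le n (rs : seq int) (x : R) : 0 < x -> x <= 1 ->
  (forall r, r \in rs -> `|r|%:~R * x < 1) ->
  `|pade_num n rs|%:~R <=
    (4 / x) ^+ n * ((1 + x) * \prod_(r <- rs) (1 - `|r|%:~R * x)^-1) ^+ n.+1.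
Proof.
move=> x0 x1 hr.
pose q : {poly R} := ('X + 1) * \prod_(r <- rs) \poly_(i < n.+1) (`|r|%:~R) ^+ i.
have mq : majorant (pade_poly n.+1 rs) q.
  apply: majorantM => [i|].
    rewrite coefB coefD coefX coefX coef1 coef1.
    by case: i => [|[|i]] /=; rewrite ?subr0 ?sub0r ?addr0 ?add0r ?normrN ?normr1 ?normr0.
  apply: majorant_prod => r i; rewrite !coef_poly; case: ifP => _ //=.
  by rewrite normrX normrN rmorphXn.
have := majorant_sum_coef n x0 x1 (majorantX n.+1 mq).
set p := pade_poly _ _ ^+ _ => hp.
apply: (@le_trans _ _ (4 ^+ n * (\sum_(i < n.+1) `|p`_i|))%:~R).
  rewrite ler_int /pade_num -/p; apply: (le_trans (ler_norm_sum _ _ _)).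
  rewrite mulr_sumr; apply: ler_sum => i _.
  rewrite normrM ler_wpM2r // ger0_norm; last by rewrite mulr_ge0 ?exprn_ge0.
  have lin : (i <= n)%N by rewrite -ltnS.
  rewrite -[in X in _ <= X](subnKC lin) exprD ler_pM2l ?exprn_gt0 //.
  have := bin_double_le (n - i); rewrite -lez_nat => /le_trans; apply.
  by rewrite -natz natrX natz.
rewrite intrM rmorphXn /= exprMn -mulrA ler_pM2l ?exprn_gt0 //.
apply: (le_trans hp); rewrite exprVn ler_pM2l ?invr_gt0 ?exprn_gt0 //.
have q0 : 0 <= (\prod_(r <- rs) \poly_(i < n.+1) (`|r|%:~R) ^+ i).[x] :> R.
  rewrite horner_prod prodr_ge0 // => r _; rewrite horner_poly sumr_ge0 // => i _.
  by rewrite mulr_ge0 ?exprn_ge0 ?ler0z // ltW.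
have x2 : 0 <= 1 + x by rewrite addr_ge0 // ltW.
rewrite horner_exp lerXn2r ?nnegrE //.
- by rewrite hornerM hornerD hornerX hornerC addrC mulr_ge0.
- rewrite mulr_ge0 // big_seq prodr_ge0 // => r rrs.
  by rewrite invr_ge0 subr_ge0 ltW // hr.
rewrite hornerM hornerD hornerX hornerC [x + 1]addrC ler_wpM2l //.
rewrite horner_prod big_seq [X in _ <= X]big_seq; apply: ler_prod => r rrs.
rewrite geometric_sum_le ?ler0z ?(ltW x0) ?hr // andbT.
rewrite horner_poly sumr_ge0 // => i _.
by rewrite mulr_ge0 ?exprn_ge0 ?ler0z // ltW.
Qed.

End Bound.

Lemma bin_double_ratio h i :
  (\prod_(h <= j < h + i) j.*2.+1 * 4 ^ i * 'C(h.*2, h) =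
   'C((h + i).*2, h + i) * (2 ^ i * \prod_(h <= j < h + i) j.+1))%N.
Proof.
elim: i => [|i IH]; first by rewrite addn0 !big_geq //; lia.
rewrite addnS !big_nat_recr ?leq_addr //=.
have := bin_double_succ (h + i); rewrite !expnS; move: IH.
move: 'C((h+i).+1.*2, _) 'C((h+i).*2, _) 'C(_, _) => a b c.
set P := bigop _ _ _; set Q := bigop _ _ _.
move: P Q (4 ^ i)%N (2 ^ i)%N (h + i)%N => P Q u v m; move: m.*2.+1 m.+1 => k m' IH e.
transitivity ((P * u * c) * 4 * k)%N; first by ring.
rewrite IH; transitivity ((2 * k * b) * (2 * v * Q))%N; first by ring.
by rewrite -e; ring.
Qed.

(** In the sum that defines [pade_num] the weight
    [4^i 'C(2 (n - i), n - i)] is ['C(2n, n)] times [2^i] times a fraction with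
    odd denominator ([bin_double_ratio]), and the coefficient of weight
    ['C(2n, n)] is 1 or -1.  Hence [pade_num n rs] has exactly the 2-adic
    valuation of ['C(2n, n)].  One odd [o] clears the denominators for all [rs],
    so that several numerators can be compared. *)
Theorem pade_num_odd n :
  exists2 o : int, odd `|o|%N & forall rs, exists2 q : int, odd `|q|%N &
     o * pade_num n rs = 'C(n.*2, n)%:Z * q.
Proof.
pose o := (\prod_(0 <= j < n) j.*2.+1)%N.
have oo : odd o by rewrite /o; elim/big_ind: _ => // [a b|j _]; rewrite ?oddM ?oddS ?odd_double // => -> ->.
exists o%:Z => // rs.
have step (i : 'I_n) : exists a : int, o%:Z * (4 ^+ i.+1 * 'C((n - i.+1).*2, n - i.+1)%:Z) =
    'C(n.*2, n)%:Z * (2 * a).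
  pose h := (n - i.+1)%N; have nE : (h + i.+1 = n)%N by rewrite subnK.
  have := bin_double_ratio h i.+1; rewrite nE -/h => e.
  have oE : o = ((\prod_(0 <= j < h) j.*2.+1) * (\prod_(h <= j < n) j.*2.+1))%N.
    by rewrite -big_cat_nat // -nE leq_addr.
  exists ((\prod_(0 <= j < h) j.*2.+1) * (2 ^ i * \prod_(h <= j < n) j.+1))%N%:Z.
  have -> : (4 : int) ^+ i.+1 = (4 ^ i.+1)%N%:Z by rewrite -[RHS]natz natrX.
  rewrite -!PoszM; congr Posz.
  rewrite oE -!mulnA [X in (_ * X)%N]mulnA e expnS; ring.
pose p := pade_poly n.+1 rs ^+ n.+1.
have p0 : absz p`_0 = 1%N.
  suff -> : p`_0 = (-1) ^+ n.+1 by rewrite abszX exp1n.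
  rewrite -horner_coef0 horner_exp hornerM hornerD hornerX hornerN hornerC add0r.
  rewrite horner_prod big1 ?mulr1 // => r _; rewrite horner_coef0 coef_poly //.
have {}step : exists a : int, o%:Z * (\sum_(i < n) 4 ^+ i.+1 * 'C((n - i.+1).*2, n - i.+1)%:Z * p`_i.+1) =
    'C(n.*2, n)%:Z * (2 * a).
  elim/big_ind: _ => [|u v [a ha] [b hb]|i _]; first by exists 0; rewrite !mulr0.
    by exists (a + b); rewrite mulrDr ha hb; ring.
  have [a ha] := step i; exists (a * p`_i.+1).
  by rewrite mulrA ha; ring.
have [a ha] := step.
exists (o%:Z * p`_0 + 2 * a).
  have : odd (absz (o%:Z * p`_0)) by rewrite abszM p0 muln1.
  by move: (o%:Z * _) => c; lia.
rewrite /pade_num -/p big_ord_recl expr0 mul1r subn0 mulrDr.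
rewrite (eq_bigr (fun i : 'I_n => 4 ^+ i.+1 * 'C((n - i.+1).*2, n - i.+1)%:Z * p`_i.+1)) //.
by rewrite ha; ring.
Qed.

Lemma pade_num0 rs : pade_num 0 rs = -1.
Proof.
rewrite /pade_num big_ord1 expr0 mul1r bin0 mul1r expr1.
rewrite -horner_coef0 hornerM hornerD hornerX hornerN hornerC add0r.
by rewrite horner_prod big1 ?mulr1 // => q _; rewrite horner_coef0 coef_poly.
Qed.

Lemma pade_num1 (rs : seq int) : pade_num 1 rs = - 6 - 8 * \sum_(r <- rs) r.
Proof.
pose p := pade_poly 2 rs.
have g0 r : (geometric_poly 2 r)`_0 = 1 by rewrite coef_poly.
have g1 r : (geometric_poly 2 r)`_1 = - r by rewrite coef_poly.
have G : (\prod_(r <- rs) geometric_poly 2 r)`_0 = 1 /\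
         (\prod_(r <- rs) geometric_poly 2 r)`_1 = - \sum_(r <- rs) r.
  elim: rs {p} => [|r s [IH0 IH1]]; first by rewrite !big_nil !coef1 oppr0.
  rewrite !big_cons !coefM !big_ord_recl !big_ord0 /= !subn0 /bump /= IH0 IH1 g0 g1.
  by split; ring.
have p0 : p`_0 = - 1.
  by rewrite /p /pade_poly coefM big_ord1 subn0 coefB coefX coef1 G.1.
have p1 : p`_1 = 1 + \sum_(r <- rs) r.
  rewrite /p /pade_poly coefM !big_ord_recl big_ord0 /= subn0 !coefB !coefX !coef1 /= G.1 G.2.
  by ring.
rewrite /pade_num -/p !big_ord_recl big_ord0 /= expr0 !subn0 /bump /= subnn expr2 !coefM.
rewrite !big_ord_recl !big_ord0 /= subn0 !subnn p0 p1.
have -> : 'C(1.*2, 1) = 2%N by [].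
have -> : 'C(0.*2, 0) = 1%N by [].
ring.
Qed.

(** * The linear forms at a solution *)

Section Approximation.
Variables (x0 y0 : int).
Hypotheses (x0_gt0 : 0 < x0) (y0_gt0 : 0 < y0) (pell0 : y0 ^+ 2 = 3 * x0 ^+ 2 + 1).

Let e := 2 * x0 ^+ 2 + 1.
Let nodes : seq int := [:: 3 * e; 2 * y0 ^+ 2; 6 * x0 ^+ 2].
Let quots : seq (seq int) :=
  [:: [:: 0; - (3 * e); - e]; [:: 2 * y0 ^+ 2; 0; - y0 ^+ 2]; [:: 2 * x0 ^+ 2; 3 * x0 ^+ 2; 0]].
(** The nodes are [t0 = 3 e], [t1 = 2 y0^2 = 3 e - 1] and
    [t2 = 6 x0^2 = 3 e - 3].  Their differences 1, 2 and 3 divide the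
    corresponding nodes, which makes all the ratios [t_j / (t_l - t_j)]
    integers. *)
Definition num0 n := pade_num n [:: - (3 * e); - e].
Definition num1 n := pade_num n [:: 2 * y0 ^+ 2; - y0 ^+ 2].
Definition num2 n := pade_num n [:: 2 * x0 ^+ 2; 3 * x0 ^+ 2].

(** [4^n 6^(n+1) pade_form] is an integer linear form in [sqrt t0], [sqrt t1],
    [sqrt t2].  Multiply it by [x sqrt 6] and replace [x sqrt (6 t0)] by [3 z],
    [x sqrt (6 t1)] by [2 y y0], and [x sqrt (6 t2)] by its value [6 x x0]. *)
Definition int_form (x y z : int) n : int :=
  3 * z * 2 ^+ n.+1 * num0 n + 2 * y * y0 * (- 3) ^+ n.+1 * num1 n + 6 * x * x0 * num2 n.

Variable R : realType.
Let i0 : 'I_3 := @Ordinal 3 0 isT.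
Let i1 : 'I_3 := @Ordinal 3 1 isT.
Let i2 : 'I_3 := @Ordinal 3 2 isT.
Let t (j : 'I_3) : R := (nodes`_j)%:~R.
Let r (j l : 'I_3) : int := (nth [::] quots j)`_l.
Let X : R := x0%:~R.
Let Y : R := y0%:~R.
Let E : R := e%:~R.

Let X_gt0 : 0 < X. Proof. by rewrite ltr0z. Qed.
Let Y_gt0 : 0 < Y. Proof. by rewrite ltr0z. Qed.
Let YX : Y ^+ 2 = 3 * X ^+ 2 + 1.
Proof. by rewrite /Y /X -!rmorphXn /= pell0 rmorphD rmorphM. Qed.
Let EX : E = 2 * X ^+ 2 + 1.
Proof. by rewrite /E /e rmorphD rmorphM rmorphXn. Qed.

Let tE : (t i0 = 6 * X ^+ 2 + 3) * (t i1 = 6 * X ^+ 2 + 2) * (t i2 = 6 * X ^+ 2).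
Proof.
rewrite /t /=; split; last by rewrite rmorphM rmorphXn.
split; first by rewrite rmorphM /= -/E EX; ring.
by rewrite rmorphM rmorphXn /= -/Y YX; ring.
Qed.

Let ord3P (P : 'I_3 -> Prop) : P i0 -> P i1 -> P i2 -> forall j, P j.
Proof.
by move=> P0 P1 P2 [[|[|[|//]]] h]; [move: P0|move: P1|move: P2]; congr P; apply: val_inj.
Qed.

Let t_gt0 j : 0 < t j.
Proof.
have X2 := exprn_gt0 2 X_gt0.
by move: j; apply: ord3P; rewrite tE ?addr_gt0 ?mulr_gt0.
Qed.

Let rE j l : l != j -> (r j l)%:~R * (t l - t j) = t j.
Proof.
move: j; apply: ord3P; move: l; apply: ord3P => // _; rewrite !tE /r /=;
  rewrite ?(rmorphM, rmorphN, rmorphXn) /= -?/X -?/E -?/Y -?[Y * Y]/(Y ^+ 2) ?EX ?YX; ring.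
Qed.

Let ratiosE : (ratios r i0 = [:: - (3 * e); - e]) * (ratios r i1 = [:: 2 * y0 ^+ 2; - y0 ^+ 2]) *
  (ratios r i2 = [:: 2 * x0 ^+ 2; 3 * x0 ^+ 2]).
Proof.
have en : enum 'I_3 = [:: i0; i1; i2].
  by apply: (inj_map val_inj); rewrite val_enum_ord.
have rat j : ratios r j = [seq r j l | l <- [:: i0; i1; i2] & l != j].
  by rewrite -en enumT /ratios /image_mem /enum_mem.
by rewrite !rat.
Qed.

Let diffE : (node_diff t i0 = 3) * (node_diff t i1 = - 2) * (node_diff t i2 = 6).
Proof.
have d (j : 'I_3) : node_diff t j = \prod_(l <- [:: i0; i1; i2]| l != j) (t l - t j).
  rewrite /node_diff; apply: perm_big.
  by rewrite uniq_perm // ?index_enum_uniq // => l; rewrite mem_index_enum; move: l; apply: ord3P.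
rewrite !d !big_cons !big_nil /= !tE.
by split; [split|]; ring.
Qed.

Let s j := Num.sqrt (t j).
Let omega : R := Num.sqrt 6.

Let omega_gt0 : 0 < omega. Proof. by rewrite sqrtr_gt0. Qed.
Let omega2 : omega ^+ 2 = 6. Proof. by rewrite sqr_sqrtr. Qed.
Let s_gt0 j : 0 < s j. Proof. by rewrite sqrtr_gt0. Qed.
Let s2E : s i2 = omega * X.
Proof. by rewrite /s tE sqrtrM // sqrtr_sqr gtr0_norm. Qed.
Let s_sqr j : s j ^+ 2 = t j. Proof. by rewrite sqr_sqrtr // ltW. Qed.
Let s_ge j : omega * X <= s j.
Proof.
rewrite -s2E ler_sqrt ?(ltW (t_gt0 _)) //; move: j; apply: ord3P; rewrite !tE; lra.
Qed.

Let form_le n : 0 <= pade_form t r n <= (243 * X ^+ 4)^-1 ^+ n * (48 * omega * X ^+ 3)^-1.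
Proof.
have I1 : (1 < #|'I_3|)%N by rewrite card_ord.
rewrite (pade_form_ge0 t_gt0 rE) //=.
have X2 := exprn_gt0 2 X_gt0.
have X4 := exprn_gt0 4 X_gt0.
have rhoP w : 0 <= w -> w <= (243 * X ^+ 4)^-1 * \prod_j (w + t j).
  move=> w0.
  rewrite mulrC ler_pdivlMr ?mulr_gt0 //.
  rewrite (bigD1 i0) // (bigD1 i1) // (bigD1 i2) //= big1 ?mulr1; last first.
    by apply: ord3P.
  rewrite !tE.
  pose u := w + 6 * X ^+ 2.
  have u0 : 0 <= u by rewrite addr_ge0 // mulr_ge0 // ltW.
  apply: (@le_trans _ _ (u * (u * u))).
    (* [w / (w + 6 X^2)^3] is largest at [w = 3 X^2] *)
    rewrite -subr_ge0 (_ : _ - _ = (w + 24 * X ^+ 2) * (w - 3 * X ^+ 2) ^+ 2).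
      by rewrite mulr_ge0 ?sqr_ge0 // addr_ge0 // mulr_ge0 // ltW.
    by rewrite /u; ring.
  by rewrite !ler_pM ?mulr_ge0 /u //; lra.
apply: (le_trans (pade_form_le t_gt0 rE I1 n rhoP)).
rewrite ler_wpM2l ?exprn_ge0 ?invr_ge0 ?mulr_ge0 ?exprn_ge0 ?(ltW X_gt0) //.
rewrite /pade_form (bigD1 i0) // (bigD1 i1) // (bigD1 i2) //= big1; last by apply: ord3P.
rewrite !pade_num0 expr0 !expr1 !diffE addr0 !mul1r -!/(s _).
have := s_sqr i0; have := s_sqr i1; have := s_sqr i2; rewrite !tE.
have := s_ge i0; have := s_ge i1; rewrite -s2E.
have p2 := s_gt0 i2; move: (s i0) (s_gt0 i0) (s i1) (s_gt0 i1) => a a0 b b0 bc ac c2 b2 a2.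
move: (s i2) p2 bc ac c2 s2E => c c0 bc ac c2 cE.
have -> : 48 * omega * X ^+ 3 = 8 * c ^+ 3.
  by rewrite cE exprMn [omega ^+ 3]exprS omega2; ring.
have -> : a * (-1)%:~R / 3 + (b * (-1)%:~R / -2 + c * (-1)%:~R / 6) =
   ((a + b) * (b + c) * (a + c))^-1.
  have h1 : (a - b) * (a + b) = 1.
    by transitivity (a ^+ 2 - b ^+ 2); [ring | rewrite a2 b2; ring].
  have h2 : (b - c) * (b + c) = 2.
    by transitivity (b ^+ 2 - c ^+ 2); [ring | rewrite b2 c2; ring].
  have h3 : (a - c) * (a + c) = 3.
    by transitivity (a ^+ 2 - c ^+ 2); [ring | rewrite a2 c2; ring].
  have P0 : (a + b) * (b + c) * (a + c) != 0.
    by rewrite gt_eqF // !mulr_gt0 ?addr_gt0.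
  apply: (mulIf P0); rewrite mulVf //.
  transitivity ((- 2 * (b + c) * ((a - b) * (a + b)) + (a + b) * ((b - c) * (b + c))) / 6 * (a + c)).
    by field.
  rewrite h1 h2; transitivity ((a - c) * (a + c) / 3); first by field.
  by rewrite h3 divff ?pnatr_eq0.
rewrite lef_pV2 ?posrE ?mulr_gt0 ?exprn_gt0 ?addr_gt0 //.
have -> : 8 * c ^+ 3 = (c + c) * (c + c) * (c + c) by ring.
by rewrite !ler_pM ?mulr_ge0 ?addr_ge0 ?lerD ?(ltW c0) ?(ltW a0) ?(ltW b0).
Qed.

(** The first two terms are the errors made by the two replacements in the
    definition of [int_form]; the last one comes from the small linear form
    itself. *)
Lemma int_form_le x y z n : 0 < x -> 0 < y -> 0 < z ->
  y ^+ 2 = 3 * x ^+ 2 + 1 -> z ^+ 2 = 2 * e * x ^+ 2 + e + 1 ->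
  `|int_form x y z n|%:~R <=
    2 ^+ n.+1 * `|num0 n|%:~R * (3 * (2 * X ^+ 2 + 2) / (4 * x%:~R * X)) +
    3 ^+ n.+1 * `|num1 n|%:~R * ((3 * X ^+ 2 + 1) / (3 * x%:~R * X)) +
    x%:~R / (8 * X ^+ 3) * (8 / (81 * X ^+ 4)) ^+ n.
Proof.
move=> x_gt0 y_gt0 z_gt0 ey ez.
pose a : R := x%:~R; pose b : R := y%:~R; pose c : R := z%:~R.
have a0 : 0 < a by rewrite ltr0z.
have b0 : 0 < b by rewrite ltr0z.
have c0 : 0 < c by rewrite ltr0z.
have eb : b ^+ 2 = 3 * a ^+ 2 + 1.
  by rewrite /a /b -!rmorphXn /= ey rmorphD rmorphM.
have ec : c ^+ 2 = 2 * E * a ^+ 2 + E + 1.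
  have := congr1 (fun m : int => m%:~R : R) ez; rewrite /E /= rmorphXn; move: (e) => e1.
  rewrite !rmorphD /= [(2 * e1 * x ^+ 2)%:~R]rmorphM /= [(2 * e1)%:~R]rmorphM /= rmorphXn. by [].
pose alpha := 3 * c - a * omega * s i0.
pose beta := 2 * b * Y - a * omega * s i1.
have aX : 0 < a * X by rewrite mulr_gt0.
have ws j : 6 * (a * X) <= a * omega * s j.
  have -> : 6 * (a * X) = a * omega * (omega * X) by rewrite -omega2; ring.
  by rewrite ler_wpM2l ?mulr_ge0 ?(ltW a0) ?(ltW omega_gt0).
have cge : 6 * (a * X) <= 3 * c.
  have -> : 6 * (a * X) = 3 * (2 * a * X) by ring.
  rewrite ler_pM2l // -ler_sqr ?nnegrE ?(ltW c0) ?mulr_ge0 ?(ltW a0) ?(ltW X_gt0) //.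
  rewrite ec EX; have := sqr_ge0 a; have := sqr_ge0 X.
  by rewrite !exprMn; nra.
have bge : 6 * (a * X) <= 2 * b * Y.
  have -> : 6 * (a * X) = 2 * (3 * (a * X)) by ring.
  rewrite -mulrA ler_pM2l // -ler_sqr ?nnegrE ?mulr_ge0 ?(ltW a0) ?(ltW b0) ?(ltW X_gt0) ?(ltW Y_gt0) //.
  rewrite !exprMn eb YX; have := sqr_ge0 a; have := sqr_ge0 X; nra.
have alphaE : alpha * (3 * c + a * omega * s i0) = 9 * (2 * X ^+ 2 + 2).
  rewrite /alpha; transitivity (9 * c ^+ 2 - a ^+ 2 * omega ^+ 2 * s i0 ^+ 2); first by ring.
  by rewrite ec omega2 s_sqr tE EX; ring.
have betaE : beta * (2 * b * Y + a * omega * s i1) = 4 * (3 * X ^+ 2 + 1).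
  rewrite /beta; transitivity (4 * b ^+ 2 * Y ^+ 2 - a ^+ 2 * omega ^+ 2 * s i1 ^+ 2); first by ring.
  by rewrite eb omega2 s_sqr tE YX; ring.
have X2 := sqr_ge0 X.
have alpha_le : `|alpha| <= 3 * (2 * X ^+ 2 + 2) / (4 * a * X).
  have d : 12 * (a * X) <= 3 * c + a * omega * s i0 by have := ws i0; lra.
  have d0 : 0 < 3 * c + a * omega * s i0 by lra.
  have al0 : 0 <= alpha by rewrite -(pmulr_lge0 _ d0) alphaE; lra.
  rewrite ger0_norm // ler_pdivlMr ?mulr_gt0 //.
  have : alpha * (12 * (a * X)) <= 9 * (2 * X ^+ 2 + 2) by rewrite -alphaE ler_wpM2l.
  lra.
have beta_le : `|beta| <= (3 * X ^+ 2 + 1) / (3 * a * X).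
  have d : 12 * (a * X) <= 2 * b * Y + a * omega * s i1 by have := ws i1; lra.
  have d0 : 0 < 2 * b * Y + a * omega * s i1 by lra.
  have al0 : 0 <= beta by rewrite -(pmulr_lge0 _ d0) betaE; lra.
  rewrite ger0_norm // ler_pdivlMr ?mulr_gt0 //.
  have : beta * (12 * (a * X)) <= 4 * (3 * X ^+ 2 + 1) by rewrite -betaE ler_wpM2l.
  lra.
pose B0 : R := (num0 n)%:~R; pose B1 : R := (num1 n)%:~R; pose B2 : R := (num2 n)%:~R.
have LE : 4 ^+ n * 6 ^+ n.+1 * pade_form t r n =
    2 ^+ n.+1 * B0 * s i0 + (- 3) ^+ n.+1 * B1 * s i1 + B2 * s i2.
  rewrite /pade_form (bigD1 i0) // (bigD1 i1) // (bigD1 i2) //= big1; last by apply: ord3P.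
  rewrite !ratiosE !diffE addr0 -!/(s _) -/(num0 n) -/(num1 n) -/(num2 n) -/B0 -/B1 -/B2.
  have -> : (6 : R) ^+ n.+1 = 2 ^+ n.+1 * 3 ^+ n.+1 by rewrite -exprMn; congr (_ ^+ _); ring.
  have -> : (- 2 : R) ^+ n.+1 = (-1) ^+ n.+1 * 2 ^+ n.+1 by rewrite -exprMn mulN1r.
  have -> : (- 3 : R) ^+ n.+1 = (-1) ^+ n.+1 * 3 ^+ n.+1 by rewrite -exprMn mulN1r.
  have p0 m k : (0 < m)%N -> (m%:R : R) ^+ k != 0.
    by move=> m0; rewrite expf_neq0 // pnatr_eq0 -lt0n.
  move: (p0 4 n isT) (p0 2 n.+1 isT) (p0 3 n.+1 isT).
  have : ((-1 : R) ^+ n.+1) ^+ 2 = 1 by rewrite sqrr_sign.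
  move: ((-1 : R) ^+ n.+1) (4 ^+ n) (2 ^+ n.+1) (3 ^+ n.+1) => u v w k u2 v0 w0 k0.
  have uV : u^-1 = u.
    have u0 : u != 0 by apply: contra_eq_neq u2 => ->; rewrite expr0n eq_sym oner_neq0.
    by apply: (mulfI u0); rewrite divff // -expr2.
  rewrite !invfM uV; field; by rewrite v0 w0 k0.
have formE : (int_form x y z n)%:~R =
    2 ^+ n.+1 * B0 * alpha + (- 3) ^+ n.+1 * B1 * beta +
    a * omega * (4 ^+ n * 6 ^+ n.+1 * pade_form t r n).
  rewrite LE s2E /int_form /alpha /beta !rmorphD !rmorphM !rmorphXn /= -/a -/b -/c.
  rewrite -/X -/Y -/B0 -/B1 -/B2 rmorphN /=.
  transitivity (3 * c * 2 ^+ n.+1 * B0 + 2 * b * Y * (- 3) ^+ n.+1 * B1 + omega ^+ 2 * a * X * B2).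
    by rewrite omega2.
  by ring.
have [L0 L1] := andP (form_le n).
rewrite intr_norm formE; apply: (le_trans (ler_normD _ _)); apply: lerD.
  apply: (le_trans (ler_normD _ _)); apply: lerD.
    rewrite !normrM normrX ger0_norm // intr_norm -/B0.
    by rewrite ler_wpM2l // mulr_ge0 ?exprn_ge0.
  rewrite !normrM normrX normrN normr_nat (_ : `|num1 n|%:~R = `|B1|) ?intr_norm //.
  by rewrite ler_wpM2l // mulr_ge0 ?exprn_ge0.
rewrite ger0_norm; last first.
  by rewrite !mulr_ge0 ?exprn_ge0 ?(ltW a0) ?(ltW omega_gt0).
apply: (@le_trans _ _ (a * omega * (4 ^+ n * 6 ^+ n.+1 *
   ((243 * X ^+ 4)^-1 ^+ n * (48 * omega * X ^+ 3)^-1)))).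
  by rewrite !ler_wpM2l ?mulr_ge0 ?exprn_ge0 ?(ltW a0) ?(ltW omega_gt0).
have X0 := lt0r_neq0 X_gt0; have w0 := lt0r_neq0 omega_gt0.
have -> : (8 / (81 * X ^+ 4)) ^+ n = 4 ^+ n * 6 ^+ n * (243 * X ^+ 4)^-1 ^+ n.
  by rewrite -!exprMn; congr (_ ^+ _); field.
rewrite exprS le_eqVlt; apply/orP; left; apply/eqP.
move: ((4 : R) ^+ n) ((6 : R) ^+ n) ((243 * X ^+ 4)^-1 ^+ n) => u v w; field.
by rewrite X0 w0.
Qed.

End Approximation.

(** * The linear forms do not vanish *)

Lemma half_int (n : int) : exists k, n = 2 * k \/ n = 2 * k + 1.
Proof. by exists (n %/ 2)%Z; lia. Qed.

Lemma mul_succ_even (n : int) : exists k, n * (n + 1) = 2 * k.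
Proof. by have [k [->| ->]] := half_int n; eexists; rewrite -?mulrA; [|rewrite mulrC -addrA -(mulrDr 2 k 1) -mulrA]. Qed.

(** The 2-adic shape of a solution: [x] and [y] have opposite parities, and the
    even one is known modulo 4. *)
Lemma pell3_mod4 (x y : int) : y ^+ 2 = 3 * x ^+ 2 + 1 ->
  (exists u v, x = 4 * u /\ y = 2 * v + 1) \/ (exists u v, x = 2 * u + 1 /\ y = 4 * v + 2).
Proof.
have [u [->| ->]] := half_int x; have [v [->| ->]] := half_int y => h.
- by exfalso; lia.
- left; have [k hk] := mul_succ_even v.
  have hu : v * (v + 1) = 3 * (u * u) by lia.
  by have [w [uw|uw]] := half_int u; [exists w, v; split; lia | exfalso; lia].
- right; have [k hk] := mul_succ_even u.
  have hv : v * v = 3 * (u * (u + 1)) + 1 by lia.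
  have [w [vw|vw]] := half_int v; last by exists u, w; split; lia.
  by exfalso; lia.
- by exfalso; have [k hk] := mul_succ_even u; have [l hl] := mul_succ_even v; lia.
Qed.

Section Parity.
Variables (x0 y0 x y z : int).
Hypotheses (pell0 : y0 ^+ 2 = 3 * x0 ^+ 2 + 1) (pell : y ^+ 2 = 3 * x ^+ 2 + 1).
Hypothesis zE : z ^+ 2 = 2 * (2 * x0 ^+ 2 + 1) * x ^+ 2 + (2 * x0 ^+ 2 + 1) + 1.

(** As [z] is even, [x] and [x0] have opposite parities. *)
Lemma parities : exists h k c, [/\ y * y0 = 4 * h + 2, x * x0 = 4 * k & z = 2 * c].
Proof.
have e2 : z ^+ 2 = 2 * (2 * (x0 ^+ 2 * x ^+ 2) + x ^+ 2 + x0 ^+ 2 + 1).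
  by rewrite zE; ring.
have [c [zc|zc]] := half_int z; last first.
  have z2 : z ^+ 2 = 2 * (2 * c ^+ 2 + 2 * c) + 1 by rewrite zc; ring.
  by exfalso; move: e2; rewrite z2; clear; lia.
have {}e2 : 2 * c ^+ 2 = 2 * (x0 ^+ 2 * x ^+ 2) + x ^+ 2 + x0 ^+ 2 + 1.
  move: e2; rewrite zc (_ : (2 * c) ^+ 2 = 2 * (2 * c ^+ 2)); last by ring.
  by clear; lia.
have [[u [v [xu yv]]]|[u [v [xu yv]]]] := pell3_mod4 pell;
  have [[u0 [v0 [xu0 yv0]]]|[u0 [v0 [xu0 yv0]]]] := pell3_mod4 pell0.
- have x2 : x ^+ 2 = 2 * (8 * u ^+ 2) by rewrite xu; ring.
  have x02 : x0 ^+ 2 = 2 * (8 * u0 ^+ 2) by rewrite xu0; ring.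
  by exfalso; clear - e2 x2 x02; lia.
- by exists (2 * v * v0 + v + v0), (u * (2 * u0 + 1)), c; rewrite xu xu0 yv yv0; split=> //; ring.
- by exists (2 * v * v0 + v + v0), (u0 * (2 * u + 1)), c; rewrite xu xu0 yv yv0; split=> //; ring.
- have x2 : x ^+ 2 = 2 * (2 * u ^+ 2 + 2 * u) + 1 by rewrite xu; ring.
  have x02 : x0 ^+ 2 = 2 * (2 * u0 ^+ 2 + 2 * u0) + 1 by rewrite xu0; ring.
  by exfalso; clear - e2 x2 x02; lia.
Qed.

Lemma odd_prod (a b : int) : odd `|a|%N -> odd `|b|%N -> odd `|(a * b)%R|%N.
Proof. by rewrite abszM oddM => -> ->. Qed.

(** Divide the form by ['C(2n, n)] and by an odd number: what remains of the
    three numerators is odd ([pade_num_odd]), and by [parities] the first and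
    the last term become divisible by 8, whereas the middle one is 4 modulo 8. *)
Lemma int_form_neq0 n : (0 < n)%N -> int_form x0 y0 x y z n != 0.
Proof.
case: n => // n _; apply/eqP => M0.
have [h [k [c [yE xE zcE]]]] := parities.
have [o oo hnum] := pade_num_odd n.+1.
have [q0 _ e0] := hnum [:: - (3 * (2 * x0 ^+ 2 + 1)); - (2 * x0 ^+ 2 + 1)].
have [q1 oq1 e1] := hnum [:: 2 * y0 ^+ 2; - y0 ^+ 2].
have [q2 _ e2] := hnum [:: 2 * x0 ^+ 2; 3 * x0 ^+ 2].
have : o * int_form x0 y0 x y z n.+1 = 'C(n.+1.*2, n.+1)%:Z *
   (8 * (3 * c * 2 ^+ n * q0 + 3 * k * q2) + 2 * (4 * h + 2) * ((-3) ^+ n.+2 * q1)).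
  rewrite /int_form /num0 /num1 /num2.
  transitivity (3 * z * 2 ^+ n.+2 * (o * pade_num n.+1 [:: - (3 * (2 * x0 ^+ 2 + 1)); - (2 * x0 ^+ 2 + 1)])
   + 2 * (y * y0) * (- 3) ^+ n.+2 * (o * pade_num n.+1 [:: 2 * y0 ^+ 2; - y0 ^+ 2]) +
   6 * (x * x0) * (o * pade_num n.+1 [:: 2 * x0 ^+ 2; 3 * x0 ^+ 2])); first by ring.
  by rewrite e0 e1 e2 yE xE zcE [2 ^+ n.+2]exprS [2 ^+ n.+1]exprS; ring.
rewrite M0 mulr0 => /esym/eqP; rewrite mulf_eq0 => /orP[].
  by rewrite eqz_nat -leqn0 leqNgt bin_gt0 -addnn leq_addr.
have : odd `|((-3) ^+ n.+2 * q1)%R|%N.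
  by apply: odd_prod => //; rewrite abszX oddX.
move: (_ * q1) (3 * c * _ * q0 + _) => a b.
clear; move=> oa /eqP; have [d aE] := half_int a; have {}aE : a = 2 * d + 1 by lia.
rewrite aE => h8.
have : 2 * (2 * (2 * (b + 2 * h * d + h + d) + 1)) = 0 by rewrite -[RHS]h8; ring.
by clear; lia.
Qed.

End Parity.

(** * Windows without solutions *)

Section Windows.
Variable R : realType.
Variables (x0 y0 x y z : int).
Hypotheses (y0_gt0 : 0 < y0) (y_gt0 : 0 < y) (z_gt0 : 0 < z).
Hypotheses (pell0 : y0 ^+ 2 = 3 * x0 ^+ 2 + 1) (pell : y ^+ 2 = 3 * x ^+ 2 + 1).
Hypothesis zE : z ^+ 2 = 2 * (2 * x0 ^+ 2 + 1) * x ^+ 2 + (2 * x0 ^+ 2 + 1) + 1.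
Hypotheses (x0_ge : 15 <= x0) (x_ge : 3 * x0 <= x).

Let X : R := x0%:~R.
Let a : R := x%:~R.
Let X_ge : 15 <= X. Proof. by rewrite /X (ler_int R 15). Qed.
Let a_ge : 3 * X <= a.
Proof. by rewrite /a /X -[3](_ : 3%:~R = _) // -intrM ler_int. Qed.
Let X_gt0 : 0 < X. Proof. by apply: lt_le_trans X_ge. Qed.
Let a_gt0 : 0 < a. Proof. by apply: lt_le_trans a_ge; rewrite mulr_gt0. Qed.

Let x0_gt0 : 0 < x0. Proof. by apply: lt_le_trans x0_ge. Qed.
Let x_gt0 : 0 < x. Proof. by apply: lt_le_trans x_ge; rewrite mulr_gt0. Qed.

Let form_le n := int_form_le x0_gt0 y0_gt0 pell0 R n x_gt0 y_gt0 z_gt0 pell zE.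

(** [pade_num_le] at [h = 1 / (6 e)], where [3 e h = 1 / 2] and
    [e h = 1 / 6], so that the product there is [12 / 5]. *)
Let num0_le n : 2 ^+ n.+1 * `|num0 x0 n|%:~R <= 49 / 10 * (390 * X ^+ 2) ^+ n :> R.
Proof.
set e : int := 2 * x0 ^+ 2 + 1.
have eE : e%:~R = 2 * X ^+ 2 + 1 :> R by rewrite /e rmorphD rmorphM rmorphXn.
pose E : R := e%:~R.
have X2 : 225 <= X ^+ 2 by have := X_ge; rewrite expr2; nra.
have E0 : 451 <= E by rewrite /E eE; lra.
have E1 : 0 < E by lra.
pose h := (6 * E)^-1.
have h0 : 0 < h by rewrite invr_gt0; lra.
have hE : E * h = 1 / 6 by rewrite /h; field; rewrite gt_eqF.
have h1 : h <= 1 / 2706 by nra.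
have e_gt0 : 0 < e by rewrite -(ltr0z R).
have h2 : h <= 1 by lra.
have r1 : `|- (3 * e)|%:~R = 3 * E.
  by rewrite normrN normrM intrM (gtr0_norm e_gt0).
have r2 : `|- e|%:~R = E by rewrite normrN (gtr0_norm e_gt0).
have hr r : r \in [:: - (3 * e); - e] -> `|r|%:~R * h < 1.
  by rewrite !inE => /orP[]/eqP->; rewrite ?r1 ?r2; nra.
apply: (@le_trans _ _ (2 ^+ n.+1 * ((4 / h) ^+ n * ((1 + h) * (12 / 5)) ^+ n.+1))).
  rewrite ler_wpM2l ?exprn_ge0 //; apply: (le_trans (pade_num_le n h0 h2 hr)).
  rewrite !big_cons big_nil r1 r2 -(mulrA 3) hE.
  by rewrite le_eqVlt; apply/orP; left; apply/eqP; congr (_ * (_ * _) ^+ _); field.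
have -> : 2 ^+ n.+1 * ((4 / h) ^+ n * ((1 + h) * (12 / 5)) ^+ n.+1) =
   24 / 5 * (1 + h) * (576 / 5 * (E + 1 / 6)) ^+ n.
  have -> : 576 / 5 * (E + 1 / 6) = 2 * (4 / h) * ((1 + h) * (12 / 5)).
    transitivity (576 / 5 * (E + E * h)); first by rewrite hE.
    by rewrite /h invrK -/h; field.
  by rewrite !exprMn !exprS; field.
have b0 : 0 <= 576 / 5 * (E + 1 / 6) by lra.
have b1 : 576 / 5 * (E + 1 / 6) <= 390 * X ^+ 2 by rewrite /E eE; lra.
apply: ler_pM.
- lra.
- exact: exprn_ge0.
- lra.
- by rewrite lerXn2r // nnegrE (le_trans b0).
Qed.

(** The same at [h = 1 / (4 y0^2)], where the product is [8 / 3]. *)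
Let num1_le n : 3 ^+ n.+1 * `|num1 y0 n|%:~R <= 81 / 10 * (390 * X ^+ 2) ^+ n :> R.
Proof.
set e : int := y0 ^+ 2.
have eE : e%:~R = 3 * X ^+ 2 + 1 :> R by rewrite /e pell0 rmorphD rmorphM rmorphXn.
pose E : R := e%:~R.
have X2 : 225 <= X ^+ 2 by have := X_ge; rewrite expr2; nra.
have E0 : 676 <= E by rewrite /E eE; lra.
have E1 : 0 < E by lra.
pose h := (4 * E)^-1.
have h0 : 0 < h by rewrite invr_gt0; lra.
have hE : E * h = 1 / 4 by rewrite /h; field; rewrite gt_eqF.
have h1 : h <= 1 / 2704 by nra.
have e_gt0 : 0 < e by rewrite -(ltr0z R).
have h2 : h <= 1 by lra.
have r1 : `|2 * e|%:~R = 2 * E.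
  by rewrite normrM intrM (gtr0_norm e_gt0).
have r2 : `|- e|%:~R = E by rewrite normrN (gtr0_norm e_gt0).
have hr r : r \in [:: 2 * e; - e] -> `|r|%:~R * h < 1.
  by rewrite !inE => /orP[]/eqP->; rewrite ?r1 ?r2; nra.
apply: (@le_trans _ _ (3 ^+ n.+1 * ((4 / h) ^+ n * ((1 + h) * (8 / 3)) ^+ n.+1))).
  rewrite ler_wpM2l ?exprn_ge0 //; apply: (le_trans (pade_num_le n h0 h2 hr)).
  rewrite !big_cons big_nil r1 r2 -(mulrA 2) hE.
  by rewrite le_eqVlt; apply/orP; left; apply/eqP; congr (_ * (_ * _) ^+ _); field.
have -> : 3 ^+ n.+1 * ((4 / h) ^+ n * ((1 + h) * (8 / 3)) ^+ n.+1) =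
   8 * (1 + h) * (128 * (E + 1 / 4)) ^+ n.
  have -> : 128 * (E + 1 / 4) = 3 * (4 / h) * ((1 + h) * (8 / 3)).
    transitivity (128 * (E + E * h)); first by rewrite hE.
    by rewrite /h invrK -/h; field.
  by rewrite !exprMn !exprS; field.
have b0 : 0 <= 128 * (E + 1 / 4) by lra.
have b1 : 128 * (E + 1 / 4) <= 390 * X ^+ 2 by rewrite /E eE; lra.
apply: ler_pM.
- lra.
- exact: exprn_ge0.
- lra.
- by rewrite lerXn2r // nnegrE (le_trans b0).
Qed.

Let form_bound n : `|int_form x0 y0 x y z n|%:~R <=
  16 * (X / a) * (390 * X ^+ 2) ^+ n + a / (8 * X ^+ 3) * (8 / (81 * X ^+ 4)) ^+ n.
Proof.
apply: (le_trans (form_le n)); apply: lerD => //.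
have X2 : 225 <= X ^+ 2 by have := X_ge; rewrite expr2; nra.
set p := (390 * X ^+ 2) ^+ n; have p0 : 0 <= p by rewrite exprn_ge0 // mulr_ge0 // ltW // exprn_gt0.
have X0 := X_gt0; have a0 := a_gt0.
have u0 : 0 <= 3 * (2 * X ^+ 2 + 2) / (4 * a * X) by rewrite divr_ge0 ?mulr_ge0 ?(ltW X0) ?(ltW a0) //; lra.
have v0 : 0 <= (3 * X ^+ 2 + 1) / (3 * a * X) by rewrite divr_ge0 ?mulr_ge0 ?(ltW X0) ?(ltW a0) //; lra.
apply: (@le_trans _ _ (49 / 10 * p * (3 * (2 * X ^+ 2 + 2) / (4 * a * X)) +
    81 / 10 * p * ((3 * X ^+ 2 + 1) / (3 * a * X)))).
  by apply: lerD; rewrite ler_wpM2r // ?num0_le ?num1_le.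
have -> : 49 / 10 * p * (3 * (2 * X ^+ 2 + 2) / (4 * a * X)) +
    81 / 10 * p * ((3 * X ^+ 2 + 1) / (3 * a * X)) = p * ((1545 / 100 * X ^+ 2 + 1005 / 100) / (a * X)).
  by field; rewrite !gt_eqF.
have -> : 16 * (X / a) * p = p * (16 * X ^+ 2 / (a * X)) by field; rewrite !gt_eqF.
rewrite ler_wpM2l // ler_wpM2r ?invr_ge0 ?mulr_ge0 ?(ltW X0) ?(ltW a0) //; lra.
Qed.

(** In this window the two parts of the bound on the integer [int_form] are at
    most [16 / 33] and [39 / 80], whose sum is less than 1. *)
Lemma window_free n : (0 < n)%N ->
  33 * x0 * (390 * x0 ^+ 2) ^+ n <= x -> 10 * x <= 39 * x0 ^+ 3 * (10 * x0 ^+ 4) ^+ n -> False.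
Proof.
move=> n0 lo up; have M1 : (1 : R) <= `|int_form x0 y0 x y z n|%:~R.
  by rewrite (ler_int R 1) -gtz0_ge1 normr_gt0 (int_form_neq0 pell0 pell).
have := le_trans M1 (form_bound n).
have lo' : 33 * X * (390 * X ^+ 2) ^+ n <= a.
  by move: lo; rewrite -(ler_int R) !(rmorphM, rmorphXn).
have up' : 10 * a <= 39 * X ^+ 3 * (10 * X ^+ 4) ^+ n.
  by move: up; rewrite -(ler_int R) !(rmorphM, rmorphXn).
have X0 := X_gt0; have a0 := a_gt0.
have t1 : 16 * (X / a) * (390 * X ^+ 2) ^+ n <= 16 / 33.
  rewrite (_ : _ * _ = 16 / 33 * (33 * X * (390 * X ^+ 2) ^+ n / a)); last by field; rewrite gt_eqF.
  have : 33 * X * (390 * X ^+ 2) ^+ n / a <= 1 by rewrite ler_pdivrMr // mul1r.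
  by move: (_ / a) => u; lra.
have t2 : a / (8 * X ^+ 3) * (8 / (81 * X ^+ 4)) ^+ n <= 39 / 80.
  have w : (80 / 81 : R) ^+ n <= 1 by apply: exprn_ile1; lra.
  have P0 : 0 < (10 * X ^+ 4) ^+ n by rewrite exprn_gt0 // mulr_gt0 // exprn_gt0.
  have -> : 8 / (81 * X ^+ 4) = (80 / 81) / (10 * X ^+ 4) by field; rewrite gt_eqF.
  rewrite expr_div_n.
  have -> : a / (8 * X ^+ 3) * ((80 / 81) ^+ n / (10 * X ^+ 4) ^+ n) =
     (80 / 81) ^+ n * (39 / 80 * (10 * a / (39 * X ^+ 3 * (10 * X ^+ 4) ^+ n))).
    by field; rewrite !gt_eqF.
  have w0 : 0 <= (80 / 81 : R) ^+ n by apply: exprn_ge0; lra.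
  have d0 : 0 < 39 * X ^+ 3 * (10 * X ^+ 4) ^+ n by rewrite (mulr_gt0 _ P0) // mulr_gt0 // exprn_gt0.
  have q1 : 10 * a / (39 * X ^+ 3 * (10 * X ^+ 4) ^+ n) <= 1 by rewrite ler_pdivrMr ?mul1r.
  have q0 : 0 <= 10 * a / (39 * X ^+ 3 * (10 * X ^+ 4) ^+ n).
    by rewrite divr_ge0 ?mulr_ge0 ?(ltW a0) // ltW.
  by have := ler_pM w0 q0 w q1; rewrite mulrCA mul1r; lra.
lra.
Qed.

End Windows.

(** * The windows cover a half-line *)

Section Covering.
Variable R : realType.
Variables (x0 y0 x y z : int).
Hypotheses (y0_gt0 : 0 < y0) (y_gt0 : 0 < y) (z_gt0 : 0 < z).
Hypotheses (pell0 : y0 ^+ 2 = 3 * x0 ^+ 2 + 1) (pell : y ^+ 2 = 3 * x ^+ 2 + 1).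
Hypothesis zE : z ^+ 2 = 2 * (2 * x0 ^+ 2 + 1) * x ^+ 2 + (2 * x0 ^+ 2 + 1) + 1.
Hypotheses (x0_ge : 15 <= x0) (x_ge : 3 * x0 <= x).

(** Write [lo n] for the lower end of the [n]-th window.  The second hypothesis
    says that [lo (n + 1)] is below the upper end of the [n]-th window for
    [n >= n0]: from [lo n <= x] one gets [lo (n + 1) <= x], forever. *)
Lemma covering n0 : (0 < n0)%N ->
  (forall n, (n0 <= n)%N -> 3300 * 39 ^+ n <= (x0 ^+ 2) ^+ n) ->
  33 * x0 * (390 * x0 ^+ 2) ^+ n0 <= x -> False.
Proof.
move=> n0_gt0 hn lo0.
have x0_gt0 : 0 < x0 by apply: lt_le_trans x0_ge.
pose lo n := 33 * x0 * (390 * x0 ^+ 2) ^+ n.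
have lo_gt n : n%:Z < lo n.
  have h1 : 1 <= 33 * x0 by clear - x0_gt0; lia.
  rewrite /lo; apply: (@lt_le_trans _ _ (1 * (2 ^+ n))).
    by rewrite mul1r -natrX natz ltz_nat ltn_expl.
  have x2 : 1 <= x0 ^+ 2 by rewrite expr_ge1 // ltW.
  have h2 : 2 <= 390 * x0 ^+ 2 by clear - x2; lia.
  by rewrite ler_pM ?exprn_ge0 // lerXn2r // nnegrE (le_trans _ h2).
have step n : (n0 <= n)%N -> lo n <= x -> lo n.+1 <= x.
  move=> hle low; rewrite leNgt; apply/negP => up.
  apply: (window_free R y0_gt0 y_gt0 z_gt0 pell0 pell zE x0_ge x_ge (n := n) _ low).
    exact: leq_trans hle.
  apply: (@le_trans _ _ (10 * lo n.+1)); first by rewrite ler_pM2l // ltW.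
  have -> : 10 * lo n.+1 = 39 * x0 ^+ 3 * (10 * x0 ^+ 2) ^+ n * (3300 * 39 ^+ n).
    rewrite /lo; have -> : 390 * x0 ^+ 2 = 39 * (10 * x0 ^+ 2) by ring.
    by rewrite exprMn !exprS expr0; ring.
  have -> : 39 * x0 ^+ 3 * (10 * x0 ^+ 4) ^+ n = 39 * x0 ^+ 3 * (10 * x0 ^+ 2) ^+ n * (x0 ^+ 2) ^+ n.
    have -> : 10 * x0 ^+ 4 = 10 * x0 ^+ 2 * x0 ^+ 2 by ring.
    by rewrite [(10 * _ * _) ^+ n]exprMn mulrA.
  by rewrite ler_wpM2l ?hn // !mulr_ge0 ?exprn_ge0 ?mulr_ge0 ?sqr_ge0 // ltW.
have all_lo n : (n0 <= n)%N -> lo n <= x.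
  move=> /subnK <-; elim: (n - n0)%N => // k IH; rewrite addSn; apply: step => //.
  by rewrite leq_addl.
have x_gt0 : 0 < x by apply: lt_le_trans x_ge; rewrite mulr_gt0.
have := all_lo (n0 + `|x|)%N (leq_addr _ _).
have := lo_gt (n0 + `|x|)%N; move: (lo _) => l; clear; lia.
Qed.

Lemma far_no_solution : 33 * x0 * (390 * x0 ^+ 2) ^+ 6 <= x -> False.
Proof.
apply: (covering (n0 := 6) isT) => n n6.
have x2 : 39 * 5 <= x0 ^+ 2.
  by have : 15 * 15 <= x0 ^+ 2; [rewrite expr2 ler_pM | clear; lia].
apply: (@le_trans _ _ ((39 * 5) ^+ n)); last by rewrite lerXn2r ?nnegrE ?sqr_ge0.
rewrite exprMn mulrC; apply: ler_wpM2l; first exact: exprn_ge0.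
apply: (@le_trans _ _ (5 ^+ 6)); first by clear; lia.
exact: ler_weXn2l.
Qed.

Let X : R := x0%:~R.
Let a : R := x%:~R.
Let x0_gt0 : 0 < x0. Proof. by apply: lt_le_trans x0_ge. Qed.
Let x_gt0 : 0 < x. Proof. by apply: lt_le_trans x_ge; rewrite mulr_gt0. Qed.
Let X_gt0 : 0 < X. Proof. by rewrite ltr0z. Qed.
Let a_gt0 : 0 < a. Proof. by rewrite ltr0z. Qed.
Let X_ge : 15 <= X. Proof. by rewrite /X (ler_int R 15). Qed.
Let a_ge : 3 * X <= a.
Proof. by rewrite /a /X -[3](_ : 3%:~R = _) // -intrM ler_int. Qed.

Let form_le n := int_form_le x0_gt0 y0_gt0 pell0 R n x_gt0 y_gt0 z_gt0 pell zE.

(** For [n = 0] the form is [6 (y y0 - x x0 - z)], and it is less than 6 in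
    absolute value in this range. *)
Lemma near_regular : x <= 30 * x0 ^+ 3 -> z = y * y0 - x * x0.
Proof.
move=> near.
have near' : a <= 30 * X ^+ 3 by move: near; rewrite -(ler_int R) !(rmorphM, rmorphXn).
have := form_le 0; rewrite /num0 /num1 !pade_num0 !expr1 expr0 mulr1 normrN1 !mulr1 -/X -/a => h.
have {h} : `|int_form x0 y0 x y z 0|%:~R < 6 :> R.
  apply: (le_lt_trans h).
  have X0 := X_gt0; have a0 := a_gt0; have X15 := X_ge; have aX := a_ge.
  have -> : 2 * (3 * (2 * X ^+ 2 + 2) / (4 * a * X)) + 3 * ((3 * X ^+ 2 + 1) / (3 * a * X)) +
     a / (8 * X ^+ 3) = (6 * X ^+ 2 + 4) / (a * X) + a / (8 * X ^+ 3).
    by field; rewrite !gt_eqF.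
  have t1 : (6 * X ^+ 2 + 4) / (a * X) <= 202 / 100.
    by rewrite ler_pdivrMr ?mulr_gt0 //; nra.
  have t2 : a / (8 * X ^+ 3) <= 30 / 8.
    by rewrite ler_pdivrMr ?mulr_gt0 ?exprn_gt0 //; lra.
  lra.
rewrite (ltr_int R _ 6) /int_form /num0 /num1 /num2 !pade_num0 !expr1.
have -> : 3 * z * 2 * -1 + 2 * y * y0 * (- 3) * -1 + 6 * x * x0 * -1 = 6 * (y * y0 - x * x0 - z).
  by ring.
move: (y * y0 - x * x0) => m h.
suff : m - z = 0 by clear; lia.
by move: h; move: (m - z) => u; clear; lia.
Qed.

(** Just below the window for [n = 1], the form with [n = 1] is less than 24 in
    absolute value; but it is a multiple of 24 by [parities], and not zero. *)
Lemma middle_empty : 30 * x0 ^+ 3 <= x -> x <= 33 * 390 * x0 ^+ 3 -> False.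
Proof.
move=> lo up.
have lo' : 30 * X ^+ 3 <= a by move: lo; rewrite -(ler_int R) !(rmorphM, rmorphXn).
have up' : a <= 33 * 390 * X ^+ 3 by move: up; rewrite -(ler_int R) !(rmorphM, rmorphXn).
have [h [k [c [yE xE zc]]]] := parities pell0 pell zE.
have n0E : num0 x0 1 = 64 * x0 ^+ 2 + 26.
  by rewrite /num0 pade_num1 !big_cons big_nil; ring.
have n1E : num1 y0 1 = - (24 * x0 ^+ 2 + 14).
  by rewrite /num1 pade_num1 !big_cons big_nil pell0; ring.
have n2E : num2 x0 1 = - (40 * x0 ^+ 2 + 6).
  by rewrite /num2 pade_num1 !big_cons big_nil; ring.
have M24 : 24 <= `|int_form x0 y0 x y z 1|.
  have := int_form_neq0 pell0 pell zE (n := 1) isT.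
  have -> : int_form x0 y0 x y z 1 = 24 * (c * (64 * x0 ^+ 2 + 26)
      - 3 * (2 * h + 1) * (12 * x0 ^+ 2 + 7) - k * (40 * x0 ^+ 2 + 6)).
    rewrite /int_form n0E n1E n2E -(mulrA 2 y) -(mulrA 6 x) yE xE zc; ring.
  by move: (_ - _) => w; clear; lia.
have p0 : 0 <= 64 * x0 ^+ 2 + 26 by have := sqr_ge0 x0; clear; lia.
have p1 : 0 <= 24 * x0 ^+ 2 + 14 by have := sqr_ge0 x0; clear; lia.
have := form_le 1; rewrite n0E n1E normrN (ger0_norm p0) (ger0_norm p1) => hle.
have X0 := X_gt0; have a0 := a_gt0; have X15 := X_ge.
have X2 : 225 <= X ^+ 2 by rewrite expr2; nra.
have X3 : 0 < X ^+ 3 by rewrite exprn_gt0.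
have M24' : 24 <= `|int_form x0 y0 x y z 1|%:~R :> R by rewrite (ler_int R 24).
have c0 : (64 * x0 ^+ 2 + 26)%:~R = 64 * X ^+ 2 + 26 :> R.
  by rewrite rmorphD rmorphM rmorphXn.
have c1 : (24 * x0 ^+ 2 + 14)%:~R = 24 * X ^+ 2 + 14 :> R.
  by rewrite rmorphD rmorphM rmorphXn.
have {hle} := le_trans M24' hle; rewrite c0 c1 -/X -/a expr1.
have -> : 2 ^+ 2 * (64 * X ^+ 2 + 26) * (3 * (2 * X ^+ 2 + 2) / (4 * a * X)) +
  3 ^+ 2 * (24 * X ^+ 2 + 14) * ((3 * X ^+ 2 + 1) / (3 * a * X)) +
  a / (8 * X ^+ 3) * (8 / (81 * X ^+ 4)) =
  (600 * X ^+ 4 + 738 * X ^+ 2 + 198) / (a * X) + a / X ^+ 3 / (81 * X ^+ 4).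
  by field; rewrite !gt_eqF.
have X4 : X ^+ 4 = X ^+ 2 * X ^+ 2 by ring.
have X4' : 225 * X ^+ 2 <= X ^+ 4 by rewrite X4 ler_wpM2r ?sqr_ge0.
have t1 : (600 * X ^+ 4 + 738 * X ^+ 2 + 198) / (a * X) <= 22.
  rewrite ler_pdivrMr ?mulr_gt0 //.
  have : 30 * X ^+ 4 <= a * X by rewrite (_ : 30 * X ^+ 4 = 30 * X ^+ 3 * X) ?ler_pM2r //; ring.
  lra.
have t2 : a / X ^+ 3 / (81 * X ^+ 4) <= 1.
  rewrite ler_pdivrMr ?mulr_gt0 ?exprn_gt0 // mul1r.
  have : a / X ^+ 3 <= 33 * 390 by rewrite ler_pdivrMr.
  by move: (_ / _) => u hu; lra.
lra.
Qed.

(** All [x] above [30 x0^3] are excluded.  Below, [near_regular] gives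
    [z = y y0 - x x0], and then [zE] forces [x y0 - y x0 = 1]: in terms of
    [(2 + sqrt 3)^k] the two indices differ by one. *)
Theorem large_regular : 780 <= x0 -> x = 2 * x0 + y0.
Proof.
move=> x0_large.
(* Above [30 x0^3]: first the gap below the window for [n = 1], then all
   windows from [n = 1] on *)
have [near|far] := lerP x (30 * x0 ^+ 3); last first.
  exfalso; have [mid|far'] := lerP x (33 * 390 * x0 ^+ 3).
    exact: middle_empty (ltW far) mid.
  apply: (covering (n0 := 1) isT) => [n n1|]; last first.
    by apply: ltW; rewrite expr1 (_ : _ * _ = 33 * 390 * x0 ^+ 3) //; ring.
  have x2 : 39 * 3300 <= x0 ^+ 2.
    have : 780 * 780 <= x0 ^+ 2 by rewrite expr2; apply: ler_pM.
    by clear; lia.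
  apply: (@le_trans _ _ ((39 * 3300) ^+ n)).
    rewrite exprMn mulrC; apply: ler_wpM2l; first exact: exprn_ge0.
    by rewrite -[X in X <= _]expr1; apply: ler_weXn2l.
  by rewrite lerXn2r // nnegrE ?sqr_ge0.
have zE' := near_regular near.
have sq1 : (x * y0 - y * x0) ^+ 2 = 1.
  have e1 : z ^+ 2 = y ^+ 2 * y0 ^+ 2 + x ^+ 2 * x0 ^+ 2 - 2 * x * x0 * y * y0 by rewrite zE'; ring.
  have e2 : (x * y0 - y * x0) ^+ 2 = x ^+ 2 * y0 ^+ 2 + y ^+ 2 * x0 ^+ 2 - 2 * x * x0 * y * y0 by ring.
  move: e1; rewrite zE e2 pell pell0 => e1.
  have -> : 2 * x * x0 * y * y0 = (3 * x ^+ 2 + 1) * (3 * x0 ^+ 2 + 1) + x ^+ 2 * x0 ^+ 2 -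
      (2 * (2 * x0 ^+ 2 + 1) * x ^+ 2 + (2 * x0 ^+ 2 + 1) + 1) by rewrite e1; ring.
  by ring.
have w4 : (y * y0 - 3 * x * x0) ^+ 2 = 4.
  transitivity ((y ^+ 2 - 3 * x ^+ 2) * (y0 ^+ 2 - 3 * x0 ^+ 2) + 3 * (x * y0 - y * x0) ^+ 2); first by ring.
  by rewrite sq1 pell pell0; ring.
have xx0 := x0_gt0; have xx := x_gt0.
have d_gt0 : 0 < x * y0 - y * x0.
  rewrite subr_gt0 -ltr_sqr ?nnegrE ?mulr_ge0 ?(ltW xx) ?(ltW xx0) ?(ltW y_gt0) ?(ltW y0_gt0) //.
  rewrite !exprMn pell pell0.
  rewrite -subr_gt0 (_ : _ - _ = (x - x0) * (x + x0)); last by ring.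
  by apply: mulr_gt0; clear - x_ge xx0; lia.
have w_gt0 : 0 < y * y0 - 3 * x * x0.
  rewrite subr_gt0 -ltr_sqr ?nnegrE ?mulr_ge0 ?(ltW xx) ?(ltW xx0) ?(ltW y_gt0) ?(ltW y0_gt0) //.
  rewrite !exprMn pell pell0 -subr_gt0 (_ : _ - _ = 3 * x ^+ 2 + 3 * x0 ^+ 2 + 1); last by ring.
  by rewrite !addr_gt0 ?mulr_gt0 ?exprn_gt0.
have d1 : x * y0 - y * x0 = 1.
  by move: d_gt0 sq1; move: (_ - _) => d; clear; nia.
have w2 : y * y0 - 3 * x * x0 = 2.
  by move: w_gt0 w4; move: (_ - _) => d; clear; nia.
transitivity ((x * y0 - y * x0) * y0 + (y * y0 - 3 * x * x0) * x0).
  transitivity (x * (y0 ^+ 2 - 3 * x0 ^+ 2)); first by rewrite pell0; ring.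
  by ring.
by rewrite d1 w2; ring.
Qed.

End Covering.

(** * Quadratic reciprocity and Jacobi symbols *)

(** The Legendre symbol, defined by Euler's criterion. *)
Definition legendre (q : nat) (a : 'F_q) : int :=
  if a == 0 then 0 else if a ^+ q.-1./2 == 1 then 1 else -1.

Section Legendre.
Variable q : nat.
Hypotheses (q_prime : prime q) (q_odd : odd q).
Implicit Types a b : 'F_q.

Lemma Fp_card_pred a : a != 0 -> a ^+ q.-1 = 1.
Proof.
move=> a0; have := expf_card a; rewrite card_Fp // => aq.
by apply: (mulfI a0); rewrite mulr1 -exprS prednK ?prime_gt0.
Qed.

Lemma half_pred : (q.-1./2 * 2 = q.-1)%N.
Proof. by have := prime_gt0 q_prime; lia. Qed.

Lemma euler_sign a : a != 0 -> (a ^+ q.-1./2 == 1) || (a ^+ q.-1./2 == -1).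
Proof.
move=> a0; rewrite -eqf_sqr expr1n -exprM half_pred; exact/eqP/Fp_card_pred.
Qed.

Lemma Fp_m1_neq1 : (-1 : 'F_q) != 1.
Proof.
have q3 : (2 < q)%N by have := prime_gt1 q_prime; lia.
rewrite eq_sym -addr_eq0 -(natrD _ 1 1) -(dvdn_pcharf (pchar_Fp q_prime)).
by rewrite gtnNdvd.
Qed.

Lemma legendreM a b : legendre (a * b) = legendre a * legendre b.
Proof.
rewrite /legendre mulf_eq0; case: eqP => [//|/eqP a0] /=; first by rewrite mul0r.
case: eqP => [//|/eqP b0] /=; first by rewrite mulr0.
rewrite exprMn; have := Fp_m1_neq1; have := euler_sign a0; have := euler_sign b0.
by case/orP=> /eqP -> /orP[]/eqP-> /negPf m1; rewrite ?mulr1 ?mul1r ?mulrNN ?mulr1 ?eqxx ?m1.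
Qed.

Lemma legendre_sqr a : a != 0 -> legendre a ^+ 2 = 1.
Proof. by rewrite /legendre => /negPf ->; case: ifP. Qed.

Lemma exists_nonresidue : exists2 a : 'F_q, a != 0 & legendre a = -1.
Proof.
case: (pickP (fun a : 'F_q => (a != 0) && (a ^+ q.-1./2 != 1))) => [a /andP[a0 a1]|H].
  by exists a => //; rewrite /legendre (negPf a0) (negPf a1).
exfalso; have q3 : (2 < q)%N by have := prime_gt1 q_prime; lia.
pose P : {poly 'F_q} := 'X^(q.-1./2) - 1.
have szP : size P = (q.-1./2).+1 by rewrite size_XnsubC //; lia.
have := @max_poly_roots _ P (enum (predC1 (0 : 'F_q))).
rewrite -size_poly_gt0 szP enum_uniq => /(_ isT).
have -> : all (root P) (enum (predC1 (0 : 'F_q))).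
  apply/allP => a; rewrite mem_enum => /= a0.
  rewrite /root hornerD hornerN hornerXn hornerC subr_eq0.
  by have := H a; rewrite [a != 0]a0 /= => /negbFE.
move=> /(_ isT isT); rewrite -cardE cardC1 card_Fp //.
by have := half_pred; lia.
Qed.

Lemma sum_legendre : \sum_(a : 'F_q) legendre a = 0.
Proof.
have [u u0 lu] := exists_nonresidue.
have h : \sum_(a : 'F_q) legendre a = - \sum_(a : 'F_q) legendre a.
  rewrite {1}(reindex_inj (mulfI u0)) /= -sumrN; apply: eq_bigr => a _.
  by rewrite legendreM lu mulN1r.
by move: h; lia.
Qed.
End Legendre.

Section GaussSum.
Variables (p q : nat).
Hypotheses (p_prime : prime p) (q_prime : prime q) (q_odd : odd q) (pq : p != q).

(** A field of order [p^(q-1)] has elements of order [q]. *)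
Lemma exists_root_of_unity :
  exists (K : finFieldType) (zeta : K),
    [/\ p \in [pchar K], zeta ^+ q = 1 & zeta != 1].
Proof.
have q1 : (0 < q.-1)%N by have := prime_gt1 q_prime; lia.
have [K charK cardK] := PrimePowerField p_prime q1.
have dv : (q %| #|[set: {unit K}]|)%N.
  rewrite card_finField_unit cardK.
  have cop : coprime p q by rewrite prime_coprime // dvdn_prime2.
  have := Euler_exp_totient cop; rewrite totient_prime // => /eqP.
  by rewrite eqn_mod_dvd ?expn_gt0 ?prime_gt0 // subn1.
have [x _ ox] := Cauchy q_prime dv.
exists K, (val x); split => //.
  by have := expg_order x; rewrite ox => /(congr1 val); rewrite FinRing.val_unitX FinRing.val_unit1.
apply: contraTneq (prime_gt1 q_prime) => x1.
by rewrite -ox (_ : x = 1%g) ?order1 //; apply: val_inj.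
Qed.

(** Quadratic reciprocity together with Euler's criterion: [q' = (-1/q) q] to
    the power [(p-1)/2] is [(p/q)] modulo [p].  In a field of characteristic [p]
    with a [q]-th root of unity, the Gauss sum [g] satisfies [g^2 = q'], and the
    Frobenius map gives [g^p = (p/q) g]. *)
Theorem legendre_reciprocity :
  odd p ->
  (p %| `|((legendre (-1 : 'F_q) * q%:Z) ^+ p.-1./2 - legendre (p%:R : 'F_q))%R|)%N.
Proof.
move=> p_odd.
have [K [zeta [charK zetaq zeta1]]] := exists_root_of_unity.
pose chi (a : 'F_q) : K := (legendre a)%:~R.
pose e (a : 'F_q) : K := zeta ^+ (a : nat).
have q_gt0 : (0 < q)%N by rewrite prime_gt0.
have e_mod n : zeta ^+ (n %% q) = zeta ^+ n by rewrite expr_mod.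
have eD a b : e (a + b) = e a * e b.
  rewrite /e -exprD /= -[RHS]e_mod; congr (zeta ^+ (_ %% _)).
  exact: Fp_cast.
have eM (a : 'F_q) n : e (a * n%:R) = e a ^+ n.
  elim: n => [|n IH]; first by rewrite mulr0 /e expr0 expr0.
  by rewrite -addn1 natrD mulrDr mulr1 eD IH exprD.
have e1 : e 1 = zeta.
  by rewrite /e /= (Fp_cast q_prime) modn_small ?prime_gt1 // expr1.
have sum_e d : \sum_(a : 'F_q) e (a * d) = if d == 0 then q%:R else 0.
  case: eqP => [->|/eqP d0].
    rewrite (eq_bigr (fun _ => 1)) => [|a _]; last by rewrite mulr0 /e expr0.
    by rewrite sumr_const card_Fp.
  rewrite -(reindex_inj (mulIf d0) (P := predT) (F := e)).
  have h : zeta * \sum_a e a = \sum_a e a.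
    rewrite [RHS](reindex_inj (addrI 1)) /= mulr_sumr; apply: eq_bigr => a _.
    by rewrite eD e1.
  apply/eqP; move/eqP: h; rewrite -subr_eq0 -{2}[\sum_a e a]mul1r -mulrBl mulf_eq0.
  by rewrite subr_eq0 (negPf zeta1).
pose g := \sum_(a : 'F_q) chi a * e a.
have chiM a b : chi (a * b) = chi a * chi b by rewrite /chi legendreM // intrM.
have g2 : g ^+ 2 = (legendre (-1 : 'F_q) * q%:Z)%:~R.
  have chi0 : chi 0 = 0 by rewrite /chi /legendre eqxx.
  have step a : chi a * e a * g = (a != 0)%:R * \sum_c chi c * e (a * (1 + c)).
    have [->|a0] := eqVneq a 0; first by rewrite chi0 !mul0r.
    rewrite mul1r /g (reindex_inj (mulfI a0)) /= mulr_sumr; apply: eq_bigr => c _.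
    have chia : chi a * chi a = 1 by rewrite /chi -intrM -expr2 legendre_sqr.
    rewrite chiM mulrDr mulr1 eD.
    by transitivity (chi a * chi a * chi c * (e a * e (a * c))); [ring | rewrite chia mul1r].
  rewrite expr2 {1}/g mulr_suml (eq_bigr _ (fun a _ => step a)).
  under eq_bigr do rewrite mulr_sumr.
  rewrite exchange_big /=.
  transitivity (\sum_c chi c * ((if 1 + c == 0 then q%:R else 0) - 1)).
    apply: eq_bigr => c _; rewrite -sum_e (bigD1 0) //= [in RHS](bigD1 0) //=.
    have e0 : e 0 = 1 by rewrite /e expr0.
    rewrite !mul0r add0r e0 addrAC subrr add0r mulr_sumr.
    by apply: eq_bigr => a a0; rewrite a0 mul1r.
  under eq_bigr do rewrite mulrBr mulr1.
  rewrite sumrB -[\sum_i chi i](rmorph_sum (intr : int -> K)) sum_legendre // subr0.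
  rewrite (bigD1 (-1)) //= subrr eqxx big1 ?addr0 => [|c cm1].
    by rewrite intrM.
  by rewrite addrC addr_eq0 (negPf cm1) mulr0.
have p0 : (p%:R : 'F_q) != 0.
  by rewrite -(dvdn_pcharf (pchar_Fp q_prime)) dvdn_prime2 // eq_sym.
have gp : g ^+ p = chi p%:R * g.
  have gE : g = \sum_a chi (a * p%:R) * e (a * p%:R) by rewrite /g (reindex_inj (mulIf p0)).
  rewrite [in RHS]gE mulr_sumr -(pFrobenius_autE charK) rmorph_sum /=.
  apply: eq_bigr => a _; rewrite rmorphM /= rmorph_int pFrobenius_autE -eM mulrA.
  congr (_ * _); rewrite /chi -intrM legendreM // mulrCA -expr2 legendre_sqr //.
  by rewrite mulr1.
have g0 : g != 0.
  rewrite -sqrf_eq0 g2 intrM mulf_neq0 //.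
    have := legendre_sqr (a := (-1 : 'F_q)); rewrite oppr_eq0 oner_eq0 => /(_ isT) h.
    by rewrite -sqrf_eq0 -rmorphXn /= h oner_eq0.
  by rewrite -pmulrn -(dvdn_pcharf charK) dvdn_prime2.
have gp1 : g ^+ p.-1 = chi p%:R.
  by apply: (mulIf g0); rewrite -exprSr prednK ?prime_gt0.
have hp : (2 * p.-1./2 = p.-1)%N by have := prime_gt0 p_prime; lia.
have : (((legendre (-1 : 'F_q) * q%:Z) ^+ p.-1./2 - legendre (p%:R : 'F_q))%:~R : K) = 0.
  by rewrite intrB rmorphXn /= -g2 -exprM hp gp1 subrr.
move: (_ - _) => n; rewrite {1}[n]intEsign rmorphM rmorph_sign /= => /eqP.
by rewrite mulf_eq0 signr_eq0 /= -pmulrn -(dvdn_pcharf charK).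
Qed.

End GaussSum.

Section Jacobi.
Variables (T : nat) (qs : seq nat) (s a : int).
Hypotheses (T1 : (T %% 4 = 1)%N) (s1 : s = 1 \/ s = -1).
Hypotheses (qs_prime : all prime qs) (qs_odd : all odd qs) (qs_cop : all (fun q => ~~ (q %| T)%N) qs).

Let N : int := s * \prod_(q <- qs) (legendre (-1 : 'F_q) * q%:Z).
Hypothesis aT : (T %| `|a ^+ 2 - N|)%N.

Let sign (m : nat) : int := if (s == 1) || (m %% 4 == 1)%N then 1 else -1.
Let phi (m : nat) : int := sign m * \prod_(q <- qs) legendre (m%:R : 'F_q).

Let signM m n : odd m -> odd n -> sign (m * n) = sign m * sign n.
Proof.
rewrite /sign; case: (s == 1) => //= om on; rewrite -modnMm.
have : (m %% 4 = 1 \/ m %% 4 = 3)%N by lia.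
have : (n %% 4 = 1 \/ n %% 4 = 3)%N by lia.
by case=> -> [] ->.
Qed.

Let phiM m n : odd m -> odd n -> phi (m * n) = phi m * phi n.
Proof.
move=> om on; rewrite /phi signM // mulrACA -big_split /=; congr (_ * _).
rewrite big_seq [RHS]big_seq; apply: eq_bigr => q qin.
by rewrite natrM legendreM // ?(allP qs_prime) ?(allP qs_odd).
Qed.

Let T_odd : odd T.
Proof. by have := T1; lia. Qed.

Let phi_prime p : prime p -> (p %| T)%N -> phi p = 1.
Proof.
move=> pp pT; have p_odd : odd p by apply: dvdn_odd pT T_odd.
have hp : (2 * p.-1./2 = p.-1)%N by have := prime_gt0 pp; lia.
have h0 : (0 < p.-1./2)%N by have := prime_gt1 pp; lia.
have div0 (n : int) : (p %| `|n|)%N = (n%:~R == 0 :> 'F_p).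
  rewrite [X in X%:~R]intEsign rmorphM rmorph_sign /= mulf_eq0 signr_eq0 /=.
  by rewrite -pmulrn -(dvdn_pcharf (pchar_Fp pp)).
have Nphi : (N%:~R : 'F_p) ^+ p.-1./2 = (phi p)%:~R.
  rewrite /N /phi !rmorphM /= exprMn; congr (_ * _).
    rewrite /sign; case: s1 => ->; first by rewrite eqxx expr1n.
    rewrite /= rmorphN -signr_odd.
    have : (p %% 4 = 1 \/ p %% 4 = 3)%N by lia.
    case=> pm; rewrite pm /=.
      by have -> : odd p.-1./2 = false by lia.
    by have -> : odd p.-1./2 = true by lia.
  rewrite !rmorph_prod /= -prodrXl big_seq [RHS]big_seq; apply: eq_bigr => q qin.
  have qp := allP qs_prime _ qin; have qo := allP qs_odd _ qin.
  have pq : p != q by apply: contraTneq pT => ->; exact: (allP qs_cop).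
  have := legendre_reciprocity pp qp qo pq p_odd.
  by rewrite div0 rmorphB rmorphXn /= subr_eq0 => /eqP.
have phi2 : phi p ^+ 2 = 1.
  rewrite /phi exprMn -prodrXl big_seq big1 => [|q qin].
    by rewrite mulr1 /sign; case: ifP.
  apply: legendre_sqr; have qp := allP qs_prime _ qin.
  rewrite -(dvdn_pcharf (pchar_Fp qp)) dvdn_prime2 //.
  by apply: contraTneq pT => <-; exact: (allP qs_cop).
have phi_neq0 : (phi p)%:~R != 0 :> 'F_p.
  by rewrite -sqrf_eq0 -rmorphXn /= phi2 oner_eq0.
have Na : (N%:~R : 'F_p) = a%:~R ^+ 2.
  apply/esym/eqP; rewrite -subr_eq0 -rmorphXn -rmorphB /= -div0.
  exact: dvdn_trans aT.
have a0 : a%:~R != 0 :> 'F_p.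
  apply: contraNneq phi_neq0 => a0; rewrite -Nphi Na a0.
  by rewrite -exprM expr0n muln_eq0 /= -leqn0 leqNgt h0.
move: Nphi; rewrite Na -exprM hp Fp_card_pred // => e1.
have := phi2; move/eqP; rewrite sqrf_eq1 => /orP[/eqP//|/eqP em1].
by move: e1; rewrite em1 rmorphN1 => /esym/eqP; rewrite (negPf (Fp_m1_neq1 pp p_odd)).
Qed.

(** For [T = 1] modulo 4 the product of the [(T/q)] is the Jacobi symbol
    [(N/T)], and it is 1 when [N] is a square modulo [T].  The function [phi] is
    multiplicative on odd numbers and, by reciprocity, [phi p = (N/p) = 1] for
    the primes [p] dividing [T].  Its factor [sign] is the symbol [(s/m)]. *)
Theorem jacobi_eq1 : \prod_(q <- qs) legendre (T%:R : 'F_q) = 1.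
Proof.
suff : phi T = 1 by rewrite /phi /sign T1 eqxx orbT mul1r.
suff H n : forall m, (m < n)%N -> (m %| T)%N -> phi m = 1 by exact: (H T.+1).
elim: n => // n IH m mn mT.
have m_odd : odd m by apply: dvdn_odd mT T_odd.
have [m1|m1] := leqP m 1.
  have -> : m = 1%N by lia.
  rewrite /phi /sign orbT mul1r big1 // => q _.
  by rewrite /legendre oner_eq0 expr1n eqxx.
have pm := pdiv_dvd m; have pp := pdiv_prime m1.
have mE := divnK pm; rewrite -[in LHS]mE.
have dm : (m %/ pdiv m %| m)%N by apply/dvdnP; exists (pdiv m); rewrite mulnC mE.
rewrite phiM ?(dvdn_odd dm) ?(dvdn_odd pm) //.
rewrite (phi_prime pp (dvdn_trans pm mT)) mulr1; apply: IH (dvdn_trans dm mT).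
by apply: (@leq_trans m); rewrite // ltn_Pdiv ?prime_gt1 // ltnW.
Qed.

End Jacobi.

(** * Index 0 *)

Local Close Scope ring_scope.

Definition power_mod (q m h : nat) := iter h (fun c => (c * m) %% q) 1.

(** A computable form of the Legendre symbol. *)
Definition legendre_val (q m : nat) : int :=
  if m %% q == 0 then 0%R else if power_mod q (m %% q) q.-1./2 == 1 then 1%R else (-1)%R.

Lemma legendre_natE q m : prime q -> legendre (m%:R : 'F_q)%R = legendre_val q m.
Proof.
move=> pq; rewrite /legendre /legendre_val.
have F0 k : ((k%:R : 'F_q) == 0)%R = (k %% q == 0).
  by rewrite -(dvdn_pcharf (pchar_Fp pq)).
have pm h : ((power_mod q (m %% q) h)%:R = m%:R ^+ h :> 'F_q)%R.
  elim: h => [|h IH]; first by rewrite expr0.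
  rewrite /= -[LHS]/(((power_mod q (m %% q) h * (m %% q)) %% q)%:R)%R.
  by rewrite Fp_nat_mod // natrM IH Fp_nat_mod // exprSr.
rewrite F0 -pm; case: (m %% q == 0) => //.
have lt1 h : power_mod q (m %% q) h < q.
  by case: h => [|h] /=; [exact: prime_gt1 | rewrite ltn_mod prime_gt0].
have -> // : ((power_mod q (m %% q) q.-1./2)%:R == 1 :> 'F_q)%R = (power_mod q (m %% q) q.-1./2 == 1).
apply/idP/idP => /eqP; last by move=> ->.
have one : (1 = 1%:R :> 'F_q)%R by [].
move=> e1; have := congr1 (fun z : 'F_q => z : nat) e1.
by rewrite one !(val_Fp_nat pq) (modn_small (lt1 _)) (modn_small (prime_gt1 pq)) => ->.
Qed.

Lemma legendre_m1E q : prime q -> legendre (-1 : 'F_q)%R = legendre_val q q.-1.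
Proof.
move=> pq; rewrite -legendre_natE //; congr legendre.
have h := prime_gt0 pq; apply/eqP; rewrite -subr_eq0 -opprD oppr_eq0 addrC.
by rewrite -(natrD _ _ 1) addn1 prednK // -(dvdn_pcharf (pchar_Fp pq)).
Qed.

(** The map [T_n -> T_(2n) = 2 T_n^2 - 1] modulo [q]. *)
Definition double_mod (q c : nat) := (2 * (c * c) + q.-1) %% q.

Lemma pell_double_mod D a b q n : a * a = D * (b * b) + 1 -> 0 < q ->
  pell_t D a b (2 * n) %% q = double_mod q (pell_t D a b n %% q).
Proof.
move=> nrm q0; have [e _] := pell_double nrm n.
rewrite /double_mod -modnDml -modnMmr modnMm modnMmr modnDml.
rewrite -e -[in LHS](modnDr _ q); congr (_ %% q); lia.
Qed.

Lemma pell_t_odd D a b n : a * a = D * (b * b) + 1 -> ~~ odd D -> odd (pell_t D a b n).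
Proof.
move=> nrm dD; have := congr1 odd (pell_norm nrm n).
by rewrite oddD !oddM (negPf dD) /= andbb.
Qed.

Lemma pell_even_mod4 D a b n : a * a = D * (b * b) + 1 -> ~~ odd D ->
  pell_t D a b (2 * n) %% 4 = 1.
Proof.
move=> nrm dD; rewrite (pell_double_mod _ nrm) // /double_mod.
have o := pell_t_odd n nrm dD.
have : (pell_t D a b n %% 4 = 1 \/ pell_t D a b n %% 4 = 3) by lia.
by case=> ->.
Qed.

(** [x + c sqrt 2 = (1 + sqrt 2) (3 + 2 sqrt 2)^i]: divide a solution by the
    unit [3 + 2 sqrt 2] until [c = 1]. *)
Lemma neg_pell2 x c : x * x + 1 = 2 * (c * c) ->
  exists i, x = pell_t 2 3 2 i + 2 * pell_u 2 3 2 i /\ c = pell_t 2 3 2 i + pell_u 2 3 2 i.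
Proof.
have [m] := ubnP c; elim: m x c => // m IH x c cm e.
have [c1|c1] := leqP c 1.
  have cE : c = 1 by case: c c1 e {cm} => [|[|c]] //; rewrite muln0 addn1.
  exists 0; have xE : x = 1 by move: e; rewrite cE; nia.
  by rewrite xE cE.
have c3 : 3 <= c.
  by rewrite leqNgt; apply/negP => c2; have c2E : c = 2 by [lia]; move: e; rewrite c2E; clear; have [x2|x3] := leqP x 2; nia.
have cx : c < x by nia.
have xc : 4 * c <= 3 * x by nia.
have xc2 : 2 * x < 3 * c by nia.
have [||i [e1 e2]] := IH (3 * x - 4 * c) (3 * c - 2 * x).
- lia.
- have [u hu] : exists u, 3 * x = u + 4 * c by exists (3 * x - 4 * c); lia.
  have [v hv] : exists v, 3 * c = v + 2 * x by exists (3 * c - 2 * x); lia.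
  have -> : 3 * x - 4 * c = u by lia.
  have -> : 3 * c - 2 * x = v by lia.
  have xE : x = 3 * u + 4 * v by lia.
  have cE : c = 2 * u + 3 * v by lia.
  by move: e; rewrite xE cE; lia.
exists i.+1; rewrite pell_tS pell_uS; split; lia.
Qed.

Lemma odd_part n : 0 < n -> exists t g, odd g /\ n = 2 ^ t * g.
Proof.
move=> n0; exists (logn 2 n), (n %/ 2 ^ logn 2 n).
have dv := pfactor_dvdnn 2 n.
split; last by rewrite mulnC divnK.
have /(pfactor_coprime (isT : prime 2)) [m cop nE] := n0.
have -> : n %/ 2 ^ logn 2 n = m by rewrite [X in X %/ _]nE mulnK ?expn_gt0.
by rewrite -coprime2n.
Qed.

(** Write [x = 2 U +- T] with [(T, U)] of index [2 j] in the powers of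
    [3 + 2 sqrt 2], and [j = 2^t g] with [g] odd, if [j > 0].  The Pell number
    of index [n = 2^(t+1)] divides [T], and modulo it
    [y^2 = 3 x^2 + 1 = 12 U^2 + 1 = - 5], as [2 U^2 = -1].  But it is 1 modulo 4
    and 2 modulo 5, so that [- 5] is not a square modulo it. *)
Theorem pell3_x_plus_one x y c : y * y = 3 * (x * x) + 1 -> x * x + 1 = 2 * (c * c) -> x = 1.
Proof.
move=> ey /neg_pell2[i [xE _]].
have nrm : 3 * 3 = 2 * (2 * 2) + 1 by [].
have [j [xj jE]] : exists j, (x = pell_t 2 3 2 (2 * j) + 2 * pell_u 2 3 2 (2 * j) \/
    x + pell_t 2 3 2 (2 * j) = 2 * pell_u 2 3 2 (2 * j)) /\ (j = 0 -> i = 0).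
  have [k [ik|ik]] : exists k, i = 2 * k \/ i.+1 = 2 * k by exists (i.+1)./2; lia.
    by exists k; split; [left; rewrite -ik | lia].
  exists k; split; last by lia.
  by right; rewrite -ik pell_tS pell_uS; lia.
have [j0|j0] := posnP j; first by rewrite xE (jE j0).
exfalso; have [t [g [og jg]]] := odd_part j0.
pose n := 2 * 2 ^ t; have dv : pell_t 2 3 2 n %| pell_t 2 3 2 (2 * j).
  by rewrite jg mulnA; apply: pell_dvd_odd.
have y5 : pell_t 2 3 2 n %| y * y + 5.
  have := pell_norm nrm (2 * j); move: (pell_t 2 3 2 (2 * j)) (pell_u _ _ _ _) dv xj => T U dv xj e.
  apply: dvdn_trans dv _.
  case: xj => xj.
    apply/dvdnP; exists (9 * T + 12 * U); rewrite ey xj; nia.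
  rewrite -(dvdn_addl _ (dvdn_mull (12 * U) (dvdnn T))).
  have -> : y * y + 5 + 12 * U * T = 9 * T * T by rewrite ey; nia.
  exact: dvdn_mull.
have nE : n = 2 * 2 ^ t by [].
have T4 : pell_t 2 3 2 n %% 4 = 1 by apply: pell_even_mod4.
have T5 : pell_t 2 3 2 n %% 5 = 2.
  rewrite /n; elim: (t) => [|u IH] //.
  by rewrite expnS (pell_double_mod _ nrm) // IH.
have := @jacobi_eq1 (pell_t 2 3 2 n) [:: 5] (-1)%R y%:Z T4 (or_intror erefl) isT isT.
rewrite /= !big_cons !big_nil andbT /dvdn T5 => /(_ isT).
rewrite legendre_natE // /legendre_val T5 legendre_m1E //=.
by move=> /(_ y5).
Qed.

(** * Index 1 *)

Lemma coprime_mul_sqr a b c : coprime a b -> a * b = c * c -> exists u, a = u * u.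
Proof.
move=> cab e; have [g0|g_gt0] := posnP (gcdn a c).
  by exists 0; apply/eqP; rewrite -leqn0 leqNgt; apply/negP => a0; move: g0; have := gcdn_gt0 a c; rewrite a0 => + E; rewrite E.
exists (gcdn a c).
have [a' aE] : exists a', a = a' * gcdn a c by exists (a %/ gcdn a c); rewrite divnK ?dvdn_gcdl.
have [c' cE] : exists c', c = c' * gcdn a c by exists (c %/ gcdn a c); rewrite divnK ?dvdn_gcdr.
have cop : coprime a' c'.
  have : gcdn (a' * gcdn a c) (c' * gcdn a c) = 1 * gcdn a c by rewrite -aE -cE mul1n.
  by rewrite -muln_gcdl => /eqP; rewrite eqn_pmul2r.
move: (gcdn a c) g_gt0 aE cE => g g0 aE cE.
have e2 : a' * b = g * (c' * c').
  apply/eqP; rewrite -(eqn_pmul2l g0); apply/eqP.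
  by transitivity (a * b); [rewrite aE; ring | rewrite e cE; ring].
have d1 : a' %| g.
  have : a' %| g * (c' * c') by rewrite -e2 dvdn_mulr.
  by rewrite Gauss_dvdl // coprimeMr cop.
have d2 : g %| a'.
  have : g %| a' * b by rewrite e2 dvdn_mulr.
  rewrite Gauss_dvdl //; apply: coprime_dvdl cab.
  by rewrite aE dvdn_mull.
have ag : a' = g by apply/eqP; rewrite eqn_dvd d1 d2.
by rewrite aE ag.
Qed.

Lemma coprime_sqr a b c : coprime a b -> a * b = c * c ->
  exists u v, [/\ a = u * u, b = v * v, coprime u v & c = u * v].
Proof.
move=> cab e; have [u uE] := coprime_mul_sqr cab e.
have [v vE] : exists v, b = v * v.
  by apply: (@coprime_mul_sqr _ a c); rewrite ?(coprime_sym b) // mulnC.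
exists u, v; split=> //.
  by move: cab; rewrite uE vE coprimeMl !coprimeMr => /andP[/andP[]].
have : (u * v) * (u * v) = c * c by rewrite -e uE vE; ring.
by move=> h; apply/eqP; rewrite -eqn_sqr -!mulnn h.
Qed.

Lemma coprime_addsub a b : coprime a b -> odd (a + b) -> b <= a -> coprime (a - b) (a + b).
Proof.
move=> cab oab ba.
have : coprime (a - b) (a + b) = coprime (a - b) (2 * b).
  have -> : a + b = (a - b) + 2 * b by lia.
  by rewrite /coprime gcdnDl.
move=> ->; rewrite coprimeMr.
have -> : coprime (a - b) 2 by rewrite coprime_sym coprime2n; lia.
by rewrite /=; move: cab; rewrite coprime_sym -{1}(subnKC ba) /coprime gcdnDl gcdnC.
Qed.

Lemma pythagoras r s c : coprime r s -> odd r -> ~~ odd s -> r * r + s * s = c * c ->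
  exists p q, [/\ q <= p, coprime p q, odd (p + q), r + q * q = p * p &
    s = 2 * (p * q) /\ c = p * p + q * q].
Proof.
move=> crs ro se e.
have co : odd c by have := congr1 odd e; rewrite oddD !oddM; lia.
have rc : r <= c by nia.
pose A := (c - r)./2; pose B := (c + r)./2.
have cE : c = A + B by rewrite /A /B; lia.
have rE : B = A + r by rewrite /A /B; lia.
have sE : s = 2 * s./2 by lia.
have AB : A * B = s./2 * s./2.
  have : 4 * (A * B) + r * r = c * c by rewrite cE rE; ring.
  by rewrite -e {1}sE; lia.
have cop : coprime A B.
  have crc : coprime r c.
    rewrite -(coprime_pexpr _ _ (ltn0Sn 1)) -mulnn -e /coprime gcdnMDl.
    by rewrite -/(coprime _ _) coprimeMr crs.
  have : coprime r (A + B) by rewrite -cE.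
  have -> : r = B - A by lia.
  move=> h.
  have d : gcdn A B %| gcdn (B - A) (A + B).
    by rewrite dvdn_gcd dvdn_sub ?dvdn_gcdl ?dvdn_gcdr // dvdn_add ?dvdn_gcdl ?dvdn_gcdr.
  by move: d; rewrite (eqP h) dvdn1.
have [q [p [qE pE cqp hE]]] := coprime_sqr cop AB.
exists p, q; split.
- have : q * q <= p * p by rewrite -qE -pE rE leq_addr.
  by rewrite !mulnn leq_sqr.
- by rewrite coprime_sym.
- have := congr1 odd cE; rewrite pE qE oddD !oddM; lia.
- by rewrite -qE -pE rE; lia.
- by split; [rewrite {1}sE hE; lia | rewrite cE pE qE addnC].
Qed.

(** Fermat's descent: 1 is not a congruent number.  Let [r], [s] be half the sum and half the difference of
    [c] and [b]: they are the legs of a primitive right triangle with hypotenuse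
    [u] and [2 r s = v^2].  For its generators [p], [q] the coprime numbers [p],
    [q], [p - q], [p + q] have a square as their product.  All four are squares
    then, and the square roots of [p] and [q] are a smaller solution. *)
Lemma no_congruent_square u v b c : coprime u v ->
  u * u + v * v = c * c -> u * u = v * v + b * b -> v = 0.
Proof.
have [n] := ubnP u; elim: n u v b c => // n IH u v b c un cuv e1 e2.
have [//|v0] := posnP v; exfalso.
have mod4 m : (m * m) %% 4 = odd m.
  rewrite -modnMm; have : m %% 4 < 4 by rewrite ltn_mod.
  have -> : odd m = odd (m %% 4) by lia.
  by case: (m %% 4) => [|[|[|[|k]]]].
have ve : ~~ odd v.
  apply/negP => ov; have := mod4 u; have := mod4 v; have := mod4 b; have := mod4 c.
  by rewrite ov /=; move: e1 e2; case: (odd u) (odd c) (odd b) => [] [] [] /=; lia.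
have uo : odd u.
  apply: contraTT cuv => eu; rewrite /coprime.
  have : 2 %| gcdn u v by rewrite dvdn_gcd !dvdn2 eu ve.
  by case: gcdn => [|[|k]].
have co : odd c by have := congr1 odd e1; rewrite oddD !oddM; lia.
have bo : odd b by have := congr1 odd e2; rewrite oddD !oddM; lia.
have bc : b <= c by nia.
pose r := (c + b)./2; pose s := (c - b)./2.
have cE : c = r + s by rewrite /r /s; lia.
have rE : r = s + b by rewrite /r /s; lia.
have h1 : r * r + s * s = u * u.
  have : 2 * (r * r + s * s) = c * c + b * b by rewrite cE rE; ring.
  lia.
have h2 : 2 * (r * s) = v * v.
  have : 4 * (r * s) + b * b = c * c by rewrite cE rE; ring.
  lia.
have crs : coprime r s.
  have d : gcdn r s * gcdn r s %| gcdn (u * u) (v * v).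
    rewrite dvdn_gcd; apply/andP; split.
      by rewrite -h1; apply: dvdn_add; apply: dvdn_mul; rewrite ?dvdn_gcdl ?dvdn_gcdr.
    by rewrite -h2; apply: dvdn_mull; apply: dvdn_mul; rewrite ?dvdn_gcdl ?dvdn_gcdr.
  move: d; have -> : gcdn (u * u) (v * v) = 1.
    by apply/eqP; rewrite -/(coprime _ _) coprimeMl !coprimeMr cuv.
  by rewrite dvdn1 muln_eq1 => /andP[].
have main r' s' : coprime r' s' -> odd r' -> ~~ odd s' -> r' * r' + s' * s' = u * u ->
    2 * (r' * s') = v * v -> False.
  move=> c' o' e' h1' h2'.
  have [p [q [qp cpq opq eq1 [eq2 eq3]]]] := pythagoras c' o' e' h1'.
  have vE : v = 2 * v./2 by lia.
  have r'E : r' = (p - q) * (p + q) by rewrite mulnBl !mulnDr; lia.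
  have q0 : 0 < q.
    rewrite lt0n; apply: contraTneq v0 => q0.
    have : v * v = 0 by rewrite -h2' eq2 q0 !muln0.
    by move/eqP; rewrite muln_eq0 orbb => /eqP ->.
  have h3 : (p * q) * ((p - q) * (p + q)) = v./2 * v./2.
    rewrite -r'E; have : 4 * (p * q * r') = 4 * (v./2 * v./2).
      transitivity (v * v); first by rewrite -h2' eq2; ring.
      by rewrite [in LHS]vE; ring.
    by move/eqP; rewrite eqn_pmul2l // => /eqP.
  have cop1 : coprime (p * q) ((p - q) * (p + q)).
    by move: c'; rewrite -r'E eq2 coprimeMr coprime_sym => /andP[_]; rewrite coprime_sym.
  have [x [y [xE yE cxy _]]] := coprime_sqr cop1 h3.
  have [a [b' [aE bE cab _]]] := coprime_sqr cpq xE.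
  have [d' [c'' [dE cE' _ _]]] := coprime_sqr (coprime_addsub cpq opq qp) yE.
  have b0 : b' = 0.
    apply: (IH a b' d' c'' _ cab).
    - have ap : a <= p by rewrite aE; case: (a) => // k; rewrite leq_pmulr.
      have pu : p < u.
        rewrite eq3 -addn1 leq_add ?muln_gt0 ?q0 //; case: (p) => // k; rewrite leq_pmulr //.
      by apply: leq_ltn_trans ap _; apply: leq_trans pu _.
    - by rewrite -aE -bE -cE'.
    - by rewrite -aE -bE -dE subnKC.
  by move: q0; rewrite bE b0.
have [ro|re] := boolP (odd r).
  have se : ~~ odd s by lia.
  exact: main crs ro se h1 h2.
have so : odd s by lia.
by apply: (main s r); rewrite 1?coprime_sym // 1?addnC // (mulnC s).
Qed.

(** With [b^2 = 2 w + 1] the equation becomes [(w + 1)^2 + w^2 = c^2], and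
    [(w + 1)^2 - w^2] is the square [b^2]. *)
Lemma fourth_plus_one b c : (b * b) * (b * b) + 1 = 2 * (c * c) -> b = 1.
Proof.
move=> e.
have ob : odd b by have := congr1 odd e; rewrite oddD !oddM; lia.
have [w wE] : exists w, b * b = 2 * w + 1.
  by exists (b * b)./2; have : odd (b * b) by [rewrite oddM ob]; lia.
have cE : (w + 1) * (w + 1) + w * w = c * c by move: e; rewrite wE; lia.
have w0 : w = 0.
  by apply: (@no_congruent_square (w + 1) w b c) => //; [rewrite addn1 coprimeSn | rewrite wE; ring].
by move: wE; rewrite w0 => /eqP; rewrite muln_eq1 => /andP[/eqP].
Qed.

(** For [y = 2 m + 1], the coprime numbers [m], [m + 1] have the product
    [3 v^2] with [x = 2 v]; so [m = 3 t^2] and [m + 1 = s^2], the other splitting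
    being impossible modulo 3.  They are also the legs of a right triangle with
    hypotenuse [w].  In terms of its generators [p], [q], the equation
    [(m + 1) - m = 1] gives [b^4 + 1 = 2 p^2] with [p + q = b^2] if [m] is even,
    and [c^4 + 1 = 2 q^2] with [p - q = c^2] if [m] is odd. *)
Lemma pell3_y_plus_one x y w : y * y = 3 * (x * x) + 1 -> y * y + 1 = 2 * (w * w) -> x = 0 \/ x = 4.
Proof.
move=> e1 e2.
have yo : odd y by have := congr1 odd e2; rewrite oddD !oddM; lia.
have [m mE] : exists m, y = 2 * m + 1 by exists y./2; lia.
have xe : x = 2 * x./2 by have := congr1 odd e1; rewrite oddD !oddM /=; lia.
pose v := x./2.
have e3 : m * (m + 1) = 3 * (v * v) by move: e1; rewrite mE xe -/v; lia.
(* A square is 0 or 1 modulo 3 *)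
have sq3 a : (a * a) %% 3 = (a %% 3 != 0).
  rewrite -modnMm; have : a %% 3 < 3 by rewrite ltn_mod.
  by case: (a %% 3) => [|[|[|]]].
have cop : coprime m (m + 1) by rewrite addn1 coprimenS.
have [t [s [tE sE]]] : exists t s, m = 3 * (t * t) /\ m + 1 = s * s.
  have : 3 %| m * (m + 1) by rewrite e3 dvdn_mulr.
  rewrite Euclid_dvdM // => /orP[/dvdnP[n nE]|/dvdnP[n nE]].
    have [t [s [tE sE _ _]]] : exists u w, [/\ n = u * u, m + 1 = w * w, coprime u w & v = u * w].
      apply: coprime_sqr; last by move: e3; rewrite [X in X * _]nE; lia.
      by apply: coprime_dvdl cop; rewrite nE dvdn_mulr.
    by exists t, s; split=> //; rewrite nE tE mulnC.
  have [t [s [tE sE _ _]]] : exists u w, [/\ n = u * u, m = w * w, coprime u w & v = u * w].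
    apply: coprime_sqr; last by move: e3; rewrite nE; lia.
    by rewrite coprime_sym; apply: coprime_dvdr cop; rewrite nE dvdn_mulr.
  by exfalso; have := sq3 s; rewrite -sE; case: (_ != _); lia.
have xE : x * x = 4 * ((t * t) * (s * s)).
  rewrite xe -/v -sE; have : 3 * (v * v) = 3 * (t * t * (m + 1)) by rewrite -e3 {1}tE; ring.
  lia.
suff [t0|[t1 s2]] : t = 0 \/ t = 1 /\ s = 2.
- by left; apply/eqP; rewrite -[x == 0]orbb -muln_eq0 xE t0.
- by right; apply/eqP; rewrite -eqn_sqr -!mulnn xE t1 s2.
have wE : m * m + (m + 1) * (m + 1) = w * w by move: e2; rewrite mE; lia.
have [om|em] := boolP (odd m).
  have em : ~~ odd (m + 1) by rewrite addn1 /= om.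
  have [p [q [qp cpq opq eq1 [eq2 eq3]]]] := pythagoras cop om em wE.
  have pq : p * p = q * q + 2 * (p - q) * q + (p - q) * (p - q) by rewrite -{1 2}(subnKC qp); ring.
  have qE : (p - q) * (p - q) + 1 = 2 * (q * q).
    by move: eq1 eq2 pq; rewrite -{2}(subnKC qp); lia.
  have mE2 : m = (p - q) * (p + q) by rewrite mulnBl !mulnDr; lia.
  have copq := coprime_addsub cpq opq qp.
  have : 3 %| (p - q) * (p + q) by rewrite -mE2 tE dvdn_mulr.
  rewrite Euclid_dvdM // => /orP[/dvdnP[n nE]|/dvdnP[n nE]].
    by exfalso; have := sq3 q; move: qE; rewrite nE; case: (_ != _); lia.
  have [c [d [cE _ _ _]]] : exists c d, [/\ p - q = c * c, n = d * d, coprime c d & t = c * d].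
    apply: coprime_sqr; last by move: mE2; rewrite tE nE; lia.
    by apply: coprime_dvdr copq; rewrite nE dvdn_mulr.
  have c1 : c = 1 by apply: (@fourth_plus_one c q); rewrite -cE.
  have q1 : q = 1.
    have /eqP : q * q = 1 by clear -qE cE c1; move: qE; rewrite cE c1; lia.
    by rewrite muln_eq1 => /andP[/eqP].
  have p2 : p = 2 by move: cE; rewrite c1; lia.
  right; clear -mE2 p2 q1 sE tE; have mE3 : m = 3 by rewrite mE2 p2 q1.
  split; apply/eqP; rewrite -eqn_sqr -!mulnn; apply/eqP; lia.
have em1 : odd (m + 1) by rewrite addn1 /= em.
have cop1 : coprime (m + 1) m by rewrite coprime_sym.
have wE1 : (m + 1) * (m + 1) + m * m = w * w by rewrite addnC.
have [p [q [qp cpq opq eq1 [eq2 eq3]]]] := pythagoras cop1 em1 em wE1.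
have mE2 : (p - q) * (p + q) = s * s by rewrite mulnBl !mulnDr -sE; lia.
have [a [b [_ bE _ _]]] := coprime_sqr (coprime_addsub cpq opq qp) mE2.
have b1 : b = 1 by apply: (@fourth_plus_one b p); rewrite -bE; lia.
left; have q0 : q = 0 by move: bE; rewrite b1; lia.
by move/eqP: tE; rewrite eq2 q0 !muln0 eq_sym !muln_eq0 orbb => /eqP.
Qed.

(** * Index 2 *)

Local Notation T22 := (pell_t 22 197 42).
Local Notation U22 := (pell_u 22 197 42).

Lemma norm22 : 197 * 197 = 22 * (42 * 42) + 1.
Proof. by lia. Qed.

(** A necessary condition, modulo [q], for [4 c^2 - 1] to be of the form
    [3 x^2]. *)
Definition admissible (q : nat) (c : Z) : bool := is_square_mod q (3 * (4 * (c * c) - 1))%ZZ.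

Lemma admissibleP q c d x : 0 < q -> 3 * (x * x) + 1 = 4 * (c * c) ->
  (Z.of_nat c mod Z.of_nat q = d mod Z.of_nat q)%ZZ -> admissible q d.
Proof.
move=> q0 e cd; have q1 : (Z.of_nat q <> 0)%ZZ by lia.
have := is_square_modP (3 * Z.of_nat x)%ZZ q0.
have -> : (3 * Z.of_nat x * (3 * Z.of_nat x) = 3 * (4 * (Z.of_nat c * Z.of_nat c) - 1))%ZZ by lia.
rewrite /admissible /is_square_mod; have -> // :
  ((3 * (4 * (d * d) - 1)) mod Z.of_nat q = (3 * (4 * (Z.of_nat c * Z.of_nat c) - 1)) mod Z.of_nat q)%ZZ.
rewrite Z.mul_mod // Zminus_mod (Z.mul_mod 4) // (Z.mul_mod d) // -cd.
by rewrite -(Z.mul_mod (Z.of_nat c)) // -(Z.mul_mod 4) // -Zminus_mod -Z.mul_mod.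
Qed.

Lemma small_c c w : c < 73 -> w * w = 22 * (c * c) + 3 -> c = 1 \/ c = 13.
Proof.
pose chk c := (c == 1) || (c == 13) ||
  has (fun q => ~~ is_square_mod q (22 * (Z.of_nat c * Z.of_nat c) + 3)%ZZ) (iota 3 100).
have : all chk (iota 0 73) by vm_compute.
move=> /allP h c73 e; have := h c; rewrite mem_iota => /(_ c73) /orP[/orP[]/eqP-> | /hasP[q]]; [by left|by right|].
rewrite mem_iota => /andP[q3 _] /negP[].
have := @is_square_modP q (Z.of_nat w) (leq_trans _ q3); rewrite -Nat2Z.inj_mul.
have -> : (Z.of_nat (w * w)%coq_nat = 22 * (Z.of_nat c * Z.of_nat c) + 3)%ZZ by lia.
by apply.
Qed.

(** [w + c sqrt 22 = (5 +- sqrt 22) (197 + 42 sqrt 22)^i]: divide a solution by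
    the unit as long as [c >= 73]. *)
Lemma norm3_solutions w c : w * w = 22 * (c * c) + 3 ->
  exists i, (w = 5 * T22 i + 22 * U22 i /\ c = T22 i + 5 * U22 i) \/
    [/\ 0 < i, w + 22 * U22 i = 5 * T22 i & c + T22 i = 5 * U22 i].
Proof.
have [m] := ubnP c; elim: m w c => // m IH w c cm e.
have [c73|c73] := ltnP c 73.
  have [c1|c13] := small_c c73 e.
    exists 0; left; rewrite c1 in e *; split; last by [].
    suff -> : w = 5 by [].
    by nia.
  exists 1; right; rewrite c13 in e *; have -> : w = 61 by nia.
  by rewrite pell_tS pell_uS.
have [v hv] : exists v, 197 * w = v + 924 * c by exists (197 * w - 924 * c); nia.
have [u hu] : exists u, 197 * c = u + 42 * w by exists (197 * c - 42 * w); nia.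
have wE : w = 197 * v + 924 * u by lia.
have cE : c = 42 * v + 197 * u by lia.
have euv : v * v = 22 * (u * u) + 3 by move: e; rewrite wE cE; lia.
have v0 : 0 < v by nia.
have [|i [[e1 e2]|[i0 e1 e2]]] := IH v u _ euv; first by lia.
  by exists i.+1; left; rewrite pell_tS pell_uS; split; lia.
by exists i.+1; right; rewrite pell_tS pell_uS; split=> //; lia.
Qed.

Definition survives (a b : Z) (q r : nat) : bool :=
  let tu := zpell 22 197 42 q r in admissible q (a * tu.1 + b * tu.2)%ZZ.

Definition period (q m : nat) : bool :=
  let tu := zpell 22 197 42 q m in
  [&& Z.eqb tu.1 (1 mod Z.of_nat q)%ZZ, Z.eqb tu.2 0 & 0 < q].

Lemma periodP q m n : period q m -> zpell 22 197 42 q n = zpell 22 197 42 q (n %% m).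
Proof.
case/and3P=> /Z.eqb_eq e1 /Z.eqb_eq e2 q0.
rewrite {1}(divn_eq n m) addnC zpell_period //.
by rewrite [zpell _ _ _ _ m]surjective_pairing e1 e2.
Qed.

Lemma survives_real a b q m i c x : period q m -> 3 * (x * x) + 1 = 4 * (c * c) ->
  (Z.of_nat c = a * Z.of_nat (T22 i) + b * Z.of_nat (U22 i))%ZZ ->
  survives a b q (i %% m).
Proof.
move=> per e hc; rewrite /survives -(periodP i per).
have /and3P[_ _ q0] := per; have q1 : (Z.of_nat q <> 0)%ZZ by lia.
apply: (admissibleP q0 e); rewrite zpellE //; cbn [fst snd]; rewrite hc.
move: (Z.of_nat (T22 i)) (Z.of_nat (U22 i)) => t u.
rewrite [RHS]Z.add_mod // [(a * (t mod _) mod _)%ZZ]Z.mul_mod // Z.mod_mod // -Z.mul_mod //.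
by rewrite (Z.mul_mod b (u mod _)) // Z.mod_mod // -(Z.mul_mod b) // -Z.add_mod.
Qed.

(** Each prime comes with a period of the Pell sequence modulo it. *)
Definition sieve_primes := [:: (13, 12); (19, 5); (23, 24); (61, 60); (71, 24);
  (109, 36); (127, 9); (233, 18); (577, 48); (719, 720)].

(** Stops at the first prime that excludes [r]; under call-by-value
    evaluation [has] would try them all. *)
Fixpoint excluded (sign : Z) (qs : seq (nat * nat)) (r : nat) : bool :=
  if qs is (q, m) :: qs' then
    if survives sign 5 q (r %% m) then excluded sign qs' r else true
  else false.

Definition sieve_ok (sign : Z) (shift r : nat) : bool :=
  excluded sign sieve_primes r ||
  (if odd r then (r + shift) %% 15 == 0 else r %% 5 == 0).

Lemma excludedP sign qs r : excluded sign qs r ->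
  exists2 qm, qm \in qs & ~~ survives sign 5 qm.1 (r %% qm.2).
Proof.
elim: qs => //= -[q m] qs IH; case E: survives.
  by move=> /IH[qm qmin h]; exists qm; rewrite // in_cons qmin orbT.
by move=> _; exists (q, m); rewrite ?E // in_cons eqxx.
Qed.

Lemma sieve_check : [/\ all (fun qm => (qm.2 %| 720) && period qm.1 qm.2) sieve_primes,
      all (sieve_ok 1 1) (iota 0 720) & all (sieve_ok (-1) 14) (iota 0 720)].
Proof. by split; vm_compute. Qed.

Lemma sieve_period qm : qm \in sieve_primes -> (qm.2 %| 720) && period qm.1 qm.2.
Proof. by have [/allP h _ _] := sieve_check; apply: h. Qed.

Lemma sieve_okP (s : bool) r : r \in iota 0 720 ->
  sieve_ok (if s then -1 else 1)%ZZ (if s then 14 else 1) r.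
Proof. by have [_ /allP h1 /allP h2] := sieve_check; case: s; [apply: h2 | apply: h1]. Qed.

(** Modulo each of [sieve_primes] the sequence has a period that divides 720,
    and the residues of [i] modulo 720 that survive them all satisfy these
    congruences.  Here
    [c = T + 5 U] if [s] is false, and [c = 5 U - T] if [s] is true. *)
Lemma sieve (s : bool) i c x : 3 * (x * x) + 1 = 4 * (c * c) ->
  c + s * T22 i = ~~ s * T22 i + 5 * U22 i ->
  if odd i then (i + (if s then 14 else 1)) %% 15 == 0 else i %% 5 == 0.
Proof.
move=> e ci; have rin : i %% 720 \in iota 0 720 by rewrite mem_iota ltn_mod.
have := sieve_okP s rin; rewrite /sieve_ok.
have surv qm : qm \in sieve_primes ->
    survives (if s then -1 else 1)%ZZ 5 qm.1 ((i %% 720) %% qm.2).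
  move=> /sieve_period/andP[dv per]; rewrite modn_dvdm //.
  apply: survives_real per e _.
  by case: s ci {rin}; cbn [negb nat_of_bool]; lia.
move: sieve_primes surv => qs surv.
case/orP=> [/excludedP[qm qin /negP[]]|]; first exact: surv.
move: (if s then 14 else 1) => k; have -> : odd (i %% 720) = odd i by lia.
by case: (odd i) => /eqP h; apply/eqP; lia.
Qed.

(** An odd index is made even by moving one factor [197 + 42 sqrt 22] into the
    base: [(5 +- sqrt 22)] is then replaced by [61 +- 13 sqrt 22]. *)
Lemma even_index (x c w : nat) : 3 * (x * x) + 1 = 4 * (c * c) -> w * w = 22 * (c * c) + 3 ->
  c = 1 \/ c = 13 \/
  exists j, 0 < j /\
   ((j %% 5 = 0 /\ (c = T22 (2 * j) + 5 * U22 (2 * j) \/ c + T22 (2 * j) = 5 * U22 (2 * j))) \/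
    (j %% 15 = 0 /\ (c = 13 * T22 (2 * j) + 61 * U22 (2 * j) \/ c + 13 * T22 (2 * j) = 61 * U22 (2 * j)))).
Proof.
move=> ex /norm3_solutions[i [[_ ci]|[i0 _ ci]]].
  have := @sieve false i c x ex; rewrite mul0n mul1n addn0 => /(_ ci).
  case: ifP => oi /eqP hi.
    right; right; exists (i.+1)./2; have e : 2 * (i.+1)./2 = i.+1 by lia.
    by split; [lia|right]; split; [lia|right]; rewrite e pell_tS pell_uS ci; lia.
  have [i_0|i_gt0] := posnP i; first by left; rewrite ci i_0.
  right; right; exists i./2; have e : 2 * i./2 = i by lia.
  by split; [lia|left]; split; [lia|left]; rewrite e.
have := @sieve true i c x ex; rewrite mul0n mul1n add0n => /(_ ci).
case: i i0 ci => // i _; rewrite pell_tS pell_uS => ci.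
case: ifP => oi /eqP hi.
  have ci' : c = 13 * T22 i + 61 * U22 i by lia.
  have [i_0|i_gt0] := posnP i; first by right; left; rewrite ci' i_0.
  right; right; exists i./2; have e : 2 * i./2 = i by lia.
  by split; [lia|right]; split; [lia|left]; rewrite e.
right; right; exists (i.+1)./2; have e : 2 * (i.+1)./2 = i.+1 by lia.
by split; [lia|left]; split; [lia|right]; rewrite e pell_tS pell_uS; lia.
Qed.

(** Modulo [T] one has [c = b U] and [22 U^2 = -1]; hence
    [33 x^2 = 44 c^2 - 11 = - 2 b^2 - 11]. *)
Lemma base_dvd x c a b T U n : 3 * (x * x) + 1 = 4 * (c * c) -> T * T = 22 * (U * U) + 1 ->
  c = a * T + b * U \/ c + a * T = b * U -> n %| T ->
  n %| (33 * x) * (33 * x) + 33 * (2 * (b * b) + 11).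
Proof.
move=> ex nrm hc nT; apply: dvdn_trans nT _.
have -> : (33 * x) * (33 * x) + 33 * (2 * (b * b) + 11) = 33 * (44 * (c * c) + 2 * (b * b)) by lia.
apply: dvdn_mull.
have bb : 2 * (b * b) + 44 * (b * b) * (U * U) = 2 * (b * b) * (T * T) by rewrite nrm; ring.
case: hc => hc.
  have -> : 44 * (c * c) + 2 * (b * b) =
      44 * (a * a) * (T * T) + 88 * (a * b) * (T * U) + 2 * (b * b) * (T * T).
    by rewrite -bb hc; ring.
  by apply: dvdn_add; [apply: dvdn_add|]; apply: dvdn_mull; apply: dvdn_mulr.
rewrite -(dvdn_addl _ (dvdn_mull (88 * (a * b) * U) (dvdnn T))).
have -> : 44 * (c * c) + 2 * (b * b) + 88 * (a * b) * U * T =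
    44 * (a * a) * (T * T) + 2 * (b * b) * (T * T).
  have -> : 88 * (a * b) * U * T = 88 * (a * T) * (b * U) by ring.
  rewrite -bb.
  have -> : 44 * (b * b) * (U * U) = 44 * (b * U) * (b * U) by ring.
  have -> : 44 * (a * a) * (T * T) = 44 * (a * T) * (a * T) by ring.
  by rewrite -hc; ring.
by apply: dvdn_add; apply: dvdn_mull; apply: dvdn_mulr.
Qed.

Lemma pell_t_pow q t h : 0 < q -> T22 (2 ^ t * h) %% q = iter t (double_mod q) (T22 h %% q).
Proof.
move=> q0; elim: t => [|t IH]; first by rewrite mul1n.
by rewrite expnS -mulnA (pell_double_mod _ norm22) // IH.
Qed.

Lemma zpell_mod q n : 0 < q -> T22 n %% q = Z.to_nat (zpell 22 197 42 q n).1.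
Proof.
move=> q0; rewrite zpellE //; cbn [fst].
move: (T22 n) => T; have := divn_eq T q; have := ltn_pmod T q0.
move: (T %/ q) (T %% q) => d r rq e.
rewrite -(Z.mod_unique _ _ (Z.of_nat d) (Z.of_nat r)); [|lia|].
  by rewrite Nat2Z.id.
by rewrite e; lia.
Qed.

Lemma legendre_val_mod q m : legendre_val q (m %% q) = legendre_val q m.
Proof. by rewrite /legendre_val modn_mod. Qed.

(** [jacobi_eq1] for [N = - m]. *)
Lemma jacobi_nat T qs (m a : nat) : T %% 4 = 1 ->
  all prime qs -> all odd qs -> all (fun q => T %% q != 0) qs ->
  (\prod_(q <- qs) (legendre_val q q.-1 * q%:Z) = m%:Z)%R ->
  T %| a * a + m -> (\prod_(q <- qs) legendre_val q T = 1)%R.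
Proof.
move=> T4 pq oq nz hm dv.
have := @jacobi_eq1 T qs (-1)%R a%:Z T4 (or_intror erefl) pq oq.
have -> : all (fun q : nat => ~~ (q %| T)) qs by [].
have -> : (\prod_(q <- qs) (legendre (-1 : 'F_q) * q%:Z) = m%:Z)%R.
  rewrite -hm big_seq [RHS]big_seq; apply: eq_bigr => q qin.
  by rewrite legendre_m1E // (allP pq).
have -> : absz (a%:Z ^+ 2 - -1 * m%:Z)%R = a * a + m.
  by have -> // : (a%:Z ^+ 2 - -1 * m%:Z)%R = Posz (a * a + m) by lia.
move=> /(_ isT dv) h; rewrite -[RHS]h big_seq [RHS]big_seq; apply: eq_bigr => q qin.
by rewrite legendre_natE // (allP pq).
Qed.

(** [T_n] modulo [q]. *)
Definition residue (q n : nat) : nat := Z.to_nat (zpell 22 197 42 q n).1.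

Lemma residue_pow q t h : 0 < q -> T22 (2 ^ t * h) %% q = iter t (double_mod q) (residue q h).
Proof. by move=> q0; rewrite pell_t_pow // zpell_mod. Qed.

(** The values of [T] at the indices [2^t h] modulo a fixed number are the
    iterates of [double_mod]; they are ultimately periodic in [t], so that a
    finite check covers all [t]. *)
Lemma iter_all (A : eqType) (f : A -> A) (x : A) (n : nat) (P : pred A) t :
  looping f x n -> all P (traject f x n) -> P (iter t f x).
Proof. by move=> /loopingP h /allP; apply. Qed.

(** Indices divisible by 5, base [5 + sqrt 22]: here [2 b^2 + 11 = 61]. *)
Lemma symbol61 t : legendre_val 61 (T22 (2 ^ t.+1 * 5)) = (-1)%R.
Proof.
rewrite -legendre_val_mod residue_pow // iterSr.
have := @iter_all _ (double_mod 61) (double_mod 61 (residue 61 5)) 60 (fun u => legendre_val 61 u == (-1)%R) t.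
by move=> h; apply/eqP; apply: h; vm_compute.
Qed.

Lemma symbol3_11 q t h : q = 3 \/ q = 11 -> h \in [:: 1; 3; 5] ->
  legendre_val q (T22 (2 ^ t.+1 * h)) = 1%R /\ T22 (2 ^ t.+1 * h) %% q != 0.
Proof.
move=> qE hE; have q0 : 0 < q by case: qE => ->.
rewrite -legendre_val_mod residue_pow // iterSr.
have := @iter_all _ (double_mod q) (double_mod q (residue q h)) 10 (fun u => (legendre_val q u == 1%R) && (u != 0)) t.
have [] : looping (double_mod q) (double_mod q (residue q h)) 10 /\
   all (fun u => (legendre_val q u == 1%R) && (u != 0)) (traject (double_mod q) (double_mod q (residue q h)) 10).
  move: hE; rewrite !inE; case: qE => -> /or3P[]/eqP->; by split; vm_compute.
by move=> l a /(_ l a)/andP[/eqP].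
Qed.

Definition residues_29_257 h : nat * nat := (residue 29 h, residue 257 h).
Definition double_29_257 (s : nat * nat) : nat * nat := (double_mod 29 s.1, double_mod 257 s.2).
(** For the base [61 + 13 sqrt 22] one has [2 b^2 + 11 = 7453 = 29 * 257]. *)
Definition opposite_symbols (s : nat * nat) : bool :=
  [&& s.1 != 0, s.2 != 0 & legendre_val 29 s.1 == (- legendre_val 257 s.2)%R].

Lemma residues_29_257_pow t h : (T22 (2 ^ t * h) %% 29, T22 (2 ^ t * h) %% 257) = iter t double_29_257 (residues_29_257 h).
Proof.
rewrite !residue_pow //; elim: t => //= t <-; by [].
Qed.

(** Which [h] works depends on [t] modulo 3, once [t >= 5].  The exception
    [t = 4] is left to [exclude_32]. *)
Lemma exists_opposite_symbols t : t.+1 != 5 ->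
  exists2 h, h \in [:: 1; 3; 5] & opposite_symbols (T22 (2 ^ t.+1 * h) %% 29, T22 (2 ^ t.+1 * h) %% 257).
Proof.
have cyc h t0 s : looping (iter 3 double_29_257) (iter t0 double_29_257 (residues_29_257 h)) 10 &&
    all opposite_symbols (traject (iter 3 double_29_257) (iter t0 double_29_257 (residues_29_257 h)) 10) ->
    opposite_symbols (T22 (2 ^ (s * 3 + t0) * h) %% 29, T22 (2 ^ (s * 3 + t0) * h) %% 257).
  move=> /andP[l a]; rewrite residues_29_257_pow iterD iterM.
  exact: iter_all l a.
have small h u : h \in [:: 1; 3; 5] -> opposite_symbols (iter u double_29_257 (residues_29_257 h)) ->
    exists2 h, h \in [:: 1; 3; 5] &
      opposite_symbols (T22 (2 ^ u * h) %% 29, T22 (2 ^ u * h) %% 257).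
  by move=> hin opp; exists h; [exact: hin | rewrite residues_29_257_pow].
move=> t5; have [tS|tL] := ltnP t.+1 6.
  have : (t.+1 == 1) || (t.+1 == 2) || (t.+1 == 3) || (t.+1 == 4) by lia.
  case/orP=> [/orP[/orP[]|]|] /eqP->;
    [apply: (small 1)|apply: (small 1)|apply: (small 5)|apply: (small 5)]; by vm_compute.
have [s [e|e|e]] : exists s, [\/ t.+1 = s * 3 + 6, t.+1 = s * 3 + 7 | t.+1 = s * 3 + 8].
  exists ((t.+1 - 6) %/ 3).
  have : ((t.+1 - 6) %% 3 = 0) \/ ((t.+1 - 6) %% 3 = 1) \/ ((t.+1 - 6) %% 3 = 2) by lia.
  by case=> [h|[h|h]]; [apply: Or31|apply: Or32|apply: Or33]; lia.
- exists 3; [by vm_compute | rewrite e; apply: cyc; by vm_compute].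
- exists 5; [by vm_compute | rewrite e; apply: cyc; by vm_compute].
- exists 1; [by vm_compute | rewrite e; apply: cyc; by vm_compute].
Qed.

Lemma pell22_mod4 n : T22 (2 * n) %% 4 = 1.
Proof. exact: pell_even_mod4 norm22 isT. Qed.

Lemma period_383 : period 383 128.
Proof. by vm_compute. Qed.

Lemma survives_383 sg r : sg = 13%ZZ \/ sg = (-13)%ZZ -> r = 32 \/ r = 96 ->
  survives sg 61 383 r = false.
Proof. by case=> -> [] ->; vm_compute. Qed.

(** Indices that are 32 or 96 modulo 128 are excluded by the single prime 383,
    modulo which the sequence has period 128. *)
Lemma exclude_32 x c i : 3 * (x * x) + 1 = 4 * (c * c) -> i %% 64 = 32 ->
  c = 13 * T22 i + 61 * U22 i \/ c + 13 * T22 i = 61 * U22 i -> False.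
Proof.
move=> e i32 ci.
have r : i %% 128 = 32 \/ i %% 128 = 96 by clear - i32; lia.
have [sg [sgE hc]] : exists sg, (sg = 13%ZZ \/ sg = (-13)%ZZ) /\
    (Z.of_nat c = sg * Z.of_nat (T22 i) + 61 * Z.of_nat (U22 i))%ZZ.
  by case: ci => ci; [exists 13%ZZ|exists (-13)%ZZ]; split; [by left|lia|by right|lia].
by have := survives_real period_383 e hc; rewrite survives_383.
Qed.

(** After [even_index], let the index be [2 j] with [j = 2^t g], [g] odd.  For a
    suitable divisor [h] of [g] the Pell number of index [2^(t+1) h] divides the
    one of index [2 j], so that by [base_dvd] the number [- 33 (2 b^2 + 11)] is
    a square modulo it; the Jacobi symbol says the contrary. *)
Theorem pell3_norm22 x c w : 3 * (x * x) + 1 = 4 * (c * c) -> w * w = 22 * (c * c) + 3 ->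
  c = 1 \/ c = 13.
Proof.
move=> ex ew; have [?|[?|[j [j0 hj]]]] := even_index ex ew; [by left|by right|exfalso].
have [t [g [og jg]]] := odd_part j0.
have nrm n : T22 n * T22 n = 22 * (U22 n * U22 n) + 1 by apply: pell_norm norm22 n.
have dvn h g' : g = h * g' -> T22 (2 ^ t.+1 * h) %| T22 (2 * j).
  move=> gE; have -> : 2 * j = 2 ^ t.+1 * h * g' by rewrite jg gE expnS; ring.
  by apply: (pell_dvd_odd norm22); move: og; rewrite gE oddM => /andP[].
have mod4 h : T22 (2 ^ t.+1 * h) %% 4 = 1 by rewrite expnS -mulnA; exact: pell22_mod4.
case: hj => -[jm hc].
  have [g' gE] : exists g', g = 5 * g'.
    have : 5 %| 2 ^ t * g by rewrite -jg; apply/eqP.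
    by rewrite Gauss_dvdr ?coprimeXr // => /dvdnP[g' ->]; exists g'; rewrite mulnC.
  have [l3 n3] := @symbol3_11 3 t 5 (or_introl erefl) isT.
  have [l11 n11] := @symbol3_11 11 t 5 (or_intror erefl) isT.
  have l61 := symbol61 t.
  have := @base_dvd x c 1 5 _ _ (T22 (2 ^ t.+1 * 5)) ex (nrm (2 * j)).
  rewrite !mul1n => /(_ hc (dvn 5 g' gE)) dv.
  have n61 : T22 (2 ^ t.+1 * 5) %% 61 != 0.
    by apply: contraPneq l61 => h; rewrite /legendre_val h.
  have := fun m => @jacobi_nat _ [:: 3; 11; 61] m (33 * x) (mod4 5) isT isT.
  move: dv l3 n3 l11 n11 l61 n61; move: (T22 _) => T dv l3 n3 l11 n11 l61 n61 jac.
  have := jac (33 * (2 * (5 * 5) + 11)).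
  rewrite !big_cons !big_nil l3 l11 l61 [all _ _]/= n3 n11 n61 => /(_ isT) H.
  have v3 : legendre_val 3 3.-1 = (-1)%R by vm_compute.
  have v11 : legendre_val 11 11.-1 = (-1)%R by vm_compute.
  have v61 : legendre_val 61 61.-1 = 1%R by vm_compute.
  move: H; rewrite v3 v11 v61 => H; have {}H := fun e => H e dv.
  by lapply H; clear; lia.
have [g' gE] : exists g', g = 15 * g'.
  have : 15 %| 2 ^ t * g by rewrite -jg; apply/eqP.
  by rewrite Gauss_dvdr ?coprimeXr // => /dvdnP[g' ->]; exists g'; rewrite mulnC.
have [t5|t5] := eqVneq t.+1 5.
  apply: (exclude_32 (i := 2 * j) ex _ hc).
  have -> : 2 * j = 32 * g by rewrite jg mulnA -expnS t5.
  by lia.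
have [h hin good] := exists_opposite_symbols t5.
have [g2 gE2] : exists g2, g = h * g2.
  by move: hin; rewrite !inE => /or3P[]/eqP->; [exists (15 * g')|exists (5 * g')|exists (3 * g')]; rewrite gE; ring.
have [l3 n3] := @symbol3_11 3 t h (or_introl erefl) hin.
have [l11 n11] := @symbol3_11 11 t h (or_intror erefl) hin.
have dv := @base_dvd x c 13 61 _ _ (T22 (2 ^ t.+1 * h)) ex (nrm (2 * j)) hc (dvn h g2 gE2).
have := fun m => @jacobi_nat _ [:: 3; 11; 29; 257] m (33 * x) (mod4 h) isT isT.
move: dv l3 n3 l11 n11 good; move: (T22 _) => T dv l3 n3 l11 n11.
case/and3P; cbn [fst snd]; rewrite !legendre_val_mod => n29 n257 /eqP l2 jac.
have := jac (33 * (2 * (61 * 61) + 11)).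
rewrite !big_cons !big_nil l3 l11 l2 [all _ _]/= n3 n11 n29 n257 => /(_ isT) H.
have v3 : legendre_val 3 3.-1 = (-1)%R by vm_compute.
have v11 : legendre_val 11 11.-1 = (-1)%R by vm_compute.
have v29 : legendre_val 29 29.-1 = 1%R by vm_compute.
have v257 : legendre_val 257 257.-1 = 1%R by vm_compute.
move: H; rewrite v3 v11 v29 v257 => H; have {}H := fun e => H e dv.
have : legendre_val 257 T = 1%R \/ legendre_val 257 T = (-1)%R.
  by rewrite /legendre_val (negPf n257); case: ifP; [left|right].
move: H; move: (legendre_val 257 T) => l H lE.
lapply H; last by clear; lia.
by case: lE => ->; clear; lia.
Qed.

(** * Consecutive indices *)

Lemma pell_xS n : pell_x n.+1 = 2 * pell_x n + pell_y n.
Proof. by rewrite /pell_x pell_uS mul1n addnC. Qed.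

Lemma pell_yS n : pell_y n.+1 = 2 * pell_y n + 3 * pell_x n.
Proof. by rewrite /pell_y pell_tS muln1. Qed.

Lemma pell3 n : pell_y n * pell_y n = 3 * (pell_x n * pell_x n) + 1.
Proof. exact: pell_norm. Qed.

Lemma pell_y_gt n : pell_x n < pell_y n.
Proof. by rewrite -ltn_sqr -!mulnn pell3; lia. Qed.

Lemma pell_x_step n : 3 * pell_x n < pell_x n.+1.
Proof. by rewrite pell_xS; have := pell_y_gt n; lia. Qed.

Lemma pell_x_ltn k l : k < l -> 3 * pell_x k < pell_x l.
Proof.
elim: l => // l IH; rewrite ltnS leq_eqVlt => /orP[/eqP->|/IH h]; first exact: pell_x_step.
by have := pell_x_step l; lia.
Qed.

Lemma pell_x_inj : injective pell_x.
Proof.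
move=> k l e; have [h|h|//] := ltngtP k l; have := pell_x_ltn h; lia.
Qed.

(** Divide a solution by [2 + sqrt 3] until [x = 0]. *)
Lemma pell3_complete x y : y * y = 3 * (x * x) + 1 -> exists l, x = pell_x l /\ y = pell_y l.
Proof.
have [n] := ubnP x; elim: n x y => // n IH x y xn e.
have [x0|x_gt0] := posnP x.
  exists 0; split; first by rewrite x0.
  by apply/eqP; rewrite /pell_y /pell_t /= -[y == 1]eqn_sqr -mulnn e x0.
have xy : x < y by rewrite -ltn_sqr -!mulnn e; lia.
have y2x : y <= 2 * x by rewrite -leq_sqr -!mulnn e; nia.
have x3y : 3 * x <= 2 * y by rewrite -leq_sqr -!mulnn; move: e; clear; lia.
have [l [xE yE]] : exists l, 2 * x - y = pell_x l /\ 2 * y - 3 * x = pell_y l.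
  apply: IH; first by lia.
  move: e; have : x = 2 * (2 * x - y) + (2 * y - 3 * x) by lia.
  have : y = 2 * (2 * y - 3 * x) + 3 * (2 * x - y) by lia.
  by move: (2 * x - y) (2 * y - 3 * x) => u v -> ->; lia.
exists l.+1; rewrite pell_xS pell_yS -xE -yE; lia.
Qed.

Lemma pell_x_step2 n : 13 * pell_x n <= pell_x n.+2.
Proof.
rewrite !pell_xS pell_yS; have : 6 * pell_x n <= 4 * pell_y n; last by lia.
by rewrite -leq_sqr -!mulnn; have := pell3 n; lia.
Qed.

Lemma pell_x_power m n : 13 ^ m * pell_x n <= pell_x (n + 2 * m).
Proof.
elim: m => [|m IH]; first by rewrite mul1n muln0 addn0.
have -> : n + 2 * m.+1 = (n + 2 * m).+2 by lia.
apply: leq_trans (pell_x_step2 _); rewrite expnS -mulnA.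
by rewrite leq_mul2l IH.
Qed.

Lemma pell_x_leq k l : k <= l -> pell_x k <= pell_x l.
Proof. by rewrite leq_eqVlt => /orP[/eqP->//|/pell_x_ltn]; lia. Qed.

Lemma power_absorb t : 8 <= t -> (4 * t ^ 6) ^ 6 <= t ^ 40.
Proof.
move=> t8; rewrite expnMn -expnM; have -> : t ^ 40 = t ^ 4 * t ^ (6 * 6) by rewrite -expnD.
by apply: leq_mul => //; apply: (@leq_trans (8 ^ 4)) => //; rewrite leq_exp2r.
Qed.

(** From the index 5 to the index 91 the sequence [x] is multiplied by at least
    [13^43], since two steps multiply it by 13 or more ([pell_x_step2]). *)
Lemma pell_x_far k l : k <= 5 -> 90 < l ->
  33 * pell_x k * (390 * (pell_x k * pell_x k)) ^ 6 <= pell_x l.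
Proof.
move=> k5 l90.
have a5 := pell_x_leq k5.
have l91 : 5 + 2 * 43 <= l by [].
apply: leq_trans (pell_x_leq l91); apply: leq_trans (pell_x_power _ _).
have aE : pell_x k <= 17 * 13 by apply: leq_trans a5 _.
have sq : 390 * (pell_x k * pell_x k) <= 4 * 13 ^ 6.
  apply: (@leq_trans (30 * 13 * (17 * 13 * (17 * 13)))).
    by rewrite leq_mul2l leq_mul.
  rewrite (_ : 30 * 13 * _ = 30 * (17 * 17) * 13 ^ 3); last by rewrite !expnS expn0; ring.
  have -> : 4 * 13 ^ 6 = 4 * 13 ^ 3 * 13 ^ 3 by rewrite -mulnA -expnD.
  by apply: leq_mul; [clear; lia | exact: leqnn].
have p6 : (390 * (pell_x k * pell_x k)) ^ 6 <= 13 ^ 40.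
  apply: (@leq_trans ((4 * 13 ^ 6) ^ 6)); first by rewrite leq_exp2r.
  exact: (@power_absorb 13 isT).
rewrite -mulnA (mulnC (pell_x k)) mulnA.
rewrite (expnD 13 3 40 : 13 ^ 43 = _); apply: leq_mul a5; apply: leq_mul p6.
by clear; lia.
Qed.

Section Regular.
Variables (k l z : nat).
Hypothesis kl : k < l.
Hypothesis zE : z * z = (2 * (pell_x k * pell_x k) + 1) * (2 * (pell_x l * pell_x l) + 1) + 1.

Let index_eq m : pell_x l = pell_x m -> l = m.
Proof. exact: pell_x_inj. Qed.

(** [e_0 = 1]: put [z = 2 c] to find [x_l^2 + 1 = 2 c^2]. *)
Lemma regular0 : k = 0 -> l = 1.
Proof.
move=> k0; apply: index_eq; move: zE; rewrite k0 => e.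
have ze : ~~ odd z by have := congr1 odd e; rewrite oddD !oddM; lia.
have e2 : pell_x l * pell_x l + 1 = 2 * (z./2 * z./2).
  have h : z = 2 * z./2 by lia.
  by move: e; rewrite {1 2}h (_ : pell_x 0 = 0) //; lia.
by rewrite (pell3_x_plus_one (pell3 l) e2).
Qed.

(** [e_1 = 3]: put [z = 2 w] to find [y_l^2 + 1 = 2 w^2]. *)
Lemma regular1 : k = 1 -> l = 2.
Proof.
move=> k1; apply: index_eq; move: zE; rewrite k1 => e.
have ze : ~~ odd z by have := congr1 odd e; rewrite oddD !oddM; lia.
have e2 : pell_y l * pell_y l + 1 = 2 * (z./2 * z./2).
  have h : z = 2 * z./2 by lia.
  by move: e; rewrite pell3 {1 2}h (_ : pell_x 1 = 1) //; lia.
have [x0|->//] := pell3_y_plus_one (pell3 l) e2.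
have l0 : l = 0 by apply: pell_x_inj.
by move: kl; rewrite l0.
Qed.

(** [e_2 = 33]: [z = 2 w] and [y_l = 2 c] give [w^2 = 22 c^2 + 3]. *)
Lemma regular2 : k = 2 -> l = 3.
Proof.
move=> k2; apply: index_eq; move: zE; rewrite k2 => e.
have h2 : pell_x 2 = 4 by [].
have ze : ~~ odd z by have := congr1 odd e; rewrite oddD !oddM; lia.
have h : z = 2 * z./2 by lia.
have e2 : 2 * (z./2 * z./2) = 33 * (pell_x l * pell_x l) + 17.
  by move: e; rewrite {1 2}h h2; lia.
have xo : odd (pell_x l) by have := congr1 odd e2; rewrite oddD !oddM /=; case: odd.
have ye : ~~ odd (pell_y l).
  by have := congr1 odd (pell3 l); rewrite oddD !oddM xo; case: odd.
have hy : pell_y l = 2 * (pell_y l)./2 by lia.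
have e3 := pell3 l; rewrite {1 2}hy in e3.
have e4 : 3 * (pell_x l * pell_x l) + 1 = 4 * ((pell_y l)./2 * (pell_y l)./2) by rewrite -e3; ring.
have e5 : z./2 * z./2 = 22 * ((pell_y l)./2 * (pell_y l)./2) + 3.
  by move: e2 e4; clear; lia.
have [c1|c13] := pell3_norm22 e4 e5; move: e4; rewrite ?c1 ?c13 => e4.
  have l1 : l = 1.
    apply: pell_x_inj; apply/eqP; rewrite -eqn_sqr -!mulnn (_ : pell_x 1 = 1) //.
    by move: e4; clear; lia.
  by move: kl; rewrite l1 k2.
apply/eqP; rewrite -eqn_sqr -!mulnn (_ : pell_x 3 = 15) //.
by move: e4; clear; lia.
Qed.

Let xk_gt : 2 < k -> 15 <= pell_x k.
Proof.
rewrite leq_eqVlt => /orP[/eqP <- //|/pell_x_ltn h].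
by rewrite (leq_trans _ (ltnW h)).
Qed.

Let zE_int : ((z%:Z) ^+ 2 = 2 * (2 * (pell_x k)%:Z ^+ 2 + 1) * (pell_x l)%:Z ^+ 2
  + (2 * (pell_x k)%:Z ^+ 2 + 1) + 1)%R.
Proof. by rewrite !expr2; move: zE; clear; lia. Qed.

Let pell3_int n : ((pell_y n)%:Z ^+ 2 = 3 * (pell_x n)%:Z ^+ 2 + 1)%R.
Proof. by rewrite !expr2; have := pell3 n; clear; lia. Qed.

Let y_gt0 n : (0 < (pell_y n)%:Z)%R.
Proof. by rewrite ltz_nat; apply: leq_ltn_trans (pell_y_gt n). Qed.

Let z_gt0 : (0 < z%:Z)%R.
Proof. by rewrite ltz_nat; move: zE; case: (z) => // e; exfalso; move: e; clear; lia. Qed.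

Let x_ge : (3 * (pell_x k)%:Z <= (pell_x l)%:Z)%R.
Proof. by have := pell_x_ltn kl; clear; lia. Qed.

Let xk_ge : 2 < k -> (15 <= (pell_x k)%:Z)%R.
Proof. by move=> /xk_gt; rewrite -lez_nat. Qed.

Lemma regular_small : 3 <= k <= 5 -> l = k.+1.
Proof.
move=> hk; apply/eqP; apply: contraT => lk; exfalso.
have k2 : k + 2 <= l by move: kl lk; clear; lia.
have [l90|l90] := leqP l 90; first by apply: (middle_range hk _ zE); rewrite k2 l90.
have /andP[k3 k5] := hk.
apply: (far_no_solution Rdefinitions.R (y_gt0 k) (y_gt0 l) z_gt0 (pell3_int k) (pell3_int l)
  zE_int (xk_ge k3) x_ge).
have := pell_x_far k5 l90; rewrite -lez_nat -[in X in (X <= _)%R]natz.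
by rewrite natrM natrX !natrM !natz -expr2.
Qed.

Lemma regular_large : 6 <= k -> l = k.+1.
Proof.
move=> k6; apply: index_eq; rewrite pell_xS.
have x6 : (780 <= (pell_x k)%:Z)%R.
  rewrite lez_nat; move: k6; rewrite leq_eqVlt => /orP[/eqP <- //|/pell_x_ltn h].
  by rewrite (leq_trans _ (ltnW h)).
have k3 : 2 < k by apply: leq_trans k6.
have := large_regular Rdefinitions.R (y_gt0 k) (y_gt0 l) z_gt0 (pell3_int k) (pell3_int l)
  zE_int (xk_ge k3) x_ge x6.
by clear; lia.
Qed.

Lemma regular : l = k.+1.
Proof.
have [k6|] := leqP 6 k; first exact: regular_large.
case E : k => [|[|[|k']]] h.
- exact: regular0.
- exact: regular1.
- exact: regular2.
by rewrite -E; apply: regular_small; rewrite E.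
Qed.

End Regular.

(** * Squares in the quadratic ring, and the theorem *)

Local Open Scope ring_scope.

Lemma dseq_nat_pell n : dseq_nat n = - (2 * (pell_x n)%:Z ^+ 2 + 1).
Proof.
suff [//] : dseq_nat n = - (2 * (pell_x n)%:Z ^+ 2 + 1) /\
  dseq_nat n.+1 = - (2 * (pell_x n.+1)%:Z ^+ 2 + 1).
elim: n => [//|n [IH0 IH1]]; split=> //.
have -> : dseq_nat n.+2 = 14 * dseq_nat n.+1 - dseq_nat n + 8 by [].
rewrite IH0 IH1 !pell_xS pell_yS; have := pell3 n.
rewrite !expr2; move: (pell_x n) (pell_y n) => x y; clear; lia.
Qed.

Lemma zsqrt_int D (n : int) : n%:~R = Zsqrt D n 0.
Proof.
have natE (m : nat) : m%:R = Zsqrt D m 0.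
  by elim: m => [|m IH] //; rewrite -addn1 natrD IH; congr Zsqrt; rewrite /= addn1; lia.
case: n => m; first exact: natE.
rewrite NegzE intrN -pmulrn natE.
by congr Zsqrt; rewrite /= oppr0.
Qed.

(** The imaginary part of [(a + b sqrt -2)^2] is [2 a b]; it vanishes only if
    [a] or [b] does. *)
Lemma zsqrt_square (n : int) (w : zsqrt (-2)) : n%:~R = w ^+ 2 ->
  exists a : int, n = a ^+ 2 \/ n = - (2 * a ^+ 2).
Proof.
case: w => a b; rewrite zsqrt_int expr2 => -[nE ab].
have /eqP : a * b = 0 by move: ab; clear; lia.
rewrite mulf_eq0 => /orP[] /eqP e; rewrite nE e.
  by exists b; right; ring.
by exists a; left; ring.
Qed.

Lemma square_pos n : 0 < n -> (exists a : int, n = a ^+ 2 \/ n = - (2 * a ^+ 2)) ->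
  exists a : nat, n = a%:Z ^+ 2.
Proof.
move=> n0 [a [aE|aE]]; first by exists `|a|%N; rewrite aE abszE real_normK ?num_real.
by have := sqr_ge0 a; move: n0; rewrite aE; clear; lia.
Qed.

Lemma square_npos n : n <= 0 -> (exists a : int, n = a ^+ 2 \/ n = - (2 * a ^+ 2)) ->
  exists a : nat, n = - (2 * a%:Z ^+ 2).
Proof.
move=> n0 [a [aE|aE]]; last by exists `|a|%N; rewrite aE abszE real_normK ?num_real.
exists 0%N; rewrite expr0n mulr0 oppr0; have := sqr_ge0 a; move: n0; rewrite aE; clear; lia.
Qed.

Lemma regular_pair k l (z : nat) : k != l ->
  (dseq_nat k) * (dseq_nat l) + 1 = z%:Z ^+ 2 -> l = k.+1 \/ k = l.+1.
Proof.
rewrite !dseq_nat_pell mulrNN neq_ltn => h e.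
have e' : (z * z = (2 * (pell_x k * pell_x k) + 1) * (2 * (pell_x l * pell_x l) + 1) + 1)%N.
  by move: e; rewrite !expr2; move: (pell_x k) (pell_x l); clear; lia.
case/orP: h => h; [left | right]; first exact: regular h e'.
by apply: (regular h (z := z)); rewrite e' [in RHS]mulnC.
Qed.

Theorem theorem1p1 (k : nat) (d : int) :
  diophantine_quadruple
    [tuple (1 : zsqrt (- 2)); 3; (dseq k%:Z)%:~R; d%:~R] ->
  d = dseq (k%:Z - 1) \/ d = dseq (k%:Z + 1).
Proof.
case=> nz neq sq.
pose i0 : 'I_4 := @Ordinal 4 0 isT; pose i1 : 'I_4 := @Ordinal 4 1 isT.
pose i2 : 'I_4 := @Ordinal 4 2 isT; pose i3 : 'I_4 := @Ordinal 4 3 isT.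
have sq1 : exists a : int, d + 1 = a ^+ 2 \/ d + 1 = - (2 * a ^+ 2).
  have [w wE] := sq i0 i3 isT; apply: (@zsqrt_square _ w).
  by rewrite -wE intrD mul1r.
have sq3 : exists a : int, 3 * d + 1 = a ^+ 2 \/ 3 * d + 1 = - (2 * a ^+ 2).
  have [w wE] := sq i1 i3 isT; apply: (@zsqrt_square _ w).
  by rewrite -wE intrD intrM.
have sqk : exists a : int, dseq k * d + 1 = a ^+ 2 \/ dseq k * d + 1 = - (2 * a ^+ 2).
  have [w wE] := sq i2 i3 isT; apply: (@zsqrt_square _ w).
  by rewrite -wE intrD intrM.
have dk : d <> dseq k by move=> e; have := neq i2 i3 isT; rewrite e eqxx.
have d0 : d <> 0 by move=> e; have := nz i3; rewrite e eqxx.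
have d1 : d <> 1 by move=> e; have := neq i0 i3 isT; rewrite e eqxx.
have dkE : dseq k = - (2 * (pell_x k)%:Z ^+ 2 + 1) := dseq_nat_pell k.
have x2 : 0 <= (pell_x k)%:Z ^+ 2 by apply: sqr_ge0.
have [dpos|dneg] := ltrP 0 d.
  exfalso.
  have [a aE] : exists a : nat, d + 1 = a%:Z ^+ 2 by apply: square_pos sq1; lia.
  have [b bE] : exists b : nat, 3 * d + 1 = b%:Z ^+ 2 by apply: square_pos sq3; lia.
  have [c cE] : exists c : nat, dseq k * d + 1 = - (2 * c%:Z ^+ 2).
    apply: square_npos sqk; rewrite dkE; move: ((pell_x k)%:Z ^+ 2) x2 d1 dpos => u; clear; nia.
  (* [d_k] is odd and [d_k d + 1] is even, so [d] is odd; but then [a] and [b]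
     are even and [3 a^2 - b^2 = 2], impossible modulo 4 *)
  have dodd : exists m, d = 2 * m + 1.
    exists (c%:Z ^+ 2 - (pell_x k)%:Z ^+ 2 * d).
    by move: cE; rewrite dkE; clear; lia.
  have [m mE] := dodd.
  have [[a' [a'E|a'E]] [b' [b'E|b'E]]] := (half_int a, half_int b);
    by move: aE bE; rewrite ?a'E ?b'E mE !expr2; clear; lia.
have [x xE] : exists x : nat, d + 1 = - (2 * x%:Z ^+ 2) by apply: square_npos sq1; lia.
have [y yE] : exists y : nat, 3 * d + 1 = - (2 * y%:Z ^+ 2) by apply: square_npos sq3; lia.
have [l [xl _]] : exists l, x = pell_x l /\ y = pell_y l.
  by apply: pell3_complete; move: xE yE; rewrite !expr2; clear; lia.
have dE : d = dseq_nat l by rewrite dseq_nat_pell -xl; move: xE; clear; lia.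
have [z zE] : exists z : nat, dseq_nat k * dseq_nat l + 1 = z%:Z ^+ 2.
  apply: square_pos; last by rewrite -dE; exact: sqk.
  rewrite !dseq_nat_pell mulrNN; have := sqr_ge0 (pell_x l)%:Z.
  by move: x2; clear; nia.
have kl : k != l by apply/eqP => e; apply: dk; rewrite dE -e.
rewrite dE; case: (regular_pair kl zE) => ->.
  by right; rewrite (_ : k%:Z + 1 = k.+1%:Z) //; lia.
by left; rewrite (_ : l.+1%:Z - 1 = l%:Z) //; lia.
Qed.
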